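(* Let $F_\infty$ be the canonical one-sided graph of a nested fractal, let $\mu=\lim_{n\to\infty}c_n^{1/n}$ be its connective constant, and let $\mathcal B$ and $\beta_{\mathrm c}=\inf\mathcal B$ be as in the context. (i) The critical inverse temperature $\beta_{\mathrm c}$ is finite, and $\mu=e^{\beta_{\mathrm c}}$. (ii) If $\beta_{\mathrm c}=\min\mathcal B$ (i.e. the infimum is attained), then there are constants $A\ge1$ and $p\ge0$ such that $$A^{-1}\mu^n n^{-p}\le c_n\le A\mu^n n^p,\qquad n\ge1.$$
   Context: **Nested fractal.** Fix $d\ge1$, $M\ge2$, $\mathcal I=\{0,\dots,M-1\}$, $\lambda>1$, and contractive similitudes $\Psi_i(x)=\lambda^{-1}U_ix+\nu_i$ of $\mathbb R^d$ ($i\in\mathcal I$) with $U_i$ orthogonal. $K$ is the unique nonempty compact set with $K=\bigcup_{i}\Psi_i(K)$. Let $p_i$ be the fixed point of $\Psi_i$; $p_i$ is essential if there are a fixed point $p_j$ and distinct $k,\ell\in\mathcal I$ with $\Psi_k(p_i)=\Psi_\ell(p_j)$. $V_0=\{q_0,\dots,q_{b-1}\}$ is the set of essential fixed points, $b=\#V_0\ge2$. For a word $w=w_1\cdots w_r\in\mathcal I^r$, $\Psi_w=\Psi_{w_1}\circ\cdots\circ\Psi_{w_r}$ ($\Psi_\emptyset=\mathrm{id}$), $|w|=r$, $K_w=\Psi_w(K)$ is a level-$r$ fractal cell and $\partial K_w=\Psi_w(V_0)$ its boundary. For distinct $x,y\in V_0$, $\mathscr R_{x,y}$ is the reflection in the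 hyperplane $\{z:|z-x|=|z-y|\}$. $K$ is a nested fractal if: (NF1) there is a nonempty bounded open set $\mathcal U$ with $\Psi_i(\mathcal U)\cap\Psi_j(\mathcal U)=\varnothing$ for $i\ne j$ and $\bigcup_i\Psi_i(\mathcal U)\subset\mathcal U$; (NF2) $K$ is connected; (NF3) for all distinct $x,y\in V_0$, $\mathscr R_{x,y}$ preserves $V_0$ and, for each $r\ge1$, permutes the level-$r$ fractal cells together with their boundaries; (NF4) for distinct $i,j\in\mathcal I$, $\Psi_i(K)\cap\Psi_j(K)=\Psi_i(V_0)\cap\Psi_j(V_0)$. Standing assumption (one-point intersection): $\#(\Psi_u(V_0)\cap\Psi_v(V_0))\le1$ whenever $u\ne v$, $|u|=|v|$. **Graphs.** $\delta_0=\min\{|x-y|:x\neq y\in V_0\}$; $F_0$ is the graph on $V_0$ with edges $\{x,y\}$ with $|x-y|=\delta_0$. Choose $O\in V_0$ and label the maps so that $\Psi_0(O)=O$. Put $F_m=\bigcup_{w\in\mathcal I^m}(\Psi_0^{-m}\circ\Psi_w)(F_0)$ (union of image graphs; $\Psi_0^{-m}$ is the $m$-fold inverse iterate), $F_\infty=\bigcup_{m\ge0}F_m$, $\partial F_m=\Psi_0^{-m}(V_0)$, and $\iota_m:V_0\to\partial F_m$, $\iota_m(q)=\Psi_0^{-m}(q)$. **Walks.** $c_n$ is the number of self-avoiding walks (sequences of $n+1$ distinct vertices of $F_\infty$, consecutive ones adjacent) of length $n$ starting at $O$. The limit $\mu=\lim c_n^{1/n}$ exists and is called the connective constant. **Boundary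 states.** A linear forest is an acyclic graph all of whose vertices have degree at most two. A boundary forest in $F_m$ is a nonempty edge subgraph $\Gamma\subset F_m$ that is a linear forest, all of whose degree-one vertices belong to $\partial F_m$, and each of whose connected components contains at least one edge. $\mathcal S$ is the finite set of abstract boundary forests: nonempty linear forests with vertex set contained in $V_0$ and without isolated vertices. The boundary trace $\operatorname{tr}_m(\Gamma)\in\mathcal S$ (the boundary state of $\Gamma$) is obtained, for each component (a path) of $\Gamma$, by listing the boundary vertices in $\partial F_m$ in the order the path meets them, keeping only these, replacing each portion between two consecutive listed vertices by one abstract edge, and relabeling by $\iota_m^{-1}$. For $\sigma\in\mathcal S$ let $\mathcal C_m(\sigma)$ be the set of boundary forests $\Gamma\subset F_m$ with $\operatorname{tr}_m(\Gamma)=\sigma$, and for $\beta\ge0$ $$Z_m^\sigma(\beta)=\sum_{\Gamma\in\mathcal C_m(\sigma)}e^{-\beta\#E(\Gamma)},\qquad \mathbf Z_m(\beta)=(Z_m^\sigma(\beta))_{\sigma\in\mathcal S}.$$ Finally $\mathcal B=\{\beta\ge0:\sup_{m\ge0}\|\mathbf Z_m(\beta)\|_\infty<\infty\}$ and $\beta_{\mathrm c}=\inf\mathcal B\in[0,\infty]$ is the critical inverse temperature. *)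

(* Defs.v *)
From HB Require Import structures.
From mathcomp Require Import all_boot all_order all_algebra finmap.
From mathcomp Require Import all_classical all_reals all_analysis.
Set Implicit Arguments.
Unset Strict Implicit.
Unset Printing Implicit Defensive.
Import Order.TTheory GRing.Theory Num.Theory.
Import numFieldNormedType.Exports.
Local Open Scope classical_set_scope.
Local Open Scope ring_scope.

Section Euclid.
Context {R : realType} {d : nat}.
Implicit Types x y z : 'cV[R]_d.

Definition dot x y : R := \sum_(k < d) x k 0 * y k 0.

(* The library norm `|x| on 'cV_d is the sup norm; distances are Euclidean.
   The two norms have the same topology and the same bounded sets. *)
Definition enorm x : R := Num.sqrt (dot x x).

(* For x != y, the reflection in the hyperplane {z : |z - x| = |z - y|}, which
   has normal x - y and contains the midpoint of x and y. *)
Definition reflection x y z : 'cV[R]_d :=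
  z - (2 * dot (z - 2^-1 *: (x + y)) (x - y) / dot (x - y) (x - y))
        *: (x - y).

End Euclid.

Record similitudes (R : realType) (d M : nat) := Similitudes {
  ratio : R;
  rot : 'I_M -> 'M[R]_d;
  shift : 'I_M -> 'cV[R]_d }.

Section Fractal.
Context {R : realType} {d M : nat} (S : similitudes R d M).
Local Notation point := 'cV[R]_d.

Definition Psi (i : 'I_M) (x : point) : point :=
  (ratio S)^-1 *: (rot S i *m x) + shift S i.

(* Inverse of Psi i when ratio S != 0 and rot S i is invertible. *)
Definition Psi_inv (i : 'I_M) (x : point) : point :=
  ratio S *: (invmx (rot S i) *m (x - shift S i)).

Definition Psi_word (w : seq 'I_M) (x : point) : point := foldr Psi x w.

Definition V0 : set point :=
  [set p | exists i j k l q,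
     [/\ Psi i p = p, Psi j q = q, k != l & Psi k p = Psi l q]].

Definition cells (K : set point) (r : nat) : set (set point * set point) :=
  [set (Psi_word w @` K, Psi_word w @` V0) | w in [set w | size w = r]].

Record attractor (K : set point) : Prop := Attractor {
  attractor_neq0 : K !=set0;
  attractor_compact : compact K;
  attractor_eq : K = \bigcup_(i in [set: 'I_M]) Psi i @` K }.

Record nested_fractal (K : set point) : Prop := NestedFractal {
  nf_dim : (1 <= d)%N;
  nf_maps : (2 <= M)%N;
  nf_scale : 1 < ratio S;
  nf_orthogonal : forall i, rot S i *m (rot S i)^T = 1%:M;
  nf_attractor : attractor K;
  nf_boundary : (2 <= #|` fset_set V0|)%N;
  nf1 : exists U : set point,
    [/\ U !=set0, bounded_set U, open U,
        forall i j, i != j -> Psi i @` U `&` Psi j @` U = set0 &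
        \bigcup_(i in [set: 'I_M]) Psi i @` U `<=` U];
  nf2 : connected K;
  nf3 : forall x y, V0 x -> V0 y -> x != y ->
    reflection x y @` V0 = V0 /\
    forall r, (1 <= r)%N ->
      [set (reflection x y @` c.1, reflection x y @` c.2) | c in cells K r]
      = cells K r;
  nf4 : forall i j, i != j ->
    Psi i @` K `&` Psi j @` K = Psi i @` V0 `&` Psi j @` V0 }.

Definition one_point_intersection : Prop :=
  forall u v : seq 'I_M, u != v -> size u = size v ->
    is_subset1 (Psi_word u @` V0 `&` Psi_word v @` V0).

End Fractal.

(* Edges are sets {x, y} of two endpoints. *)
Record graph (T : choiceType) := Graph {
  vertices : set T;
  edges : set {fset T} }.

Section Graph.
Context {T : choiceType}.
Implicit Types (H : graph T) (G : {fset {fset T}}) (x y : T) (s : seq T).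

Definition image_graph (f : T -> T) H : graph T :=
  Graph (f @` vertices H) [set [fset f x | x in e]%fset | e in edges H].

Definition union_graph {I : Type} (D : set I) (H : I -> graph T) : graph T :=
  Graph (\bigcup_(i in D) vertices (H i)) (\bigcup_(i in D) edges (H i)).

Definition saw H o (n : nat) : set (n.+1.-tuple T) :=
  [set s | [/\ thead s = o, forall x, x \in s -> vertices H x, uniq s &
    sorted (fun x y => `[< edges H [fset x; y]%fset >]) s]].

(* A finite graph without isolated vertices is given by its set of edges. *)
Definition adj G x y : bool := [fset x; y]%fset \in G.

Definition degree G x : nat := #|` [fset e in G | x \in (e : {fset T})]%fset|.

Definition acyclic G : Prop :=
  forall s, (3 <= size s)%N -> uniq s -> ~~ cycle (adj G) s.

Definition linear_forest G : Prop :=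
  acyclic G /\ forall x, (degree G x <= 2)%N.

(* For a linear forest G, s enumerates a connected component of G, which is a path, from one end to
   the other. *)
Definition component_path G s : Prop :=
  [/\ (2 <= size s)%N, uniq s, sorted (adj G) s &
      forall x y, x \in s -> adj G x y -> y \in s].

End Graph.

Arguments saw {T} H o n.

(* i0 is the index of the map fixing the origin O of the unbounded graph. *)
Section Model.
Context {R : realType} {d M : nat} (S : similitudes R d M) (i0 : 'I_M).
Local Notation point := 'cV[R]_d.

(* V0 S is finite, so that the infimum is a minimum. *)
Definition delta0 : R :=
  inf [set r | exists x y, [/\ V0 S x, V0 S y, x != y & r = enorm (x - y)]].

Definition F0 : graph point :=
  Graph (V0 S)
    [set e | exists x y, [/\ V0 S x, V0 S y, x != y,
       enorm (x - y) = delta0 & e = [fset x; y]%fset]].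

Definition Fm (m : nat) : graph point :=
  union_graph [set w : seq 'I_M | size w = m]
    (fun w => image_graph (iter m (Psi_inv S i0) \o Psi_word S w) F0).

Definition Finf : graph point := union_graph [set: nat] Fm.

Definition embed (m : nat) (q : point) : point := iter m (Psi_inv S i0) q.

Definition boundary (m : nat) : set point := embed m @` V0 S.

(* fset_set of an infinite set is empty; the walks of a given length from a
   point are finitely many, since Finf is locally finite. *)
Definition saw_count (o : point) (n : nat) : nat :=
  #|` fset_set (saw Finf o n)|.

Definition saw_root (o : point) (n : nat) : R :=
  (saw_count o n)%:R `^ (n%:R)^-1.

Definition connective_constant (o : point) : R := limn (saw_root o).

(* Given by their edge sets, so that no component is an isolated vertex. *)
Definition boundary_forest (m : nat) (G : {fset {fset point}}) : Prop :=
  [/\ G != fset0, [set` G] `<=` edges (Fm m), linear_forest G &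
      forall x, degree G x = 1%N -> boundary m x].

Definition states : set {fset {fset point}} :=
  [set sigma : {fset {fset point}} | [/\ sigma != fset0,
     forall e : {fset point}, e \in sigma -> #|` e| = 2 /\ [set` e] `<=` V0 S &
     linear_forest sigma]].

(* In each component, consecutive boundary vertices embed m x, embed m y give
   an abstract edge {x, y}. *)
Definition trace (m : nat) (G : {fset {fset point}}) : set {fset point} :=
  [set e | exists s x y, [/\ component_path G s, V0 S x, V0 S y,
     infix [:: embed m x; embed m y] [seq z <- s | `[< boundary m z >]] &
     e = [fset x; y]%fset]].

Definition forests (m : nat) (sigma : {fset {fset point}}) :
    set {fset {fset point}} :=
  [set G | boundary_forest m G /\ trace m G = [set` sigma]].

(* A finite sum, as Fm m has finitely many edges. *)
Definition Zm (m : nat) (sigma : {fset {fset point}}) (beta : R) : R :=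
  \sum_(G \in forests m sigma) expR (- beta * #|` G|%:R).

Definition Z_norm (m : nat) (beta : R) : \bar R :=
  ereal_sup [set `|Zm m sigma beta|%:E | sigma in states].

Definition bounded_betas : set R :=
  [set beta | 0 <= beta /\
     (ereal_sup [set Z_norm m beta | m in [set: nat]] < +oo)%E].

Definition beta_c : \bar R := ereal_inf [set beta%:E | beta in bounded_betas].

End Model.

(* Main.v *)
Require Import Defs.
From HB Require Import structures.
From mathcomp Require Import all_boot all_order all_algebra finmap.
From mathcomp Require Import all_classical all_reals all_analysis.
From mathcomp Require Import zify lra ring.
Set Implicit Arguments.
Unset Strict Implicit.
Unset Printing Implicit Defensive.
Import Order.TTheory GRing.Theory Num.Theory.
Import numFieldNormedType.Exports.
Local Open Scope classical_set_scope.
Local Open Scope ring_scope.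

(* The graphs [F_m] form a finitely ramified hierarchy: [F_(m+1)] consists of [M] copies of [F_m]
   glued at boundary vertices, each boundary vertex of [F_(m+1)] lies in a single copy, and the
   reflections act transitively on the boundary.  Let [q_m] be the total weight of the boundary
   forests of [F_m]; boundedness of [q_m] in [m] is boundedness of the vectors [Z_m].

   A boundary forest of [F_(m+1)] has at least two leaves, so it meets at least two cells and
   [q_(m+1) <= 2^M q_m^2] if [q_m <= 1].  Hence [q_m <= 2^-M] persists, so that the set of bounded
   [beta] is nonempty and [q_m > 2^-M] for all [m] if [beta < beta_c].  Forests are made of paths
   between boundary vertices, so at [beta_c] these paths keep a weight bounded below at every level:
   for each [m] some [n] between [2^m] and [#|E(F_m)|] satisfies [c_n >= c e^(beta_c n) / #|E(F_m)|].
   Conversely, if [q_m] is bounded, then the weight of forests with at most two leaves off the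
   boundary is polynomial in [2^m]; a walk of length [n <= 2^m] meets at most one vertex of level
   [m], which gives [c_n <= A n^p e^(beta n)].

   Between such scales [c_n] is compared with the number of walks of length [n] from an arbitrary
   vertex, whose supremum is submultiplicative and therefore at least [e^(beta_c n)] by the bound
   along the scales.  A long walk either reaches a vertex of a level [l] whose cells have diameter
   much smaller than [n], and goes on from there, or comes close to one.  This needs the diameter of
   a cell to be comparable to the distance of two of its boundary vertices: a path crossing a cell
   is folded by the reflections into paths between all pairs of boundary vertices. *)

(** * Linear forests *)

(** Criticality yields lower bounds only at one uncontrolled length [n'] per level, anywhere between
    [2 ^ m] and a constant times a power of it. If [beta_c] is attained, a walk of length [n'] may
    be cut after [n] steps: the continuations number at most a polynomial times
    [e^(beta_c (n' - n))], with the exact rate, so only a power of [n] is lost. For (i) merely the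
    rates [beta_c + delta] are available from above, and [e^(delta n')] cannot be afforded, since
    [n'] may be far larger than any multiple of [n]. Submultiplicativity removes this gap, but only
    for walks with a free starting vertex; returning such a walk to the origin is the real work. A
    walk of length [N = C n] ([C] fixed before [delta]) is cut so that one factor counts [n] steps
    from a boundary vertex, which symmetry moves to the origin, and the rest is bounded at rate
    [beta_c + delta]. If the walk only comes close to a boundary vertex, a geodesic from there is
    put in front, at the point where the walk is nearest; this lengthens the total by at most the
    diameter [D] of a small cell, so [D] must be an arbitrarily small fraction of [n]. *)

Section LinearForests.
Local Open Scope nat_scope.
Local Open Scope fset_scope.
Context {T : choiceType}.
Implicit Types (G H : {fset {fset T}}) (x y z : T) (p q s : seq T).

Definition simple G := forall e, e \in G -> exists x y, x != y /\ e = [fset x; y].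

Lemma fset2C x y : [fset x; y] = [fset y; x].
Proof. by rewrite fsetUC. Qed.

Lemma fset2_inj x y z : [fset x; y] = [fset x; z] -> y = z.
Proof.
move=> h; have : y \in [fset x; z] by rewrite -h in_fset2 eqxx orbT.
rewrite in_fset2 => /orP[/eqP yx|/eqP //].
have : z \in [fset x; y] by rewrite h in_fset2 eqxx orbT.
by rewrite in_fset2 yx => /orP[/eqP|/eqP].
Qed.

Lemma fset2_eq x y x' y' : [fset x; y] = [fset x'; y'] ->
  (x = x' /\ y = y') \/ (x = y' /\ y = x').
Proof.
move=> e; have : x \in [fset x'; y'] by rewrite -e fset21.
rewrite in_fset2 => /orP[]/eqP E; [left|right]; split=> //; apply: (@fset2_inj x).
  by rewrite {2}E.
by rewrite e E fset2C.
Qed.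

Lemma imfset_fset2 (U : choiceType) (f : T -> U) x y :
  [fset f z | z in [fset x; y]] = [fset f x; f y].
Proof.
apply/fsetP => z; rewrite in_fset2; apply/imfsetP/orP => [[u /=]|].
  by rewrite in_fset2 => /orP[/eqP->|/eqP->] ->; [left|right].
by move=> [/eqP->|/eqP->]; [exists x|exists y]; rewrite //= in_fset2 eqxx ?orbT.
Qed.

Lemma adjC G x y : adj G x y = adj G y x.
Proof. by rewrite /adj fset2C. Qed.

Lemma adj_neq G x y : simple G -> adj G x y -> x != y.
Proof.
move=> sG /sG[u [v [uv e]]]; apply/eqP => xy; subst y.
have : u \in [fset x; x] by rewrite e in_fset2 eqxx.
have : v \in [fset x; x] by rewrite e in_fset2 eqxx orbT.
by rewrite !in_fset2 !orbb => /eqP vx /eqP ux; rewrite vx ux eqxx in uv.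
Qed.

Lemma simple_sub G H : H `<=` G -> simple G -> simple H.
Proof. by move=> /fsubsetP HG sG e /HG/sG. Qed.

Lemma simple_edge G e x : simple G -> e \in G -> x \in e ->
  exists2 y, x != y & e = [fset x; y].
Proof.
move=> sG /sG[u [v [uv ->]]]; rewrite in_fset2 => /orP[/eqP->|/eqP->].
  by exists v.
by exists u; rewrite 1?eq_sym 1?fset2C.
Qed.

Definition edges_at G x := [fset e in G | x \in (e : {fset T})].

Lemma in_edges_at G x e : (e \in edges_at G x) = (e \in G) && (x \in e).
Proof. by rewrite !inE. Qed.

Lemma degreeE G x : degree G x = #|` edges_at G x|.
Proof. by []. Qed.

Lemma degree_neighbours G x (s : seq T) : uniq s -> all (adj G x) s ->
  size s <= degree G x.
Proof.
move=> us /allP sG; rewrite degreeE.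
have us' : uniq [seq [fset x; y] | y <- s] by rewrite map_inj_uniq // => u v /fset2_inj.
rewrite -(size_map (fun y => [fset x; y])).
rewrite cardfE; apply: leq_trans (uniq_leq_size us' _) _; last first.
  by rewrite -cardfE.
move=> e /mapP[y ys ->]; rewrite in_edges_at in_fset2 eqxx andbT.
exact: sG.
Qed.

Lemma degree_sub G H x : H `<=` G -> degree H x <= degree G x.
Proof.
move=> /fsubsetP HG; apply/fsubset_leq_card/fsubsetP => e.
by rewrite !in_edges_at => /andP[/HG -> ->].
Qed.

Lemma adj_sub G H x y : H `<=` G -> adj H x y -> adj G x y.
Proof. by move=> /fsubsetP HG /HG. Qed.

Lemma sub_cycle_adj G H s : H `<=` G -> cycle (adj H) s -> cycle (adj G) s.
Proof.
by move=> HG; apply: sub_cycle => x y; apply: adj_sub.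
Qed.

Lemma linear_forest_sub G H : H `<=` G -> linear_forest G -> linear_forest H.
Proof.
move=> HG [aG dG]; split=> [s s3 us|x]; last exact: leq_trans (degree_sub _ HG) _.
by apply/negP => /(sub_cycle_adj HG); apply/negP/aG.
Qed.

(* The rank [f] orders each component along a path. *)
Lemma linear_forest_rank G (f : T -> nat) : simple G ->
  (forall x y, adj G x y -> f x != f y) ->
  (forall x y z, adj G x y -> adj G x z -> f x < f y -> f x < f z -> y = z) ->
  (forall x y z, adj G x y -> adj G x z -> f y < f x -> f z < f x -> y = z) ->
  linear_forest G.
Proof.
move=> sG fne fup fdn; split=> [s s3 us|x].
  apply/negP => cs.
  have s0 : exists n, has (fun x => f x == n) s.
    case: s s3 {us cs} => // x s _; exists (f x); by rewrite /= eqxx.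
  (* The vertex of least rank on the cycle has two different neighbours of larger rank. *)
  case: (ex_minnP s0) => n /hasP[x xs /eqP fx] nmin.
  case: (rot_to xs) => i q e.
  have cq : cycle (adj G) (x :: q) by rewrite -e rot_cycle.
  have uq : uniq (x :: q) by rewrite -e rot_uniq.
  have sq : 3 <= size (x :: q) by rewrite -e size_rot.
  have minq y : y \in q -> f x <= f y.
    move=> yq; rewrite fx; apply: nmin; apply/hasP; exists y => //.
    by rewrite -(mem_rot i) e inE yq orbT.
  case: q e cq uq sq minq => [//|y q] e cq uq sq minq.
  case/lastP: q e cq uq sq minq => [//|q z] e cq uq sq minq.
  have xy : adj G x y by move: cq => /= /andP[].
  have xz : adj G x z.
    by move: cq; rewrite /= rcons_path last_rcons => /andP[_ /andP[_]]; rewrite adjC.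
  have yz : y != z.
    move: uq; rewrite /= => /and3P[_ + _]; rewrite mem_rcons inE negb_or => /andP[+ _].
    by [].
  case/eqP: yz; apply: (fup x) => //; rewrite ltn_neqAle fne //=; apply: minq.
    by rewrite inE eqxx.
  by rewrite inE mem_rcons inE eqxx orbT.
rewrite degreeE leqNgt; apply/negP.
have mm e : e \in edges_at G x -> exists2 y, adj G x y & e = [fset x; y].
  rewrite in_edges_at => /andP[eG xe]; case: (simple_edge sG eG xe) => y _ E.
  by exists y => //; rewrite /adj -E.
set l := enum_fset (edges_at G x); rewrite -/l in mm.
have {}mm e : e \in l -> exists2 y, adj G x y & e = [fset x; y] by apply: mm.
have ul : uniq l by exact: fset_uniq.
case: l mm ul => [|e1 [|e2 [|e3 l]]] //= mm ul _.
case: (mm e1) => [|y1 a1 E1]; first by rewrite !inE eqxx.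
case: (mm e2) => [|y2 a2 E2]; first by rewrite !inE eqxx orbT.
case: (mm e3) => [|y3 a3 E3]; first by rewrite !inE eqxx !orbT.
move: ul; rewrite !inE !negb_or => /and3P[/and3P[n12 n13 _] /andP[n23 _] _].
have d12 : y1 <> y2 by move=> h; rewrite E1 E2 h eqxx in n12.
have d13 : y1 <> y3 by move=> h; rewrite E1 E3 h eqxx in n13.
have d23 : y2 <> y3 by move=> h; rewrite E2 E3 h eqxx in n23.
have := fne _ _ a1; have := fne _ _ a2; have := fne _ _ a3.
(* Two of the three neighbours lie on the same side of [x] in rank, hence coincide. *)
rewrite !neq_ltn => /orP[l3|l3] /orP[l2|l2] /orP[l1|l1];
 solve [ by apply: d12; apply: (fup x) | by apply: d12; apply: (fdn x)
 | by apply: d13; apply: (fup x) | by apply: d13; apply: (fdn x)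
 | by apply: d23; apply: (fup x) | by apply: d23; apply: (fdn x)].
Qed.

Fixpoint path_edges x p : {fset {fset T}} :=
  if p is y :: q then [fset x; y] |` path_edges y q else fset0.

Lemma path_edges_sub G x p : (path_edges x p `<=` G) = path (adj G) x p.
Proof. by elim: p x => [|y p IH] x /=; rewrite ?fsub0set // fsubUset fsub1set IH. Qed.

Lemma path_path_edges x p : path (adj (path_edges x p)) x p.
Proof. by rewrite -path_edges_sub fsubset_refl. Qed.

Lemma path_edges_mem x p e z : e \in path_edges x p -> z \in e -> z \in x :: p.
Proof.
elim: p x => [|y p IH] x /=; rewrite inE // => /orP[|eyp ze].
  by rewrite inE => /eqP->; rewrite in_fset2 !inE => /orP[]->; rewrite ?orbT.
by rewrite inE (IH _ eyp ze) orbT.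
Qed.

Lemma path_edges_simple x p : uniq (x :: p) -> simple (path_edges x p).
Proof.
elim: p x => [|y p IH] x /= u e; rewrite inE // => /orP[|].
  rewrite inE => /eqP->; exists x, y; split=> //.
  by move: u => /andP[]; rewrite inE negb_or => /andP[].
by apply: IH; case/andP: u.
Qed.

Lemma card_path_edges x p : uniq (x :: p) -> #|` path_edges x p| = size p.
Proof.
elim: p x => [|y p IH] x u; first exact: cardfs0.
rewrite [path_edges _ _]/= cardfsU1 IH; last by case/andP: u.
suff -> : [fset x; y] \notin path_edges y p by [].
apply/negP => /path_edges_mem/(_ (fset21 _ _)).
by case/andP: u => /negP.
Qed.

Lemma path_edges_adj_nth x p u v : uniq (x :: p) -> adj (path_edges x p) u v ->
  index u (x :: p) = (index v (x :: p)).+1 \/ index v (x :: p) = (index u (x :: p)).+1.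
Proof.
elim: p x => [|y p IH] x; first by rewrite /adj inE.
move=> U; rewrite /adj [path_edges _ _]/= inE => /orP[|h].
  have xy : x != y by move: U => /= /andP[]; rewrite inE negb_or => /andP[].
  rewrite inE => /eqP E.
  have : u \in [fset x; y] by rewrite -E fset21.
  rewrite in_fset2 => /orP[/eqP hu|/eqP hu]; subst u.
    by move/fset2_inj: E => ->; right; rewrite /= eqxx (negbTE xy) eqxx.
  rewrite (fset2C x y) in E; move/fset2_inj: E => ->.
  by left; rewrite /= eqxx (negbTE xy) eqxx.
have U' : uniq (y :: p) by case/andP: U.
have xn z : z \in y :: p -> (x == z) = false.
  by move=> zp; apply/eqP => E; move: U; rewrite cons_uniq E zp.
have hu := path_edges_mem h (fset21 _ _); have hv := path_edges_mem h (fset22 _ _).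
have iE z : z \in y :: p -> index z (x :: y :: p) = (index z (y :: p)).+1.
  by move=> zp; rewrite [LHS]/= (xn z zp).
by rewrite !iE //; case: (IH y U' h) => ->; [left|right].
Qed.

Lemma path_edges_linear_forest x p : uniq (x :: p) -> linear_forest (path_edges x p).
Proof.
move=> U; set s := x :: p.
have m u v : adj (path_edges x p) u v -> u \in s /\ v \in s.
  by move=> h; split; apply: path_edges_mem h _; rewrite ?fset21 ?fset22.
have ii u v : u \in s -> index u s = index v s -> u = v.
  by move=> us E; rewrite -(nth_index x us) E nth_index // -index_mem -E index_mem.
apply: (@linear_forest_rank _ (fun z => index z s)) => [|u v h|u v w h h'|u v w h h'].
- exact: path_edges_simple.
- by case: (path_edges_adj_nth U h); rewrite -/s => ->; rewrite neq_ltn ltnSn ?orbT.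
- move=> l1 l2; apply: ii; first by case: (m _ _ h).
  move: (path_edges_adj_nth U h) (path_edges_adj_nth U h') l1 l2; rewrite -/s; lia.
- move=> l1 l2; apply: ii; first by case: (m _ _ h).
  move: (path_edges_adj_nth U h) (path_edges_adj_nth U h') l1 l2; rewrite -/s; lia.
Qed.

(** Only the first edge of a self-avoiding path contains its starting vertex, so the edge set gives
    back the path step by step. Walks from a fixed vertex can thus be counted as edge sets. *)
Lemma path_edges_inj x p q : uniq (x :: p) -> uniq (x :: q) ->
  path_edges x p = path_edges x q -> p = q.
Proof.
elim: p x q => [|y p IH] x [|z q] //= Up Uq E.
- by move/fsetP/(_ [fset x; z]): E; rewrite !inE eqxx.
- by move/fsetP/(_ [fset x; y]): E; rewrite !inE eqxx.
have xp a r : uniq [:: x, a & r] -> forall b, [fset x; b] \in path_edges a r -> False.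
  by move=> /= /andP[/negP n _] b /path_edges_mem/(_ (fset21 _ _)).
have yz : y = z.
  move/fsetP/(_ [fset x; y]): (E); rewrite inE inE eqxx => /esym.
  by rewrite inE => /orP[|/(xp _ _ Uq) //]; rewrite inE => /eqP/fset2_inj.
subst z; congr (_ :: _); apply: (IH y); [by case/andP: Up|by case/andP: Uq|].
apply/fsetP => e; move/fsetP/(_ e): E; rewrite !inE; case: eqP => //= -> _.
by apply/idP/idP => h; [case: (xp _ _ Up _ h)|case: (xp _ _ Uq _ h)].
Qed.

Lemma path_edges_cat x p q : path_edges x (p ++ q) = path_edges x p `|` path_edges (last x p) q.
Proof. by elim: p x => [|y p IH] x /=; rewrite ?fset0U // IH fsetUA. Qed.

Lemma path_edges_rcons x p z : path_edges x (rcons p z) = [fset last x p; z] |` path_edges x p.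
Proof. by rewrite -cats1 path_edges_cat /= fsetU0 fsetUC. Qed.

Definition rpath x p := rev (belast x p).

Lemma rpathE x p : last x p :: rpath x p = rev (x :: p).
Proof. by rewrite /rpath (lastI x p) rev_rcons. Qed.

Lemma path_edges_rev x p : path_edges (last x p) (rpath x p) = path_edges x p.
Proof.
elim: p x => [|y p IH] x //=.
by rewrite /rpath /= rev_cons path_edges_rcons -/(rpath y p) IH -(last_cons y) rpathE
  rev_cons last_rcons fset2C.
Qed.

(** An inner vertex has two different neighbours on the path. *)
Lemma path_edges_leaf x p z : uniq (x :: p) -> degree (path_edges x p) z = 1 ->
  z = x \/ z = last x p.
Proof.
move=> U d1.
have /fset0Pn[e] : edges_at (path_edges x p) z != fset0 by rewrite -cardfs_gt0 -degreeE d1.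
rewrite in_edges_at => /andP[ep /(path_edges_mem ep)].
rewrite inE => /orP[/eqP|zp]; first by left.
case/splitPr: zp U d1 ep => p1 [|v p2] U d1 ep; first by right; rewrite last_cat.
have := path_path_edges x (p1 ++ [:: z, v & p2]).
set G := path_edges _ _ in d1 *; rewrite cat_path => /and4P[_ h1 h2 _].
have : size [:: last x p1; v] <= degree G z.
  apply: degree_neighbours => /=; last by rewrite h2 andbT adjC h1.
  rewrite inE andbT; apply/eqP => E.
  have : uniq ((x :: p1) ++ [:: z, v & p2]) by [].
  rewrite cat_uniq => /and3P[_ /hasPn/(_ v) + _].
  by rewrite !inE eqxx orbT -in_cons -E mem_last => /(_ isT).
by rewrite d1.
Qed.

Definition support G : {fset T} := \bigcup_(e <- G) e.

Lemma in_support G z : reflect (exists2 e, e \in G & z \in e) (z \in support G).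
Proof.
apply: (iffP (bigfcupP _ _ _ _)) => [[e]|[e eG ze]].
  by rewrite andbT; exists e.
by exists e; rewrite ?andbT.
Qed.

Lemma path_support G x p : path (adj G) x p -> {subset p <= support G}.
Proof.
elim: p x => [|y p IH] x //= /andP[xy yp] z; rewrite inE => /orP[/eqP->|].
  by apply/in_support; exists [fset x; y] => //; rewrite fset22.
exact: IH yp z.
Qed.

Lemma three_neighbours G x y1 y2 y3 : linear_forest G ->
  adj G x y1 -> adj G x y2 -> adj G x y3 -> y1 != y2 -> y3 != y1 -> y3 != y2 -> False.
Proof.
move=> [_ d] a1 a2 a3 n12 n31 n32.
have := @degree_neighbours G x [:: y3; y1; y2].
rewrite /= !inE negb_or n12 n31 n32 a1 a2 a3 => /(_ isT isT).
by rewrite ltnNge d.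
Qed.

(** A longest path through [x] is closed under adjacency: a neighbour off the path would prolong it
    at an end and would be a third neighbour of an inner vertex. *)
Lemma component_path_exists G x y : simple G -> linear_forest G -> adj G x y ->
  exists2 s, component_path G s & x \in s.
Proof.
move=> sG lG axy.
pose P n := `[< exists s, [/\ size s = n, uniq s, sorted (adj G) s, x \in s & 2 <= size s] >].
have exP : exists n, P n.
  exists 2; apply/asboolP; exists [:: x; y].
  by split; rewrite //= ?axy // ?inE ?eqxx // (adj_neq sG axy).
have bP n : P n -> n <= #|` support G|.+1.
  move=> /asboolP[[|z s] [<- us ss _ _]] //=.
  rewrite ltnS; apply: uniq_leq_size; first by case/andP: us.
  exact: path_support ss.
case: (ex_maxnP exP bP) => n /asboolP[s [sn us ss xs s2]] nmax.
exists s => //; split=> // u v us' auv; apply/negPn/negP => vs.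
have nm s' : uniq s' -> sorted (adj G) s' -> x \in s' -> size s < size s' -> False.
  move=> h1 h2 h3 h4; have : P (size s').
    by apply/asboolP; exists s'; split=> //; apply: leq_trans s2 (ltnW h4).
  by move/nmax; rewrite leqNgt -sn h4.
case/splitPr: us' us ss vs xs s2 sn nm => s1 s2 us ss vs xs sz _ nm.
case/lastP: s1 us ss vs xs sz nm => [|s1 a] us ss vs xs sz nm.
  apply: (nm (v :: u :: s2)) => //; rewrite /= in us ss vs xs *.
  - by rewrite vs us.
  - by rewrite adjC auv.
  - by rewrite inE xs orbT.
case: s2 us ss vs xs sz nm => [|b s2] us ss vs xs sz nm.
  apply: (nm (rcons (rcons s1 a ++ [:: u]) v)).
  - by rewrite rcons_uniq vs.
  - case: (rcons s1 a) ss => [|c l] /=; first by rewrite auv.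
    by rewrite rcons_path last_cat /= auv andbT.
  - by rewrite mem_rcons inE xs orbT.
  - by rewrite size_rcons.
have aua : adj G u a.
  move: ss; rewrite -cats1 -catA /=; case: s1 {us vs xs sz nm} => [|c l] /=.
    by case/andP; rewrite adjC.
  by rewrite cat_path /= => /and3P[_ _ /andP[]]; rewrite adjC.
have aub : adj G u b.
  move: ss; case: (rcons s1 a) {us vs xs sz nm} => [|c l] /=.
    by case/andP.
  by rewrite cat_path /= => /and3P[_ _ /andP[]].
apply: (three_neighbours lG aua aub auv).
- apply/eqP => ab; move: us; rewrite cat_uniq => /and3P[_ /hasPn/(_ b) + _].
  by rewrite !inE eqxx orbT -ab mem_rcons inE eqxx /= => /(_ isT).
- apply/eqP => va; move/negP: vs; apply.
  by rewrite mem_cat mem_rcons inE va eqxx.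
- apply/eqP => vb; move/negP: vs; apply.
  by rewrite mem_cat !inE vb eqxx !orbT.
Qed.

Lemma path_edges_infix x p s1 a b s2 : x :: p = s1 ++ [:: a, b & s2] ->
  [fset a; b] \in path_edges x p.
Proof.
elim: s1 x p => [|c s1 IH] x p /=.
  by case=> -> ->; rewrite /= fset1U1.
case=> _ ->; case: s1 IH => [|d s1] IH /=; rewrite inE; apply/orP; right.
  by rewrite fset1U1.
exact: (IH d (s1 ++ [:: a, b & s2])).
Qed.

(** An edge of [G] joining two vertices of the path that are not consecutive would close a cycle
    with the segment between them. *)
Lemma component_edge G x p u v : acyclic G -> component_path G (x :: p) ->
  adj G u v -> u != v -> u \in x :: p -> [fset u; v] \in path_edges x p.
Proof.
move=> aG [s2 us ss cl] auv uv hu; have hv := cl _ _ hu auv.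
have main a b : index a (x :: p) < index b (x :: p) -> adj G a b -> b \in x :: p ->
    [fset a; b] \in path_edges x p.
  move=> lt aab hb; have ha : a \in x :: p by rewrite -index_mem (ltn_trans lt) // index_mem.
  case/splitPr E: _ / ha => [q1 q2].
  have bq2 : b \in q2.
    move: hb lt; rewrite E mem_cat inE => /orP[bq1|/orP[/eqP->|//]]; last by rewrite ltnn.
    have aq1 : a \notin q1.
      move: us; rewrite E cat_uniq => /and3P[_ /hasPn/(_ a)]; rewrite inE eqxx => /(_ isT).
      by [].
    rewrite !index_cat bq1 (negbTE aq1) /= eqxx addn0 => h.
    by move: (index_size b q1); rewrite leqNgt h.
  case/splitPr E2: _ / bq2 => [q3 q4].
  case: q3 E2 => [|c q3] E2; first by apply: (path_edges_infix (s1 := q1) (s2 := q4)); rewrite E E2.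
  have: cycle (adj G) (a :: rcons (c :: q3) b).
    have h : sorted (adj G) (a :: rcons (c :: q3) b).
      move: ss; rewrite E E2 => /cat_sorted2[_].
      by rewrite -[a :: _ ++ _]cat_cons -cat_rcons rcons_cons => /cat_sorted2[].
    by rewrite /cycle rcons_path last_rcons adjC aab andbT.
  apply/contraTeq => _; apply: aG; first by rewrite /= size_rcons.
  move: us; rewrite E E2 cat_uniq => /and3P[_ _].
  by rewrite -[a :: _ ++ _]cat_cons -cat_rcons rcons_cons cat_uniq => /and3P[].
have uE z : index z (x :: p) = index v (x :: p) -> z \in x :: p -> z = v.
  by move=> h zs; rewrite -(nth_index x zs) h nth_index.
case: (ltngtP (index u (x :: p)) (index v (x :: p))) => [h|h|h].
- exact: main.
- by rewrite fset2C; apply: main; rewrite // adjC.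
- by rewrite (uE _ h hu) eqxx in uv.
Qed.

Lemma component_edges_at G x p z : acyclic G -> simple G -> component_path G (x :: p) ->
  z \in x :: p -> edges_at G z = edges_at (path_edges x p) z.
Proof.
move=> aG sG cp zs; apply/fsetP => e; rewrite !in_edges_at.
apply/andP/andP => -[h ze]; split=> //; last first.
  by case: cp h => _ _ ss _; move: ss; rewrite /= -path_edges_sub => /fsubsetP; apply.
case: (simple_edge sG h ze) => y zy E; rewrite E.
by apply: (component_edge aG cp) => //; rewrite /adj -E.
Qed.

Lemma component_leaf G x p : simple G -> linear_forest G -> component_path G (x :: p) ->
  degree G x = 1.
Proof.
move=> sG [aG _] cp; rewrite degreeE (component_edges_at aG sG cp) ?inE ?eqxx //.
case: cp => s2 us _ _; case: p s2 us => [//|y p] _ us.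
suff -> : edges_at (path_edges x (y :: p)) x = [fset [fset x; y]] by rewrite cardfs1.
apply/fsetP => e; rewrite in_edges_at /= !inE; case: eqP => [->|] /=.
  by rewrite in_fset2 eqxx.
move=> _; apply/negP => /andP[h xe]; have := path_edges_mem h xe.
by case/andP: us => /negP.
Qed.

Lemma rev_component G s : component_path G s -> component_path G (rev s).
Proof.
case=> s2 us ss cl; split; rewrite ?size_rev ?rev_uniq //.
  by rewrite rev_sorted; apply: sub_sorted ss => x y; rewrite adjC.
by move=> x y; rewrite !mem_rev; apply: cl.
Qed.

Lemma component_leaf_last G x p : simple G -> linear_forest G -> component_path G (x :: p) ->
  degree G (last x p) = 1.
Proof.
move=> sG lG /rev_component; rewrite -rpathE; exact: component_leaf.
Qed.

Lemma component_mem G s s' z : component_path G s -> component_path G s' ->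
  z \in s -> z \in s' -> {subset s' <= s}.
Proof.
move=> [_ _ _ cl] cs' zs zs'.
have sub q a : a \in s -> path (adj G) a q -> {subset q <= s}.
  elim: q a => [|b q IH] a ha //= /andP[ab bq] c; have hb := cl _ _ ha ab.
  by rewrite inE => /orP[/eqP->//|]; apply: IH bq _.
case/splitPr: zs' cs' => q1 q2 cs'; have := rev_component cs'.
rewrite rev_cat rev_cons -cats1 -catA => -[_ _ /cat_sorted2[_ h1] _].
case: cs' => _ _ /cat_sorted2[_ h2] _.
move=> c; rewrite mem_cat inE => /orP[|/orP[/eqP->//|]]; last exact: sub h2 c.
by rewrite -mem_rev; apply: (sub _ z).
Qed.

Lemma component_edges_sub G x p y q z : simple G -> linear_forest G ->
  component_path G (x :: p) -> component_path G (y :: q) ->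
  z \in x :: p -> z \in y :: q -> path_edges x p `<=` path_edges y q.
Proof.
move=> sG [aG _] c1 c2 h1 h2; apply/fsubsetP => e ep.
have eG : e \in G.
  by case: c1 => _ _ + _; rewrite /= -path_edges_sub => /fsubsetP; apply.
have [u [v [uv E]]] := sG _ eG; rewrite E.
apply: (component_edge aG c2) => //; first by rewrite /adj -E.
apply: (component_mem c2 c1 h2 h1); apply: path_edges_mem ep _.
by rewrite E fset21.
Qed.

(** Components with a common vertex have the same edges; the first vertex of one has degree one,
    hence is an end of the other, and [path_edges_inj] concludes. *)
Lemma component_unique G s s' z : simple G -> linear_forest G ->
  component_path G s -> component_path G s' -> z \in s -> z \in s' ->
  s' = s \/ s' = rev s.
Proof.
case: s => [|x p] // sG lG; case: s' => [|y q] // c1 c2 h1 h2.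
have E : path_edges x p = path_edges y q.
  by apply/eqP; rewrite eqEfsubset !(component_edges_sub sG lG _ _ h1 h2,
    component_edges_sub sG lG _ _ h2 h1).
have u1 : uniq (x :: p) by case: c1.
have u2 : uniq (y :: q) by case: c2.
have aG : acyclic G by case: lG.
have yp : y \in x :: p by apply: (component_mem c1 c2 h1 h2); rewrite inE eqxx.
have := component_leaf sG lG c2.
rewrite degreeE (component_edges_at aG sG c1 yp) -degreeE => /(path_edges_leaf u1)[yx|yl].
  by left; subst y; rewrite (path_edges_inj u1 u2 E).
right; rewrite -rpathE; subst y; congr (_ :: _); apply/esym.
apply: (path_edges_inj (x := last x p)) => //; first by rewrite rpathE rev_uniq.
by rewrite path_edges_rev.
Qed.

Lemma index_infix (s : seq T) u v : uniq s -> infix [:: u; v] s ->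
  [/\ u \in s, v \in s & index v s = (index u s).+1].
Proof.
move=> us /infixP[s1 [s2 E]]; subst s; move: us; rewrite cat_uniq => /and3P[_ h].
have un : u \notin s1 by move/hasPn: h; apply; rewrite inE eqxx.
have vn : v \notin s1 by move/hasPn: h; apply; rewrite !inE eqxx orbT.
rewrite /= inE negb_or => /andP[/andP[uv _] _].
rewrite !mem_cat !index_cat !inE (negbTE un) (negbTE vn) /= !eqxx (negbTE uv) !orbT.
by rewrite addn0 addn1.
Qed.

Lemma component_two_leaves G : simple G -> linear_forest G -> G != fset0 ->
  exists x p, [/\ component_path G (x :: p), degree G x = 1, degree G (last x p) = 1 &
    x != last x p].
Proof.
move=> sG lG /fset0Pn[e eG]; have [u [v [uv E]]] := sG _ eG.
have auv : adj G u v by rewrite /adj -E.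
have [[|x p] // cs _] := component_path_exists sG lG auv.
exists x, p; split=> //; [exact: component_leaf cs|exact: component_leaf_last cs|].
case: cs => s2 us _ _; case: p s2 us => [//|y p] _ /= /andP[h _].
by apply/eqP => E'; rewrite E' mem_last in h.
Qed.

Lemma degree_diff_component G x p z : linear_forest G -> simple G ->
  component_path G (x :: p) ->
  degree (G `\` path_edges x p) z = if z \in x :: p then 0 else degree G z.
Proof.
move=> [aG _] sG cp; case: ifP => zs.
  apply/eqP; rewrite degreeE cardfs_eq0; apply/eqP/fsetP => e.
  rewrite in_edges_at in_fsetD [RHS]inE; apply/negP => /andP[/andP[h1 h2] ze].
  have : e \in edges_at G z by rewrite in_edges_at h2.
  by rewrite (component_edges_at aG sG cp zs) in_edges_at (negbTE h1).
rewrite !degreeE; congr (#|` _|); apply/fsetP => e; rewrite !in_edges_at in_fsetD.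
case ze : (z \in e); rewrite ?andbF ?andbT //.
case ep : (e \in path_edges x p) => //=.
by rewrite (path_edges_mem ep ze) in zs.
Qed.

End LinearForests.

(** * Traces of linear forests *)

Section Trace.
Local Open Scope nat_scope.
Local Open Scope fset_scope.
Context {T T' : choiceType} (g : T' -> T) (D : pred T) (G : {fset {fset T}}).
Context (g_inj : injective g) (sG : simple G) (lG : linear_forest G).
Context (sigma : {fset {fset T'}}).
Context (sigmaE : forall e, e \in sigma -> exists s (x y : T'),
  [/\ component_path G s, infix [:: g x; g y] (seq.filter D s) & e = [fset x; y]]).

(** A component path is unique up to reversal. [cp z] selects one direction for the whole component
    of [z], so that positions of marked vertices along it can serve as a rank. *)
Let cp (z : T) : seq T := xget [::] [set s | component_path G s /\ z \in s].

Let cpE s z : component_path G s -> z \in s ->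
  [/\ component_path G (cp z), z \in cp z & s = cp z \/ s = rev (cp z)].
Proof.
move=> cs zs; rewrite /cp; case: xgetP => [r _ [cr zr]|/(_ s)]; last by case.
by split=> //; apply: component_unique cr cs zr zs.
Qed.

Let cp_eq s z z' : component_path G s -> z \in s -> z' \in s -> cp z = cp z'.
Proof.
(* Both choices are made from the same set of paths, hence agree in direction as well. *)
move=> cs zs zs'; rewrite /cp; congr xget; apply/seteqP; split=> r /= [cr h]; split=> //.
  exact: (component_mem cr cs h zs).
exact: (component_mem cr cs h zs').
Qed.

Let adj_sigma (x y : T') : adj sigma x y ->
  [/\ cp (g x) = cp (g y), uniq (seq.filter D (cp (g x))),
      g x \in seq.filter D (cp (g x)), g y \in seq.filter D (cp (g x)) &
      index (g x) (seq.filter D (cp (g x))) = (index (g y) (seq.filter D (cp (g x)))).+1 \/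
      index (g y) (seq.filter D (cp (g x))) = (index (g x) (seq.filter D (cp (g x)))).+1].
Proof.
have main u v s : component_path G s -> infix [:: g u; g v] (seq.filter D s) ->
  [/\ cp (g u) = cp (g v), uniq (seq.filter D (cp (g u))),
      g u \in seq.filter D (cp (g u)), g v \in seq.filter D (cp (g u)) &
      index (g u) (seq.filter D (cp (g u))) = (index (g v) (seq.filter D (cp (g u)))).+1 \/
      index (g v) (seq.filter D (cp (g u))) = (index (g u) (seq.filter D (cp (g u)))).+1].
  move=> cs i.
  have us : uniq (seq.filter D s) by apply: filter_uniq; case: cs.
  have [hu hv _] := index_infix us i.
  have us' := hu; have vs' := hv.
  rewrite mem_filter in us'; rewrite mem_filter in vs'.
  case/andP: us' => _ us'; case/andP: vs' => _ vs'.
  have [c1 c2 c3] := cpE cs us'.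
  have uc : uniq (seq.filter D (cp (g u))) by apply: filter_uniq; case: c1.
  have E : cp (g u) = cp (g v) by exact: cp_eq cs us' vs'.
  case: c3 => c3.
    rewrite {}c3 in hu hv i; split=> //; right.
    by have [] := index_infix uc i.
  rewrite {}c3 filter_rev in hu hv i; rewrite mem_rev in hu; rewrite mem_rev in hv.
  split=> //; left; move: i; rewrite -[[:: g u; g v]]/(rev [:: g v; g u]) infix_rev.
  by move=> /(index_infix uc)[].
move=> /sigmaE[s [u [v [cs i E]]]].
have : x \in [fset u; v] by rewrite -E fset21.
rewrite in_fset2 => /orP[/eqP xu|/eqP xv].
  by subst u; move/fset2_inj: E => ->; apply: main cs i.
subst v; rewrite (fset2C u x) in E; move/fset2_inj: E => ->.
case: (main _ _ _ cs i) => E1 E2 E3 E4 E5; rewrite -E1; split=> //.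
by case: E5; [right|left].
Qed.

Lemma trace_simple : simple sigma.
Proof.
move=> e es; have [s [x [y [cs i E]]]] := sigmaE es; exists x, y; split=> //.
have := @adj_sigma x y; rewrite /adj -E => /(_ es)[_ _ _ _ h].
by apply/eqP => xy; subst y; lia.
Qed.

Lemma trace_linear_forest : linear_forest sigma.
Proof.
apply: (@linear_forest_rank _ _ (fun x => index (g x) (seq.filter D (cp (g x))))).
- exact: trace_simple.
- move=> x y /adj_sigma[<- _ _ _ h]; apply/eqP; lia.
- move=> x y z /adj_sigma[<- _ _ my h] /adj_sigma[<- _ _ mz h'] l1 l2.
  apply: g_inj; rewrite -(nth_index (g x) my) -(nth_index (g x) mz); congr nth; lia.
- move=> x y z /adj_sigma[<- _ _ my h] /adj_sigma[<- _ _ mz h'] l1 l2.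
  apply: g_inj; rewrite -(nth_index (g x) my) -(nth_index (g x) mz); congr nth; lia.
Qed.

End Trace.

(** * Hierarchies of graphs and weights of forests *)

Section Counting.
Local Open Scope nat_scope.
Local Open Scope classical_set_scope.

(* Meaningful for finite sets only: [fset_set] sends infinite sets to [fset0]. *)
Definition count_set {U : choiceType} (A : set U) : nat := #|` fset_set A|.

Lemma finite_set_inj (U W : choiceType) (A : set U) (B : set W) (f : U -> W) :
  finite_set B -> (forall a b, A a -> A b -> f a = f b -> a = b) ->
  (forall a, A a -> B (f a)) -> finite_set A.
Proof.
move=> fB fi AB.
have inj : {in A &, injective f} by move=> a b /set_mem Aa /set_mem Ab; apply: fi.
rewrite -(eq_finite_set (inj_card_eq inj)); apply: sub_finite_set fB.
by move=> _ [a Aa <-]; apply: AB.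
Qed.

Lemma count_set_inj (U W : choiceType) (A : set U) (B : set W) (f : U -> W) :
  finite_set B -> (forall a b, A a -> A b -> f a = f b -> a = b) ->
  (forall a, A a -> B (f a)) -> count_set A <= count_set B.
Proof.
move=> fB fi AB; have fA := finite_set_inj fB fi AB.
rewrite /count_set -(size_map f); apply: uniq_leq_size.
  rewrite map_inj_in_uniq ?fset_uniq // => a b.
  by rewrite !in_fset_set // => /set_mem Aa /set_mem Ab; apply: fi.
move=> b /mapP[a]; rewrite in_fset_set // => /set_mem Aa ->.
by rewrite in_fset_set //; apply/mem_set/AB.
Qed.

Lemma count_set_sub (U : choiceType) (A B : set U) : finite_set B -> A `<=` B ->
  count_set A <= count_set B.
Proof. by move=> fB AB; apply: (count_set_inj (f := id)). Qed.

Lemma count_setU (U : choiceType) (A B : set U) : finite_set A -> finite_set B ->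
  count_set (A `|` B) <= count_set A + count_set B.
Proof. by move=> fA fB; rewrite /count_set fset_setU // leq_card_fsetU. Qed.

Lemma count_set0 (U : choiceType) : count_set (@set0 U) = 0.
Proof. by rewrite /count_set fset_set0 cardfs0. Qed.

Lemma count_set_cover (U : choiceType) (I : eqType) (s : seq I) (A : set U)
    (F : I -> set U) (k : I -> nat) :
  (forall i, i \in s -> finite_set (F i)) ->
  (forall i, i \in s -> count_set (F i) <= k i) ->
  (forall a, A a -> exists2 i, i \in s & F i a) ->
  finite_set A /\ count_set A <= \sum_(i <- s) k i.
Proof.
elim: s A => [|i s IH] A fF ck AF.
  have -> : A = set0 by apply/seteqP; split=> a // /AF[].
  by rewrite count_set0.
have [fA' cA'] : finite_set [set a | A a /\ ~ F i a] /\
    count_set [set a | A a /\ ~ F i a] <= \sum_(i <- s) k i.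
  apply: IH => [j js|j js|a [Aa nF]]; [by apply: fF; rewrite inE js orbT|
    by apply: ck; rewrite inE js orbT|].
  have [j] := AF _ Aa; rewrite inE => /orP[/eqP->//|js Fa]; by exists j.
have fFi : finite_set (F i) by apply: fF; rewrite inE eqxx.
have sub : A `<=` F i `|` [set a | A a /\ ~ F i a].
  by move=> a Aa; have [Fa|nFa] := pselect (F i a); [left|right].
have fU : finite_set (F i `|` [set a | A a /\ ~ F i a]) by rewrite finite_setU.
split; first exact: sub_finite_set sub fU.
rewrite big_cons; apply: leq_trans (count_set_sub fU sub) _.
apply: leq_trans (count_setU fFi fA') _; apply: leq_add => //.
by apply: ck; rewrite inE eqxx.
Qed.

Lemma count_set_fiber (U W : choiceType) (A : set U) (B : set W) (f : U -> W) k :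
  finite_set A -> finite_set B -> (forall a, A a -> B (f a)) ->
  (forall b, B b -> count_set [set a | A a /\ f a = b] <= k) ->
  count_set A <= count_set B * k.
Proof.
move=> fA fB AB kB.
have [_ h] : finite_set A /\ count_set A <= \sum_(b <- fset_set B) k.
  apply: (@count_set_cover U W (fset_set B) A (fun b => [set a | A a /\ f a = b])).
  - by move=> b _; apply: sub_finite_set fA => a [].
  - by move=> b; rewrite in_fset_set // => /set_mem; apply: kB.
  - by move=> a Aa; exists (f a) => //; rewrite in_fset_set //; apply/mem_set/AB.
by apply: leq_trans h _; rewrite big_const_seq count_predT iter_addn_0 mulnC.
Qed.

Lemma card_image_fset (U W : choiceType) (f : U -> W) (A : {fset U}) : injective f ->
  #|` [fset f x | x in A]%fset| = #|` A|.
Proof. by move=> fi; rewrite (card_imfset _ _ fi). Qed.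

Lemma sum_card_disjoint (U : choiceType) (I : finType) (A : I -> {fset U}) (D : {fset U}) :
  (forall i, A i `<=` D)%fset ->
  (forall i j z, z \in A i -> z \in A j -> i = j) ->
  \sum_i #|` A i| <= #|` D|.
Proof.
move=> AD dA.
have E i : #|` A i| = \sum_(z <- D) (z \in A i).
  rewrite -sum1_size.
  transitivity (\sum_(z <- D | z \in A i) 1).
    rewrite -[RHS]big_filter; apply: perm_big; apply: uniq_perm; rewrite ?fset_uniq ?filter_uniq //.
    by move=> z; rewrite mem_filter andb_idr // => /(fsubsetP (AD i)).
  by rewrite big_mkcond; apply: eq_bigr => z _; case: (_ \in _).
under eq_bigr do rewrite E.
rewrite exchange_big /= -[X in _ <= X]sum1_size; apply: leq_sum => z _.
case: (pickP (fun i => z \in A i)) => [i zi|h]; last by rewrite big1 // => i _; rewrite h.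
rewrite (bigD1 i) //= zi big1 // => j ji.
by case zj: (z \in A j) => //; rewrite (dA _ _ _ zj zi) eqxx in ji.
Qed.

Lemma sum_card_cover (U : choiceType) (I : finType) (A : I -> {fset U}) (D : {fset U}) :
  (forall z, z \in D -> exists i, z \in A i) ->
  #|` D| <= \sum_i #|` A i|.
Proof.
move=> cA; rewrite -sum1_size.
have E i : \sum_(z <- D) (z \in A i) <= #|` A i|.
  rewrite -[X in _ <= X]sum1_size -big_mkcond /= -big_filter sum1_size sum1_size.
  apply: uniq_leq_size; first by rewrite filter_uniq ?fset_uniq.
  by move=> z; rewrite mem_filter => /andP[].
apply: (@leq_trans (\sum_i \sum_(z <- D) (z \in A i))); last by apply: leq_sum => i _; exact: E.
rewrite exchange_big /= !big_seq; apply: leq_sum => z /cA[i zi].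
by rewrite (bigD1 i) //= zi.
Qed.

End Counting.

(** * Weighted sums over edge sets *)

Section WeightedSums.
Context {R : realType}.
Local Open Scope ring_scope.

Lemma ler_sum_inj (U W : eqType) (A : seq U) (S : seq W) (h : U -> W) (F : W -> R) :
  uniq A -> {in A &, injective h} -> {in A, forall a, h a \in S} ->
  (forall t, 0 <= F t) ->
  \sum_(a <- A) F (h a) <= \sum_(t <- S) F t.
Proof.
elim: A S => [|a A IH] S uA hi hS F0; first by rewrite big_nil sumr_ge0.
have aS : h a \in S by apply: hS; rewrite inE eqxx.
rewrite (perm_big _ (perm_to_rem aS)) !big_cons lerD2l; apply: IH => //.
- by case/andP: uA.
- by move=> b c bA cA; apply: hi; rewrite inE ?bA ?cA orbT.
- move=> b bA; have := hS b; rewrite inE bA orbT => /(_ isT).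
  rewrite (perm_mem (perm_to_rem aS)) inE => /orP[/eqP /hi|//].
  rewrite !inE bA eqxx orbT => /(_ isT isT) ba.
  by move: uA => /= /andP[]; rewrite -ba bA.
Qed.

Fixpoint choices {U : eqType} {I : Type} (B : I -> seq U) (r : seq I) : seq (seq U) :=
  if r is i :: r' then [seq u :: t | u <- B i, t <- choices B r'] else [:: [::]].

Lemma sum_choices (U : eqType) (I : Type) (B : I -> seq U) (r : seq I) (F : U -> R) :
  \sum_(t <- choices B r) \prod_(u <- t) F u = \prod_(i <- r) \sum_(u <- B i) F u.
Proof.
elim: r => [|i r IH] /=; first by rewrite big_seq1 !big_nil.
rewrite big_cons -IH big_allpairs_dep mulr_suml; apply: eq_bigr => u _.
by rewrite mulr_sumr; apply: eq_bigr => t _; rewrite big_cons.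
Qed.

Lemma ler_sum_prod (U W : eqType) (I : finType) (A : seq U) (B : I -> seq W)
    (g : U -> I -> W) (F : W -> R) :
  uniq A -> {in A &, forall a b, g a =1 g b -> a = b} ->
  {in A, forall a i, g a i \in B i} -> (forall t, 0 <= F t) ->
  \sum_(a <- A) \prod_i F (g a i) <= \prod_i \sum_(u <- B i) F u.
Proof.
move=> uA gi gB F0.
rewrite -sum_choices.
pose h a := [seq g a i | i <- index_enum I].
have E a : \prod_i F (g a i) = \prod_(u <- h a) F u by rewrite big_map.
under eq_bigr do rewrite E.
apply: (@ler_sum_inj _ _ A _ h (fun t => \prod_(u <- t) F u)) => //.
- move=> a b aA bA /eq_in_map e; apply: gi => // i.
  by apply: e; rewrite mem_index_enum.
- rewrite /h => a aA; elim: (index_enum I) => [|i r IH] //=.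
  by apply/allpairsP; exists (g a i, [seq g a i | i <- r]); rewrite gB.
- by move=> t; apply: prodr_ge0.
Qed.

(** With [x = expR (- beta)] this is a partition function, each edge having weight [e^(-beta)]. *)
Definition wsum {U : choiceType} (A : {fset {fset U}}) (x : R) : R :=
  \sum_(G <- A) x ^+ #|` G|.

Lemma wsum_ge0 (U : choiceType) (A : {fset {fset U}}) (x : R) : 0 <= x -> 0 <= wsum A x.
Proof. by move=> x0; apply: sumr_ge0 => G _; apply: exprn_ge0. Qed.

Lemma wsum_sub (U : choiceType) (A B : {fset {fset U}}) (x : R) : 0 <= x -> (A `<=` B)%fset ->
  wsum A x <= wsum B x.
Proof.
move=> x0 /fsubsetP AB; apply: (ler_sum_inj (h := id) (F := fun G : {fset U} => x ^+ #|` G|)) => //.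
  exact: fset_uniq.
by move=> G; apply: exprn_ge0.
Qed.

Lemma wsum_cells (U V : choiceType) (I J : finType) (P : pred J)
    (A : {fset {fset U}}) (B : J -> I -> {fset {fset V}})
    (cls : {fset U} -> J) (g : {fset U} -> I -> {fset V}) (x : R) :
  0 <= x ->
  {in A, forall G, P (cls G)} ->
  {in A, forall G i, g G i \in B (cls G) i} ->
  {in A &, forall G H, g G =1 g H -> G = H} ->
  {in A, forall G, #|` G| = (\sum_i #|` g G i|)%N} ->
  wsum A x <= \sum_(j | P j) \prod_i wsum (B j i) x.
Proof.
move=> x0 PA AB gi gc; rewrite /wsum big_seq (partition_big cls P) //=.
apply: ler_sum => j Pj; rewrite -big_filter.
have E (G : {fset U}) : G \in [seq G <- A | (G \in A) && (cls G == j)] ->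
    x ^+ #|` G| = \prod_i x ^+ #|` g G i|.
  rewrite mem_filter => /andP[/andP[GA _] _].
  by rewrite (gc _ GA) prodrXr.
rewrite (eq_big_seq _ E).
apply: (ler_sum_prod (F := fun G : {fset V} => x ^+ #|` G|)).
- by rewrite filter_uniq ?fset_uniq.
- move=> G H; rewrite !mem_filter => /andP[/andP[GA _] _] /andP[/andP[HA _] _].
  exact: gi.
- by move=> G; rewrite mem_filter => /andP[/andP[GA /eqP <-] _] i; apply: AB.
- by move=> G; apply: exprn_ge0.
Qed.

End WeightedSums.

(* A finitely ramified hierarchy of graphs: level [m.+1] is the union of the images of level [m]
   under the maps [ht m i], two of which share at most one vertex, a boundary vertex of both. *)
Record hierarchy (T : choiceType) (M : nat) := Hierarchy {
  hV : nat -> {fset T};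
  hE : nat -> {fset {fset T}};
  hB : nat -> {fset T};
  ht : nat -> 'I_M -> T -> T;
  hO : T;
  hi0 : 'I_M;
  ht_inj : forall m i, injective (ht m i);
  ht_i0 : forall m x, ht m hi0 x = x;
  hV_S : forall m z, z \in hV m.+1 <-> exists i x, x \in hV m /\ z = ht m i x;
  hE_S : forall m e, e \in hE m.+1 <->
    exists i e0, e0 \in hE m /\ e = [fset ht m i x | x in (e0 : {fset T})]%fset;
  hE_simple : forall m, simple (hE m);
  hE_V : forall m e x, e \in hE m -> x \in e -> x \in hV m;
  h_meet : forall m i j x y, i != j -> x \in hV m -> y \in hV m ->
    ht m i x = ht m j y -> x \in hB m /\ y \in hB m;
  h_meet1 : forall m i j x y x' y', i != j ->
    x \in hV m -> y \in hV m -> x' \in hV m -> y' \in hV m ->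
    ht m i x = ht m j y -> ht m i x' = ht m j y' -> x = x';
  hB_V : forall m x, x \in hB m -> x \in hV m;
  hB_cell : forall m z, z \in hB m.+1 -> exists i x, x \in hB m /\ z = ht m i x;
  hB_one : forall m z i j x y, z \in hB m.+1 -> x \in hV m -> y \in hV m ->
    z = ht m i x -> z = ht m j y -> i = j;
  hB_uniq : forall m z z' i x x', z \in hB m.+1 -> z' \in hB m.+1 ->
    x \in hV m -> x' \in hV m -> z = ht m i x -> z' = ht m i x' -> z = z';
  hV0 : hV 0 = hB 0;
  hO_B : forall m, hO \in hB m;
  hB_card : forall m, #|` hB m| = #|` hB 0|;
  hB_two : forall m, exists2 x, x \in hB m & x != hO;
  h_auto : forall m x y, x \in hB m -> y \in hB m -> exists phi : T -> T,
    [/\ injective phi, phi x = y, {in hB m, forall z, phi z \in hB m} &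
      forall u v, [fset u; v]%fset \in hE m -> [fset phi u; phi v]%fset \in hE m];
  h_conn0 : forall x y, x \in hV 0 -> y \in hV 0 ->
    exists2 p, path (adj (hE 0)) x p & last x p = y;
  h_conn : exists r : rel 'I_M, (forall i j, connect r i j) /\
    forall m i j, r i j -> exists x y,
      [/\ x \in hB m, y \in hB m & ht m i x = ht m j y];
  h_fold : exists A : nat, forall m x y p x' y',
    x \in hB m -> y \in hB m -> x != y -> path (adj (hE m)) x p -> last x p = y ->
    x' \in hB m -> y' \in hB m ->
    exists p', [/\ path (adj (hE m)) x' p', last x' p' = y' &
      (size p' <= A * size p)%N] }.

(** * Restriction of forests to cells *)

Section Restriction.
Local Open Scope nat_scope.
Local Open Scope fset_scope.
Context {T : choiceType} {M : nat} (h : hierarchy T M).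
Local Notation V := (hV h). Local Notation E := (hE h). Local Notation B := (hB h).
Local Notation t := (ht h).
Implicit Types (G H : {fset {fset T}}) (m : nat) (i j : 'I_M).

Definition tE m i (e : {fset T}) : {fset T} := [fset t m i x | x in e].

Lemma tE_inj m i : injective (tE m i).
Proof.
move=> e e' ee; apply/fsetP => x.
have mem e1 : (t m i x \in tE m i e1) = (x \in e1).
  apply/imfsetP/idP => [[y ye /(@ht_inj _ _ h) ->]//|xe]; by exists x.
by rewrite -mem ee mem.
Qed.

Lemma mem_tE m i x e : (t m i x \in tE m i e) = (x \in e).
Proof.
apply/imfsetP/idP => [[y ye /(@ht_inj _ _ h) ->]//|xe]; by exists x.
Qed.

Lemma tE2 m i x y : tE m i [fset x; y] = [fset t m i x; t m i y].
Proof. exact: imfset_fset2. Qed.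

Lemma tE_E m i e : e \in E m -> tE m i e \in E m.+1.
Proof. by move=> eE; apply/hE_S; exists i, e. Qed.

(** An edge has two vertices, whereas two cells share at most one. *)
Lemma cell_edge_uniq m i j e e' : e \in E m -> e' \in E m ->
  tE m i e = tE m j e' -> i = j.
Proof.
move=> eE e'E ee; apply/eqP; apply/negPn/negP => ij.
have [x [y [xy Ee]]] := hE_simple eE.
have get u : u \in e -> exists2 v, v \in e' & t m i u = t m j v.
  by move=> ue; have : t m i u \in tE m j e'; [rewrite -ee mem_tE|case/imfsetP=> v ? ?; exists v].
have xe : x \in e by rewrite Ee fset21.
have ye : y \in e by rewrite Ee fset22.
have [x' x'e xx] := get _ xe; have [y' y'e yy] := get _ ye.
have := h_meet1 ij _ _ _ _ xx yy.
move=> /(_ (hE_V eE xe) (hE_V e'E x'e) (hE_V eE ye) (hE_V e'E y'e)) E'.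
by rewrite E' eqxx in xy.
Qed.

Definition restr m G i : {fset {fset T}} := [fset e in E m | tE m i e \in G].

Lemma in_restr m G i e : (e \in restr m G i) = (e \in E m) && (tE m i e \in G).
Proof. by rewrite !inE. Qed.

Lemma restr_sub m G i : restr m G i `<=` E m.
Proof. by apply/fsubsetP => e; rewrite in_restr => /andP[]. Qed.

Lemma restr_inj m G H : G `<=` E m.+1 -> H `<=` E m.+1 ->
  restr m G =1 restr m H -> G = H.
Proof.
have main G' H' : G' `<=` E m.+1 -> restr m G' =1 restr m H' -> G' `<=` H'.
  move=> /fsubsetP sG GH; apply/fsubsetP => e eG; have /hE_S[i [e0 [e0E ee]]] := sG _ eG.
  have : e0 \in restr m G' i by rewrite in_restr e0E /tE -ee.
  by rewrite GH in_restr /tE -ee => /andP[].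
move=> sG sH GH; apply/eqP; rewrite eqEfsubset; apply/andP; split; apply: main => //.
Qed.

Lemma card_restr m G : G `<=` E m.+1 -> #|` G| = \sum_i #|` restr m G i|.
Proof.
move=> /fsubsetP sG; pose A i := [fset tE m i e | e in restr m G i].
have cA i : #|` restr m G i| = #|` A i| by rewrite card_image_fset //; exact: tE_inj.
under eq_bigr do rewrite cA.
apply/eqP; rewrite eqn_leq; apply/andP; split.
  apply: sum_card_cover => e eG; have /hE_S[i [e0 [e0E ee]]] := sG _ eG.
  by exists i; rewrite ee; apply: in_imfset; rewrite /= in_restr e0E -/(tE m i e0) /tE -ee.
apply: sum_card_disjoint => [i|i j e].
  by apply/fsubsetP => e /imfsetP[e0 /=]; rewrite in_restr => /andP[_ ?] ->.
move=> /imfsetP[e1 /=]; rewrite in_restr => /andP[h1 _] -> /imfsetP[e2 /=].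
by rewrite in_restr => /andP[h2 _]; apply: cell_edge_uniq.
Qed.

Lemma adj_restr m G i x y : adj (restr m G i) x y -> adj G (t m i x) (t m i y).
Proof. by rewrite /adj in_restr tE2 => /andP[]. Qed.

Lemma degree_restr m G i x : degree (restr m G i) x <= degree G (t m i x).
Proof.
rewrite !degreeE -(card_image_fset _ (@tE_inj m i)).
apply/fsubset_leq_card/fsubsetP => e /imfsetP[e0 /=].
rewrite !in_edges_at in_restr => /andP[/andP[_ h1] h2] ->.
by rewrite h1 mem_tE.
Qed.

(** A vertex off the boundary of its cell lies in no other cell, so all edges at it belong to this
    cell. *)
Lemma degree_restr_interior m G i x : G `<=` E m.+1 -> x \in V m -> x \notin B m ->
  degree (restr m G i) x = degree G (t m i x).
Proof.
move=> /fsubsetP sG xV xB; apply/eqP; rewrite eqn_leq degree_restr /=.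
rewrite !degreeE -[X in _ <= X](card_image_fset _ (@tE_inj m i)).
apply/fsubset_leq_card/fsubsetP => e; rewrite in_edges_at => /andP[eG xe].
have /hE_S[j [e0 [e0E ee]]] := sG _ eG.
rewrite ee in xe; case/imfsetP: xe => y /= ye xy.
have ij : i = j.
  apply/eqP/negPn/negP => ij; have [] := h_meet ij xV (hE_V e0E ye) xy.
  by rewrite (negbTE xB).
subst j; move/(@ht_inj _ _ h): xy => ?; subst y.
by rewrite ee; apply: in_imfset; rewrite /= in_edges_at in_restr e0E ye -/(tE m i e0) /tE -ee eG.
Qed.

Lemma linear_forest_restr m G i : linear_forest G -> linear_forest (restr m G i).
Proof.
move=> [aG dG]; split=> [s s3 us|x]; last exact: leq_trans (degree_restr _ _ _ _) _.
apply/negP => cs; have := aG (map (t m i) s); rewrite size_map map_inj_uniq //.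
  move=> /(_ s3 us) /negP; apply; rewrite cycle_map; apply: sub_cycle cs => x y.
  exact: adj_restr.
exact: ht_inj.
Qed.

(** A linear forest without defects is a boundary forest or empty. Walks with arbitrary ends have at
    most two defects. *)
Definition defects m G := [fset x in V m | (x \notin B m) && (degree G x == 1)].

(** Cutting along cells creates new leaves only at cell boundaries. A defect of a piece therefore
    comes from a defect of [G], and it lies in a single cell. *)
Lemma defects_restr m G : G `<=` E m.+1 ->
  \sum_i #|` defects m (restr m G i)| <= #|` defects m.+1 G|.
Proof.
move=> sG; pose A i := [fset t m i x | x in defects m (restr m G i)].
have cA i : #|` defects m (restr m G i)| = #|` A i|.
  by rewrite card_image_fset //; exact: ht_inj.
under eq_bigr do rewrite cA.
apply: sum_card_disjoint => [i|i j z].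
  apply/fsubsetP => z /imfsetP[x /=]; rewrite !inE => /and3P[xV xB d1] ->.
  rewrite -(degree_restr_interior _ sG) // d1 andbT; apply/andP; split.
    by apply/hV_S; exists i, x.
  apply/negP => zB; have [j [y [yB E']]] := hB_cell zB.
  have ij := hB_one zB xV (hB_V yB) erefl E'; subst j.
  by move/(@ht_inj _ _ h): E' => ?; subst y; rewrite yB in xB.
move=> /imfsetP[x /=]; rewrite !inE => /and3P[xV xB _] -> /imfsetP[y /=].
rewrite !inE => /and3P[yV yB _] E'; apply/eqP/negPn/negP => ij.
by have [] := h_meet ij xV yV E'; rewrite (negbTE xB).
Qed.

End Restriction.

(** * Recursive inequalities for partition functions *)

Section Recursion.
Context {R : realType} {T : choiceType} {M : nat} (h : hierarchy T M).
Local Notation V := (hV h). Local Notation E := (hE h). Local Notation B := (hB h).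
Local Notation t := (ht h).
Local Open Scope ring_scope.
Implicit Types (G H : {fset {fset T}}) (m k : nat) (i j : 'I_M) (x : R).

(** The empty forest is included, because the piece of a forest in a cell may be empty. *)
Definition forests_le k m : {fset {fset {fset T}}} :=
  [fset G in fpowerset (E m) |
    `[< linear_forest G >] && (#|` defects h m G| <= k)%N]%fset.

Lemma in_forests_le k m G : reflect [/\ (G `<=` E m)%fset, linear_forest G &
  (#|` defects h m G| <= k)%N] (G \in forests_le k m).
Proof.
rewrite !inE fpowersetE; apply: (iffP and3P) => [[? /asboolP]|[? ? ?]]; split=> //.
exact/asboolP.
Qed.

Definition bforests m : {fset {fset {fset T}}} := (forests_le 0 m `\ fset0)%fset.

Lemma in_bforests m G : reflect [/\ (G `<=` E m)%fset, linear_forest G, G != fset0 &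
  forall z, degree G z = 1%N -> z \in B m] (G \in bforests m).
Proof.
rewrite in_fsetD1; apply: (iffP andP) => [[n0 /in_forests_le[GE lG]]|[GE lG n0 dB]].
  rewrite leqn0 cardfs_eq0 => /eqP d0; split=> // z dz.
  apply/negPn/negP => zB.
  suff : z \in defects h m G by rewrite d0.
  rewrite !inE zB dz eqxx !andbT.
  have /fset0Pn[e] : edges_at G z != fset0 by rewrite -cardfs_gt0 -degreeE dz.
  by rewrite in_edges_at => /andP[/(fsubsetP GE) /(@hE_V _ _ h) H /H].
split=> //; apply/in_forests_le; split=> //; rewrite leqn0 cardfs_eq0.
apply/eqP/fsetP => z; rewrite !inE; apply/negP => /and3P[_ zB /eqP/dB].
by rewrite (negbTE zB).
Qed.

Lemma fset0_forests k m : fset0 \in forests_le k m.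
Proof.
apply/in_forests_le; split; first exact: fsub0set.
  split=> [s s3 us|x]; last first.
    by rewrite degreeE (_ : edges_at fset0 x = fset0) ?cardfs0 //; apply/fsetP => e; rewrite !inE.
  case: s s3 us => [|a [|b s]] //= _ _; by rewrite /adj inE.
rewrite (_ : defects _ _ _ = fset0) ?cardfs0 //; apply/fsetP => z; rewrite !inE.
by rewrite degreeE (_ : edges_at fset0 z = fset0) ?cardfs0 ?andbF //; apply/fsetP => e; rewrite !inE.
Qed.

Definition w k m x := wsum (forests_le k m) x.
Definition q m x := wsum (bforests m) x.

Lemma w0E m x : w 0 m x = 1 + q m x.
Proof.
by rewrite /w /q /wsum (big_fsetD1 fset0) ?fset0_forests //= cardfs0 expr0.
Qed.

(** [kap] distributes the at most [k] defects among the cells. *)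
Lemma w_S k m x : 0 <= x ->
  w k m.+1 x <= \sum_(kap : {ffun 'I_M -> 'I_k.+1} | (\sum_i kap i <= k)%N)
     \prod_i w (kap i) m x.
Proof.
move=> x0.
(* [inord] is faithful here, since no cell receives more than [k] defects. *)
pose cls G : {ffun 'I_M -> 'I_k.+1} := [ffun i => inord #|` defects h m (restr h m G i)|].
have sumE G : G \in forests_le k m.+1 -> forall i, cls G i = #|` defects h m (restr h m G i)| :> nat.
  move=> /in_forests_le[GE _ dk] i; rewrite ffunE inordK // ltnS.
  apply: leq_trans dk; apply: leq_trans (defects_restr GE).
  by rewrite (bigD1 i) //= leq_addr.
apply: (@wsum_cells _ _ _ _ _ _ _ _ cls (restr h m)) => //.
- move=> G GF; rewrite (eq_bigr _ (fun i _ => sumE _ GF i)).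
  by case/in_forests_le: GF => GE _; apply: leq_trans; exact: defects_restr.
- move=> G GF i; rewrite (sumE _ GF); case/in_forests_le: GF => GE lG _.
  by apply/in_forests_le; split; [exact: restr_sub|exact: linear_forest_restr|].
- by move=> G H /in_forests_le[GE _ _] /in_forests_le[HE _ _]; apply: restr_inj.
- by move=> G /in_forests_le[GE _ _]; apply: card_restr.
Qed.

Lemma w_ge0 k m x : 0 <= x -> 0 <= w k m x.
Proof. exact: wsum_ge0. Qed.

Lemma q_ge0 m x : 0 <= x -> 0 <= q m x.
Proof. exact: wsum_ge0. Qed.

Lemma w_bound k m x (Q W : R) : 0 <= x -> (forall n, w 0 n x <= Q) ->
  1 <= Q -> 1 <= W -> w k 0 x <= W ->
  forall l, (l <= k)%N -> w l m x <= Q * (((k.+1)%:R * Q) ^+ (M * m) * W) ^+ l.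
Proof.
move=> x0 wQ Q1 W1 wW; set Lam := (k.+1)%:R * Q.
have L1 : 1 <= Lam by rewrite /Lam mulr_ege1 // ler1n.
have W0 : 0 <= W by apply: le_trans W1.
have Q0 : 0 <= Q by apply: le_trans Q1.
have L0 : 0 <= Lam by apply: le_trans L1.
elim: m => [|m IH] [|l] lk; rewrite ?expr0 ?mulr1 //.
  rewrite muln0 expr0 mul1r; apply: (le_trans (y := W)).
    apply: le_trans wW; apply: wsum_sub => //; apply/fsubsetP => G /in_forests_le[? ? c].
    by apply/in_forests_le; split=> //; apply: leq_trans lk.
  rewrite -[leLHS]mul1r ler_pM // exprS ler_peMr // exprn_ege1 //.
set Gm := Lam ^+ (M * m) * W in IH.
have G1 : 1 <= Gm by rewrite mulr_ege1 // exprn_ege1.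
have G0 : 0 <= Gm by apply: le_trans G1.
apply: le_trans (w_S _ _ x0) _.
have -> : Lam ^+ (M * m.+1) * W = Lam ^+ M * Gm by rewrite mulnS exprD mulrA.
clearbody Gm.
apply: (le_trans (y := \sum_(kap : {ffun 'I_M -> 'I_l.+2}) Q ^+ M * Gm ^+ l.+1)).
  rewrite [leRHS](bigID (fun kap : {ffun 'I_M -> 'I_l.+2} => (\sum_i kap i <= l.+1)%N)) /=.
  rewrite -[leLHS]addr0 lerD //; last first.
    by apply: sumr_ge0 => kap _; rewrite mulr_ge0 // exprn_ge0.
  apply: ler_sum => kap hk.
  apply: (le_trans (y := \prod_i (Q * Gm ^+ (kap i)))).
    apply: ler_prod => i _; rewrite w_ge0 //=; apply: IH.
    by rewrite -ltnS; apply: leq_trans (ltn_ord (kap i)) _.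
  rewrite big_split /= prodr_const card_ord ler_wpM2l ?exprn_ge0 //.
  by rewrite prodrXr ler_weXn2l.
rewrite sumr_const card_ffun !card_ord -[leLHS]mulr_natl natrX mulrA.
have -> : l.+2%:R ^+ M * Q ^+ M * Gm ^+ l.+1 = (l.+2%:R * Q) ^+ M * Gm ^+ l.+1 by rewrite exprMn.
have -> : Q * (Lam ^+ M * Gm) ^+ l.+1 = (Lam ^+ M) ^+ l.+1 * Q * Gm ^+ l.+1.
  by rewrite exprMn mulrA (mulrC Q).
apply: ler_wpM2r; first by rewrite exprn_ge0.
apply: (le_trans (y := Lam ^+ M)).
  by rewrite lerXn2r ?nnegrE ?mulr_ge0 //; rewrite /Lam ler_wpM2r // ler_nat.
rewrite -[leLHS]mulr1 ler_pM ?exprn_ge0 // exprS ler_peMr ?exprn_ge0 //.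
by do 2!apply: exprn_ege1.
Qed.

(** The two ends of a component are different boundary vertices of level [m.+1], and by [hB_uniq] no
    cell contains two of these. *)
Lemma bforests_cells m G : G \in bforests m.+1 ->
  (1 < #|finset (fun i => restr h m G i != fset0)|)%N.
Proof.
move=> /in_bforests[GE lG n0 dB].
have sG : simple G by apply: simple_sub GE _; exact: hE_simple.
have [x [p [cp dx dl xl]]] := component_two_leaves sG lG n0.
have cell z : degree G z = 1%N -> exists i u, [/\ u \in V m, z = t m i u &
    restr h m G i != fset0].
  move=> dz; have /fset0Pn[e] : edges_at G z != fset0 by rewrite -cardfs_gt0 -degreeE dz.
  rewrite in_edges_at => /andP[eG ze]; have /hE_S[i [e0 [e0E ee]]] := fsubsetP GE _ eG.
  move: (ze); rewrite {1}ee => /imfsetP[u /= ue zu]; exists i, u; split=> //.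
    exact: hE_V e0E ue.
  by apply/fset0Pn; exists e0; rewrite in_restr e0E /tE -ee.
have [i [u [uV xu ri]]] := cell _ dx; have [j [v [vV lv rj]]] := cell _ dl.
have ij : i != j.
  apply/eqP => ij; subst j; case/eqP: xl.
  exact: hB_uniq (dB _ dx) (dB _ dl) uV vV xu lv.
apply/card_gt1P; exists i, j; by rewrite !inE.
Qed.

(** A set [J] of cells with nonempty pieces contributes [q] to the power [#|J|], which is at most
    [q^2] as [q <= 1]; there are [2 ^ M] sets of cells. *)
Lemma q_S m x : 0 <= x -> q m x <= 1 -> q m.+1 x <= 2 ^+ M * q m x ^+ 2.
Proof.
move=> x0 q1.
pose cls G : {set 'I_M} := finset (fun i => restr h m G i != fset0).
pose Bf (J : {set 'I_M}) i : {fset {fset {fset T}}} := if i \in J then bforests m else [fset fset0]%fset.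
have : q m.+1 x <= \sum_(J : {set 'I_M} | (1 < #|J|)%N) \prod_i wsum (Bf J i) x.
  apply: (@wsum_cells _ _ _ _ _ _ _ _ cls (restr h m)) => //.
  - exact: bforests_cells.
  - move=> G /in_bforests[GE lG n0 dB] i; rewrite /Bf inE.
    case: ifP => [n0'|/negbFE/eqP ->]; last by rewrite inE.
    rewrite in_fsetD1 n0' /=; apply/in_forests_le; split.
    - exact: restr_sub.
    - exact: linear_forest_restr.
    rewrite leqn0 -leqn0; apply: leq_trans (_ : _ <= #|` defects h m.+1 G|)%N _.
      by apply: leq_trans (defects_restr GE); rewrite (bigD1 i) //= leq_addr.
    have : G \in bforests m.+1 by apply/in_bforests.
    by rewrite in_fsetD1 => /andP[_ /in_forests_le[]].
  - by move=> G H /in_bforests[GE _ _ _] /in_bforests[HE _ _ _]; apply: restr_inj.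
  - by move=> G /in_bforests[GE _ _ _]; apply: card_restr.
move=> /le_trans; apply.
have q0 := q_ge0 m x0.
apply: (le_trans (y := \sum_(J : {set 'I_M}) q m x ^+ 2)).
  rewrite [leRHS](bigID (fun J : {set 'I_M} => (1 < #|J|)%N)) /=.
  rewrite -[leLHS]addr0 lerD //; last by apply: sumr_ge0 => J _; exact: exprn_ge0.
  apply: ler_sum => J J2.
  rewrite (bigID (mem J)) /= [X in _ * X]big1 ?mulr1; last first.
    move=> i iJ; rewrite /Bf (negbTE iJ) /wsum big_seq_fset1 cardfs0 expr0. by [].
  rewrite (eq_bigr (fun=> q m x)) => [|i iJ]; last by rewrite /Bf iJ.
  by rewrite prodr_const ler_wiXn2l.
by rewrite sumr_const -cardsT -powersetT card_powerset cardsT card_ord -[leLHS]mulr_natl natrX.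
Qed.

End Recursion.

(** * Self-avoiding walks in a hierarchy *)

Section Walks.
Local Open Scope nat_scope.
Local Open Scope classical_set_scope.
Context {T : choiceType}.
Implicit Types (G H : {fset {fset T}}) (u v z : T) (p q : seq T) (n k : nat).

(* A walk is given by its starting vertex and the sequence of its later vertices. *)
Definition saws G v n : set (seq T) :=
  [set p | [/\ size p = n, path (adj G) v p & uniq (v :: p)]].

Lemma finite_saws G v n : finite_set (saws G v n).
Proof.
apply: (@finite_set_inj _ _ _ [set` fpowerset G] (path_edges v)) => [|p q [_ _ up] [_ _ uq]|p [_ pp _]].
- exact: finite_fset.
- exact: path_edges_inj.
- by rewrite /= fpowersetE path_edges_sub.
Qed.

Definition nsaw G v n := count_set (saws G v n).

Lemma nsaw_map (f : T -> T) G H v n : injective f ->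
  (forall x y, adj G x y -> adj H (f x) (f y)) -> nsaw G v n <= nsaw H (f v) n.
Proof.
move=> fi fGH; apply: (@count_set_inj _ _ _ _ (map f)) => [|p q _ _|p [sp pp up]].
- exact: finite_saws.
- exact: inj_map.
- split; first by rewrite size_map.
    by rewrite path_map; apply: sub_path pp.
  by rewrite -map_cons map_inj_uniq.
Qed.

Lemma nsaw_sub G H v n : (G `<=` H)%fset -> nsaw G v n <= nsaw H v n.
Proof. by move=> GH; apply: (@nsaw_map id) => // x y; apply: adj_sub. Qed.

(** Basis of all cuttings of a walk at step [k]; the bound for the continuations has to be uniform
    in the vertex reached. *)
Lemma count_split (A S1 : set (seq T)) (S2 : T -> set (seq T)) v k K1 K2 :
  finite_set S1 -> count_set S1 <= K1 ->
  (forall u, finite_set (S2 u)) -> (forall u, count_set (S2 u) <= K2) ->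
  (forall p, A p -> S1 (take k p) /\ S2 (last v (take k p)) (drop k p)) ->
  finite_set A /\ count_set A <= K1 * K2.
Proof.
move=> f1 c1 f2 c2 AS.
have fA : finite_set A.
  apply: (@finite_set_inj _ _ _ (\bigcup_(p in S1) [set (p, q) | q in S2 (last v p)])
    (fun p => (take k p, drop k p))).
  - by apply: bigcup_finite => // p _; apply: finite_image.
  - by move=> p q _ _ [e1 e2]; rewrite -(cat_take_drop k p) e1 e2 cat_take_drop.
  - by move=> p /AS[h1 h2]; exists (take k p) => //; exists (drop k p).
split=> //.
apply: leq_trans (leq_mul c1 (leqnn K2)).
apply: (@count_set_fiber _ _ _ _ (take k)) => // [p /AS[]//|b _].
apply: leq_trans (c2 (last v b)).
apply: (@count_set_inj _ _ _ _ (drop k)) => // [p q [_ ep] [_ eq] e|p [/AS[_ h] <-] //].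
by rewrite -(cat_take_drop k p) ep -eq e cat_take_drop.
Qed.

Lemma take_saw G v n k p : saws G v n p -> k <= n -> saws G v k (take k p).
Proof.
move=> [sp pp up] kn; split.
- by rewrite size_takel ?sp.
- by move: pp; rewrite -{1}(cat_take_drop k p) cat_path => /andP[].
- by move: up; rewrite -{1}(cat_take_drop k p) -cat_cons cat_uniq => /and3P[].
Qed.

Lemma drop_saw G v n k p : saws G v n p -> k <= n ->
  saws G (last v (take k p)) (n - k) (drop k p).
Proof.
move=> [sp pp up] kn; split.
- by rewrite size_drop sp.
- by move: pp; rewrite -{1}(cat_take_drop k p) cat_path => /andP[].
- move: up; rewrite -{1}(cat_take_drop k p) -cat_cons lastI cat_rcons cat_uniq.
  by move=> /and3P[].
Qed.

Lemma nsaw0 G v : nsaw G v 0 <= 1.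
Proof.
rewrite /nsaw -(cardfs1 ([::] : seq T)) -(set_fsetK [fset ([::] : seq T)]%fset).
apply: count_set_sub; first exact: finite_fset.
by move=> p [/eqP/nilP -> _ _] /=; rewrite inE.
Qed.

End Walks.

Section Cells.
Local Open Scope nat_scope.
Context {T : choiceType} {M : nat} (h : hierarchy T M).
Local Notation V := (hV h). Local Notation E := (hE h). Local Notation B := (hB h).
Local Notation t := (ht h). Local Notation O := (hO h).
Implicit Types (m r n k : nat) (x y z u v : T) (p q : seq T).

(** Nested pairs make [word r] a finite type, with the letter of the largest cell first. Levels are
    written [r + m], so that [r.+1 + m] reduces to [(r + m).+1]. *)
Fixpoint word r : finType := if r is r'.+1 then ('I_M * word r')%type else unit.

Fixpoint cmap m r : word r -> T -> T :=
  if r is r'.+1 then fun w => t (r' + m) w.1 \o cmap m w.2 else fun=> id.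

Lemma M_gt0 : 0 < M.
Proof. by case: M h => // h'; case: (hi0 h'). Qed.

Lemma card_word r : #|word r| = M ^ r.
Proof. by elim: r => [|r IH]; rewrite ?card_unit // card_prod card_ord IH expnS. Qed.

Lemma cmap_inj m r (w : word r) : injective (cmap m w).
Proof. by elim: r w => [|r IH] w x y //= /(@ht_inj _ _ h); apply: IH. Qed.

Lemma cmap_V m r (w : word r) x : x \in V m -> cmap m w x \in V (r + m).
Proof. by elim: r w => [|r IH] w //= xV; apply/hV_S; exists w.1, (cmap m w.2 x); rewrite IH. Qed.

Lemma adj_V m x y : adj (E m) x y -> x \in V m /\ y \in V m.
Proof. by move=> a; split; apply: hE_V a _; rewrite ?fset21 ?fset22. Qed.

Lemma path_V m x p : x \in V m -> path (adj (E m)) x p -> last x p \in V m.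
Proof. by elim: p x => [|y p IH] x //= _ /andP[/adj_V[_ yV]]; apply: IH. Qed.

Lemma adj_cell m r x y : adj (E (r + m)) x y ->
  exists (w : word r) x' y', [/\ adj (E m) x' y', x = cmap m w x' & y = cmap m w y'].
Proof.
elim: r x y => [|r IH] x y /= a; first by exists tt, x, y.
have /hE_S[i [e [eE ee]]] : [fset x; y]%fset \in E (r + m).+1 by [].
have [x0 [y0 [_ Ee]]] := hE_simple eE.
have a0 : adj (E (r + m)) x0 y0 by rewrite /adj -Ee.
have {}ee : [fset x; y]%fset = [fset t (r + m) i x0; t (r + m) i y0]%fset.
  by rewrite -tE2 ee Ee.
have main u v : adj (E (r + m)) u v -> x = t (r + m) i u -> y = t (r + m) i v ->
    exists (w : 'I_M * word r) x' y',
    [/\ adj (E m) x' y', x = t (r + m) w.1 (cmap m w.2 x') & y = t (r + m) w.1 (cmap m w.2 y')].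
  move=> /IH[w [x' [y' [a' -> ->]]]] -> ->; by exists (i, w), x', y'.
have : x \in [fset t (r + m) i x0; t (r + m) i y0]%fset by rewrite -ee fset21.
rewrite in_fset2 => /orP[/eqP hx|/eqP hx]; rewrite hx in ee.
  by apply: (main x0 y0) => //; apply: fset2_inj ee.
apply: (main y0 x0) => //; first by rewrite adjC.
by rewrite (fset2C (t _ _ x0)) in ee; apply: fset2_inj ee.
Qed.

Lemma V_cell m r z : z \in V (r + m) -> exists (w : word r) x, x \in V m /\ z = cmap m w x.
Proof.
elim: r z => [|r IH] z /= zV; first by exists tt, z.
have /hV_S[i [y [/IH[w [x [xV ->]]] ->]]] : z \in V (r + m).+1 by [].
by exists (i, w), x.
Qed.

Lemma B_cell m r (w : word r) x : cmap m w x \in B (r + m) -> x \in V m -> x \in B m.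
Proof.
elim: r w => [|r IH] w //= zB xV.
have [i [y [yB E']]] := hB_cell (zB : _ \in B (r + m).+1).
have iw := hB_one (zB : _ \in B (r + m).+1) (cmap_V w.2 xV) (hB_V yB) erefl E'.
rewrite iw in E'; move/(@ht_inj _ _ h): E' => E'.
by apply: (IH w.2) => //; rewrite E'.
Qed.

Lemma B_cell_uniq m r (w w' : word r) x x' : x \in V m -> x' \in V m ->
  cmap m w x \in B (r + m) -> cmap m w x = cmap m w' x' -> w = w'.
Proof.
elim: r w w' => [|r IH] /=; first by do 2 case.
move=> [i w] [i' w'] /= xV xV' zB E'.
have ii := hB_one (zB : _ \in B (r + m).+1) (cmap_V w xV) (cmap_V w' xV') erefl E'.
subst i'; move/(@ht_inj _ _ h): (E') => E2; congr (_, _); apply: IH E2 => //.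
have [j [y [yB E3]]] := hB_cell (zB : _ \in B (r + m).+1).
have iw := hB_one (zB : _ \in B (r + m).+1) (cmap_V w xV) (hB_V yB) erefl E3.
by rewrite iw in E3; move/(@ht_inj _ _ h): E3 => ->.
Qed.

Lemma cells_meet m r (w w' : word r) x x' : w != w' -> x \in V m -> x' \in V m ->
  cmap m w x = cmap m w' x' -> x \in B m /\ x' \in B m.
Proof.
elim: r w w' => [|r IH] /=; first by do 2 case.
move=> [i w] [i' w'] /= ww xV xV' E'.
have [ii|ii] := eqVneq i i'.
  subst i'; move/(@ht_inj _ _ h): E'; apply: IH => //.
  by apply: contraNneq ww => ->.
have [b1 b2] := h_meet ii (cmap_V w xV) (cmap_V w' xV') E'.
by split; [apply: B_cell b1 _|apply: B_cell b2 _].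
Qed.

Definition cell_at m r z : pred (word r) := fun w => `[< exists2 x, x \in V m & z = cmap m w x >].

(** If [z] lies in two of the [M] largest cells, it is a boundary vertex of each of them that
    contains it, hence lies in a single small cell of each. Otherwise all small cells at [z] lie in
    one largest cell and induction applies. *)
Lemma cell_at_card m r z : #|cell_at m (r := r) z| <= M.
Proof.
elim: r z => [|r IH] z.
  by apply: leq_trans (max_card _) _; rewrite card_unit M_gt0.
have [[[i w] [[j w'] [/asboolP[x xV zx] /asboolP[y yV zy] /= ij]]]|none] :=
  pselect (exists a b : 'I_M * word r,
    [/\ cell_at m (r := r.+1) z a, cell_at m (r := r.+1) z b & a.1 != b.1]).
  have allB i' (w'' : word r) u : u \in V m -> z = t (r + m) i' (cmap m w'' u) -> cmap m w'' u \in B (r + m).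
    move=> uV zu; have [ii|ii] := eqVneq i' i.
      have ji : i' != j by rewrite ii.
      by rewrite zu in zy; have [] := h_meet ji (cmap_V w'' uV) (cmap_V w' yV) zy.
    by rewrite zu in zx; have [] := h_meet ii (cmap_V w'' uV) (cmap_V w xV) zx.
  rewrite -[X in _ <= X]card_ord -(card_in_image (f := @fst 'I_M (word r)) (A := cell_at m (r := r.+1) z)).
    exact: max_card.
  move=> [i1 w1] [i2 w2] /asboolP[x1 x1V z1] /asboolP[x2 x2V z2] /= ii; subst i2.
  congr (_, _); rewrite z1 in z2; move/(@ht_inj _ _ h): z2 => z2.
  by apply: B_cell_uniq z2 => //; apply: allB z1.
case: (pickP (cell_at m (r := r.+1) z)) => [[i w] /asboolP[x xV zx]|none2]; last first.
  by rewrite eq_card0.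
apply: leq_trans (IH (cmap m w x)).
rewrite -(card_in_image (f := @snd 'I_M (word r)) (A := cell_at m (r := r.+1) z)); last first.
  move=> [i1 w1] [i2 w2] c1 c2 /= ww; subst w2; congr (_, _).
  by apply/eqP/negPn/negP => ii; apply: none; exists (i1, w1), (i2, w1).
apply: subset_leq_card; apply/fintype.subsetP => w' /mapP[[i2 w2]]; rewrite mem_enum => c2 -> /=.
have ii : i2 = i.
  apply/eqP/negPn/negP => ii; apply: none; exists (i2, w2), (i, w); split=> //.
  by apply/asboolP; exists x.
subst i2; case/asboolP: c2 => y yV zy; apply/asboolP; exists y => //.
by rewrite zx in zy; move/(@ht_inj _ _ h): zy.
Qed.

Definition cell_saws m r z n : set (seq T) := [set q | exists (w : word r) x p,
  [/\ x \in V m, z = cmap m w x, q = map (cmap m w) p & saws (E m) x n p]].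

Lemma count_cell_saws m r z (P : T -> set (seq T)) X :
  (forall x, x \in V m -> (exists w : word r, z = cmap m w x) ->
     finite_set (P x) /\ count_set (P x) <= X) ->
  finite_set [set q | exists (w : word r) x p,
    [/\ x \in V m, z = cmap m w x, q = map (cmap m w) p & P x p]] /\
  count_set [set q | exists (w : word r) x p,
    [/\ x \in V m, z = cmap m w x, q = map (cmap m w) p & P x p]] <= M * X.
Proof.
move=> cP; set A := (X in finite_set X).
pose s := enum (cell_at m (r := r) z).
pose F (w : word r) := [set q | exists x p,
    [/\ x \in V m, z = cmap m w x, q = map (cmap m w) p & P x p]].
have cF (w : word r) : w \in s -> finite_set (F w) /\ count_set (F w) <= X.
  rewrite mem_enum => /asboolP[x xV zx].
  have [fP kP] := cP x xV (ex_intro _ w zx).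
  have mem q : F w q -> exists2 p, q = map (cmap m w) p & P x p.
    move=> [x' [p [xV' zx' -> Pp]]]; exists p => //.
    by rewrite zx in zx'; rewrite (cmap_inj zx').
  have sub : F w `<=` map (cmap m w) @` P x.
    by move=> q /mem[p -> Pp]; exists p.
  have fI : finite_set (map (cmap m w) @` P x) by apply: finite_image.
  split; first exact: sub_finite_set sub fI.
  apply: leq_trans (count_set_sub fI sub) _; apply: leq_trans kP.
  rewrite /count_set fset_set_image //.
  exact: leq_imfset_card.
have [fA cA] : finite_set A /\ count_set A <= \sum_(w <- s) X.
  apply: (@count_set_cover _ _ s A F (fun=> X)) => [w /cF[]//|w /cF[]//|].
  move=> q [w [x [p [xV zx qp Pp]]]]; exists w; last by exists x, p.
  by rewrite mem_enum; apply/asboolP; exists x.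
split=> //; apply: leq_trans cA _.
rewrite big_const_seq count_predT iter_addn_0 mulnC leq_mul2r; apply/orP; right.
by rewrite -cardE cell_at_card.
Qed.

Definition vertex_at m r z := exists (w : word r) x, x \in B m /\ z = cmap m w x.

Lemma vertex_at_B m r (w : word r) x : x \in V m -> vertex_at m r (cmap m w x) -> x \in B m.
Proof.
move=> xV [w' [x' [xB E']]]; have [ww|ww] := eqVneq w w'.
  by subst w'; rewrite (cmap_inj E').
by have [] := cells_meet ww xV (hB_V xB) E'.
Qed.

(** Consecutive edges in different cells would meet in a vertex of level [m], and the inner vertices
    of the path are none. *)
Lemma cell_path m r v y q : path (adj (E (r + m))) v (y :: q) ->
  (forall z, z \in belast y q -> ~ vertex_at m r z) ->
  exists (w : word r) x p, [/\ x \in V m, v = cmap m w x, y :: q = map (cmap m w) p &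
    path (adj (E m)) x p].
Proof.
elim: q v y => [|y2 q IH] v y /= /andP[vy pq] nv.
  have [w [x' [y' [a -> ->]]]] := adj_cell vy.
  exists w, x', [:: y']; split=> //; first by case: (adj_V a).
  by rewrite /= a.
have [||w [x [p [xV yx e pp]]]] := IH y y2; first exact: pq.
  by move=> z zq; apply: nv; rewrite inE zq orbT.
have [w' [x' [y' [a vx yy]]]] := adj_cell vy.
have ww : w = w'.
  apply/eqP/negPn/negP => ww; apply: (nv y); first by rewrite inE eqxx.
  have [yV' yV] := adj_V a.
  have [] := cells_meet ww xV yV _; first by rewrite -yx.
  by move=> xB _; exists w, x.
subst w'; exists w, x', (x :: p); split=> //.
- by case: (adj_V a).
- by rewrite /= -e -yx.
- rewrite yx in yy; rewrite /= pp andbT.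
  by rewrite (cmap_inj yy).
Qed.

(** For [n = 0] no edge places [v] in a cell, hence the alternative in the hypothesis. *)
Lemma cell_saw m r v n p : saws (E (r + m)) v n p -> 0 < n \/ v \in V (r + m) ->
  (forall k, 0 < k < n -> ~ vertex_at m r (last v (take k p))) ->
  cell_saws m r v n p.
Proof.
case: p => [|y q] sp hv nv.
  have n0 : n = 0 by case: sp => <-.
  have vV : v \in V (r + m) by case: hv => //; rewrite n0.
  have [w [x [xV ->]]] := V_cell vV; exists w, x, [::]; split=> //.
case: sp => sn pp up.
have [|w [x [p' [xV vx e pp']]]] := cell_path pp.
  move=> z zq; have := index_mem z (belast y q); rewrite zq size_belast => /idP iq.
  have kn : 0 < (index z (belast y q)).+1 < n by rewrite -sn /= ltnS.
  move: (nv _ kn).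
  suff -> : last v (take (index z (belast y q)).+1 (y :: q)) = z by [].
  rewrite (last_nth v) /= size_takel ?(ltnW iq) //.
  rewrite -[in RHS](nth_index v zq) -[y :: take _ q]/(take (index z (belast y q)).+1 (y :: q)).
  rewrite nth_take // lastI nth_rcons size_belast iq. by [].
exists w, x, p'; split=> //; split=> //.
- by rewrite -sn e size_map.
- by move: up; rewrite e vx -map_cons map_inj_uniq //; apply: cmap_inj.
Qed.


Definition crossing m n := forall x y p, x \in B m -> y \in B m -> x != y ->
  path (adj (E m)) x p -> last x p = y -> n <= size p.

Lemma first_vertex m r v p : path (adj (E (r + m))) v p -> p != [::] ->
  vertex_at m r (last v p) ->
  exists p1 p2, [/\ p = p1 ++ p2, p1 != [::], vertex_at m r (last v p1) &
    forall k, 0 < k < size p1 -> ~ vertex_at m r (last v (take k p1))].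
Proof.
move=> pp pn vl.
have exk : exists k, (0 < k <= size p) && `[< vertex_at m r (last v (take k p)) >].
  exists (size p); rewrite leqnn lt0n size_eq0 pn /= take_size; exact/asboolP.
case: (ex_minnP exk) => k /andP[/andP[k0 kp] /asboolP kv] kmin.
exists (take k p), (drop k p); split=> //; first by rewrite cat_take_drop.
  by rewrite -size_eq0 size_takel // -lt0n.
move=> j; rewrite size_takel // => /andP[j0 jk] vj.
have : k <= j.
  apply: kmin; rewrite j0 (leq_trans (ltnW jk) kp) /=; apply/asboolP.
  by move: vj; rewrite take_takel // ltnW.
by rewrite leqNgt jk.
Qed.

Lemma vertex_walk m r n v p : crossing m n -> vertex_at m r v -> p != [::] ->
  path (adj (E (r + m))) v p -> uniq (v :: p) -> vertex_at m r (last v p) ->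
  n <= size p.
Proof.
move=> cr vv pn pp up vl.
have [p1 [p2 [E' p1n vl1 nv]]] := first_vertex pp pn vl.
have sp1 : saws (E (r + m)) v (size p1) p1.
  split=> //; first by move: pp; rewrite E' cat_path => /andP[].
  by move: up; rewrite E' -cat_cons cat_uniq => /and3P[].
have [|w [x [p' [xV vx e [sp' pp' up']]]]] := cell_saw sp1 _ nv.
  by left; rewrite lt0n size_eq0.
have xB : x \in B m by apply: (@vertex_at_B m r w) => //; rewrite -vx.
rewrite e vx last_map in vl1.
have lV : last x p' \in V m.
  exact: path_V pp'.
have lB := vertex_at_B lV vl1.
have xl : x != last x p'.
  case: p' up' e {lV lB vl1 sp' pp'} => [|y q]; first by move=> _ e; rewrite e in p1n.
  by case/andP=> + _ _; apply: contraNneq => E2; rewrite E2; exact: (mem_last y q).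
rewrite E' size_cat e size_map; apply: leq_trans (leq_addr _ _).
by apply: (cr x (last x p')).
Qed.

Lemma short_saw m r n k v p : crossing m n -> vertex_at m r v -> k <= n ->
  saws (E (r + m)) v k p -> cell_saws m r v k p.
Proof.
move=> cr vv kn sp; apply: cell_saw (sp) _ _.
  by right; case: vv => w [x [xB ->]]; apply/cmap_V/hB_V.
move=> j /andP[j0 jk] vj.
have [sj pj uj] := take_saw sp (ltnW jk).
have : n <= size (take j p).
  by apply: (vertex_walk cr vv) => //; rewrite -size_eq0 sj -lt0n.
by rewrite sj leqNgt (leq_trans jk kn).
Qed.

Lemma crossing0 : crossing 0 1.
Proof. by move=> x y [|z p] //= _ _ xy _ E'; rewrite E' eqxx in xy. Qed.

(** No cell contains two boundary vertices of level [m.+1], so a path between two of them leaves its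
    first cell. It meets a vertex of level [m] on the way, and both parts have length at least
    [n]. *)
Lemma crossingS m n : crossing m n -> crossing m.+1 (2 * n).
Proof.
move=> cr x y p xB yB xy pp lp.
case/shortenP: pp lp => p' pp' up' sp' lp.
apply: leq_trans (_ : size p' <= _); last by apply: uniq_leq_size => //; case/andP: up'.
have vert z : z \in B m.+1 -> vertex_at m 1 z.
  by move=> /hB_cell[i [u [uB ->]]]; exists (i, tt), u.
have p'n : p' != [::] by apply/eqP => E'; rewrite E' /= in lp; rewrite lp eqxx in xy.
have vl : vertex_at m 1 (last x p') by rewrite lp; apply: vert.
have [p1 [p2 [E' p1n vl1 nv]]] := first_vertex (pp' : path (adj (E (1 + m))) x p') p'n vl.
have u1 : uniq (x :: p1) by move: up'; rewrite E' -cat_cons cat_uniq => /and3P[].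
have pp1 : path (adj (E (1 + m))) x p1 by move: pp'; rewrite E' cat_path => /andP[].
have n1 : n <= size p1 by apply: (vertex_walk cr (vert _ xB)).
have p2n : p2 != [::].
  apply/eqP => p20; rewrite p20 cats0 in E'.
  have sp1 : saws (E (1 + m)) x (size p1) p1 by [].
  have [|w [a [q [aV xa e [sq pq uq]]]]] := cell_saw sp1 _ nv.
    by left; rewrite lt0n size_eq0.
  have lV : last a q \in V m.
    exact: path_V pq.
  case/eqP: xy; apply: (hB_uniq xB yB aV lV xa).
  by rewrite -lp E' e xa last_map.
have n2 : n <= size p2.
  apply: (vertex_walk cr vl1) => //.
  - by move: pp'; rewrite E' cat_path => /andP[].
  - by move: up'; rewrite E' -cat_cons lastI cat_rcons cat_uniq => /and3P[].
  - by rewrite -last_cat -E'.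
by rewrite E' size_cat mul2n -addnn leq_add.
Qed.

Lemma crossing_exp m : crossing m (2 ^ m).
Proof. by elim: m => [|m /crossingS]; [exact: crossing0|rewrite expnS]. Qed.

Lemma crossing_le m n k : k <= n -> crossing m n -> crossing m k.
Proof. by move=> kn cr x y p xB yB xy pp lp; apply: leq_trans kn (cr x y p _ _ _ _ _). Qed.

Lemma E_S_sub m : (E m `<=` E m.+1)%fset.
Proof.
apply/fsubsetP => e eE; apply/hE_S; exists (hi0 h), e; split=> //.
apply/fsetP => z; apply/idP/imfsetP => [ze|[y /= ye ->]]; last by rewrite ht_i0.
by exists z; rewrite ?ht_i0.
Qed.

Lemma E_sub r m : (E m `<=` E (r + m))%fset.
Proof.
by elim: r => [|r IH]; [exact: fsubset_refl|exact: fsubset_trans IH (E_S_sub _)].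
Qed.

(* Within [n] steps a self-avoiding walk from the origin cannot leave level [n]. *)
Definition H n := nsaw (E n) O n.

Lemma nsaw_O m n r : crossing m n -> nsaw (E (r + m)) O n <= nsaw (E m) O n.
Proof.
move=> cr; pose w0 : word r := (fix f r : word r := if r is r'.+1 then (hi0 h, f r') else tt) r.
have w0E x : cmap m w0 x = x.
  rewrite /w0; elim: r {w0} x => [|r IH] x //=; by rewrite IH ht_i0.
have OV : O \in V m by apply/hB_V/hO_B.
have vO : vertex_at m r O by exists w0, O; rewrite w0E hO_B.
apply: (@count_set_inj _ _ _ _ id) => // [|p sp]; first exact: finite_saws.
have [w [x [p' [xV Ox e sp']]]] := short_saw cr vO (leqnn n) sp.
have OB : cmap m w x \in B (r + m) by rewrite -Ox hO_B.
have ww : w = w0.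
  apply: (@B_cell_uniq m r w w0 x O) => //; by rewrite w0E.
subst w; rewrite w0E in Ox; subst x.
rewrite e; have -> : map (cmap m w0) p' = p' by rewrite -[RHS]map_id; apply: eq_map.
exact: sp'.
Qed.

Lemma nsaw_B m x n : x \in B m -> nsaw (E m) x n <= nsaw (E m) O n.
Proof.
move=> xB; have [phi [ip px _ ae]] := h_auto xB (hO_B h m).
by rewrite -px; apply: nsaw_map.
Qed.

(** A symmetry moves [x] to the origin, and the enlarged level [n + m] is cut down to level [n],
    whose crossings have length at least [2 ^ n]. *)
Lemma nsaw_H m x n : x \in B m -> nsaw (E m) x n <= H n.
Proof.
move=> xB; apply: leq_trans (nsaw_B _ xB) _.
apply: leq_trans (nsaw_sub _ _ (E_sub n m)) _.
rewrite addnC; apply: nsaw_O; refine (crossing_le _ (@crossing_exp n)).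
exact: ltnW (ltn_expl _ _).
Qed.


Lemma count_saws_cells m r z n X : (forall x, x \in V m ->
    (exists w : word r, z = cmap m w x) -> nsaw (E m) x n <= X) ->
  finite_set (cell_saws m r z n) /\ count_set (cell_saws m r z n) <= M * X.
Proof.
move=> hX; apply: (@count_cell_saws m r z (fun x => saws (E m) x n)) => x xV zx.
by split; [exact: finite_saws|exact: hX].
Qed.

Lemma last_take k v p : k <= size p -> last v (take k p) = nth v (v :: p) k.
Proof. by case: k => [|k] kp; rewrite ?take0 // (take_nth v kp) last_rcons. Qed.

(* A walk of length [n] below the crossing distance of level [j] meets at most one vertex of
   that level; splitting it there leaves two walks inside single cells. *)
Lemma nsaw_level j r v n (X : nat -> nat) : crossing j n -> 0 < n ->
  (forall x k, x \in V j -> nsaw (E j) x k <= X k) ->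
  nsaw (E (r + j)) v n <= M * X n + \sum_(a <- iota 0 n.+1) (M * X a) * (M * X (n - a)).
Proof.
move=> cr n0 hX.
pose F a := [set p | [/\ saws (E (r + j)) v n p, cell_saws j r v a (take a p),
   vertex_at j r (last v (take a p)) & cell_saws j r (last v (take a p)) (n - a) (drop a p)]].
have cs z k : finite_set (cell_saws j r z k) /\ count_set (cell_saws j r z k) <= M * X k.
  by apply: count_saws_cells => x xV _; exact: hX.
have cF a : finite_set (F a) /\ count_set (F a) <= (M * X a) * (M * X (n - a)).
  have [c1 c2] := cs v a.
  by apply: (count_split (v := v) (k := a) c1 c2 (fun u => (cs u (n - a)).1)
    (fun u => (cs u (n - a)).2)) => p [].
pose G (i : option nat) := if i is Some a then F a else cell_saws j r v n.
pose K (i : option nat) := if i is Some a then (M * X a) * (M * X (n - a)) else M * X n.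
have [_] : finite_set (saws (E (r + j)) v n) /\ nsaw (E (r + j)) v n <=
    \sum_(i <- None :: map Some (iota 0 n.+1)) K i.
  apply: (@count_set_cover _ _ _ _ G) => [[a|] _|[a|] _|p sp].
  - by case: (cF a).
  - by case: (cs v n).
  - by case: (cF a).
  - by case: (cs v n).
  have [sn pp up] := sp.
  have [[k [kn kv]]|none] := pselect (exists k, k <= n /\ vertex_at j r (last v (take k p))).
    have exk : exists k, `[< vertex_at j r (last v (take k p)) >] by exists k; apply/asboolP.
    (* Cut at the first vertex of level [j]: before it the walk is in one cell by minimality, after
       it by [short_saw]. *)
    case: (ex_minnP exk) => a /asboolP av amin.
    have an : a <= n by apply: leq_trans kn; apply: amin; apply/asboolP.
    exists (Some a).
      by rewrite inE; apply/orP; right; apply: map_f; rewrite mem_iota add0n ltnS.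
    have ssa := take_saw sp an.
    split=> //; last by apply: (short_saw cr av (leq_subr _ _)); apply: drop_saw.
    apply: cell_saw (ssa) _ _; last first.
      move=> i /andP[i0 ia]; rewrite take_takel ?(ltnW ia) // => iv.
      by have := amin i; rewrite leqNgt ia => /(_ (asboolT iv)).
    have [a0|] := posnP a; last by left.
    right; move: av; rewrite a0 take0 /= => -[w [x [xB ->]]]; exact/cmap_V/hB_V.
  exists None; first by rewrite inE.
  apply: cell_saw (sp) _ _; first by left.
  by move=> k /andP[k0 kn] kv; apply: none; exists k; rewrite ltnW.
by rewrite big_cons big_map.
Qed.

Section Star.
Context (C : nat -> nat).
Context (hC : forall m v k, nsaw (E m) v k <= C k).
Context (C_mono : {homo C : m n / m <= n}).

Lemma word_vertices m r (s : seq T) : uniq s -> {in s, forall z, vertex_at m r z} ->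
  size s <= M ^ r * #|` B 0|.
Proof.
move=> us sv.
have -> : M ^ r * #|` B 0| = size [seq cmap m w x | w <- enum (word r), x <- B m].
  by rewrite size_allpairs -cardE card_word -(hB_card h m).
apply: uniq_leq_size => // z /sv[w [x [xB ->]]].
by apply/allpairsP; exists (w, x); rewrite mem_enum.
Qed.

(** Among [K.+1] blocks of [2 * n] steps one has no vertex of level [l] in its interior, because
    there are at most [K] such vertices and each is visited at most once. *)
Lemma block_free l r x p n : saws (E (r + l)) x (2 * n * (M ^ r * #|` B 0|).+1) p ->
  exists j, [/\ j <= M ^ r * #|` B 0| & forall k, 0 < k < 2 * n ->
    ~ vertex_at l r (last x (take (2 * n * j + k) p))].
Proof.
set K := M ^ r * #|` B 0| => -[sp pp up].
apply: contrapT => /forallNP none.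
have hit j : j <= K -> exists k, [/\ 0 < k, k < 2 * n &
    vertex_at l r (last x (take (2 * n * j + k) p))].
  move=> jK; apply: contrapT => /forallNP nk; apply: (none j); split=> // k /andP[k0 kn] kv.
  by apply: (nk k).
have {}hit j : exists k, j <= K -> [/\ 0 < k, k < 2 * n &
    vertex_at l r (last x (take (2 * n * j + k) p))].
  have [jK|jK] := leqP j K; last by exists 0.
  by have [k hk] := hit j jK; exists k.
have [f hf] := choice hit.
pose pos j := (2 * n * j + f j).-1.
have posE j : j <= K -> (pos j).+1 = 2 * n * j + f j.
  by case/hf => f0 _ _; rewrite /pos prednK // addn_gt0 f0 orbT.
have pos_lt j : j <= K -> pos j < size p.
  move=> jK; have [f0 f1 _] := hf j jK.
  by rewrite posE // sp mulnS; nia.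
pose s := [seq nth x p (pos j) | j <- iota 0 K.+1].
have us : uniq s.
  rewrite map_inj_in_uniq ?iota_uniq // => i j.
  rewrite !mem_iota !add0n !ltnS => /andP[_ iK] /andP[_ jK] /eqP.
  rewrite nth_uniq ?pos_lt //; last by case/andP: up.
  move=> /eqP e; have [a1 a2 _] := hf i iK; have [b1 b2 _] := hf j jK.
  have := posE _ iK; rewrite e posE // => e2.
  have : 2 * n * i < 2 * n * j.+1 by rewrite mulnS; lia.
  have : 2 * n * j < 2 * n * i.+1 by rewrite mulnS; lia.
  by rewrite !ltn_mul2l => /andP[_ ?] /andP[_ ?]; lia.
have : size s <= K.
  apply: (@word_vertices l r) => // z /mapP[j]; rewrite mem_iota add0n ltnS => /andP[_ jK] ->.
  have [f0 f1 fv] := hf j jK; rewrite -[nth _ _ _]/(nth x (x :: p) (pos j).+1).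
  by rewrite -last_take ?pos_lt // posE.
by rewrite size_map size_iota ltnn.
Qed.

Lemma last_take_drop v p a k :
  last (last v (take a p)) (take k (drop a p)) = last v (take (a + k) p).
Proof. by rewrite takeD last_cat. Qed.

(* Either the walk meets a vertex of level [r1 + l] early, and its next [n] steps stay in one cell
   of that level; or its first steps stay in such a cell, which has few vertices of level [l], and
   some [2 * n] consecutive steps avoid them. *)
Lemma nsaw_long l r1 r2 v n N X : 0 < n -> crossing (r1 + l) n ->
  (forall x, x \in V l -> nsaw (E l) x (2 * n) <= X) ->
  N = n + 2 * n * (M ^ r1 * #|` B 0|).+1 ->
  nsaw (E (r2 + (r1 + l))) v N <=
    \sum_(a <- iota 0 (N - n).+1) C a * (M * H n * C (N - a - n)) +
    \sum_(a <- iota 0 (N - 2 * n).+1) C a * (M * (M * X) * C (N - a - 2 * n)).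
Proof.
set m := r1 + l; set K := M ^ r1 * _ => n0 cr hX NE.
pose F1 a := [set p | [/\ saws (E (r2 + m)) v N p, a + n <= N &
  vertex_at m r2 (last v (take a p))]].
pose cell2 z := [set q | exists (w : word r2) x p,
    [/\ x \in V m, z = cmap m w x, q = map (cmap m w) p & cell_saws l r1 x (2 * n) p]].
pose F2 a := [set p | [/\ saws (E (r2 + m)) v N p, a + 2 * n <= N &
  cell2 (last v (take a p)) (take (2 * n) (drop a p))]].
have c2 z : finite_set (cell2 z) /\ count_set (cell2 z) <= M * (M * X).
  apply: count_cell_saws => x _ _; apply: count_saws_cells => y yV _; exact: hX.
have cF1 a : finite_set (F1 a) /\ count_set (F1 a) <= C a * (M * H n * C (N - a - n)).
  pose S2 u := [set q | [/\ n <= N - a, vertex_at m r2 u & saws (E (r2 + m)) u (N - a) q]].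
  have cS2 u : finite_set (S2 u) /\ count_set (S2 u) <= M * H n * C (N - a - n).
    have [vu|nvu] := pselect (vertex_at m r2 u); last first.
      rewrite (_ : S2 u = set0) ?count_set0 //.
      by apply/seteqP; split=> q //; case.
    have [f3 k3] : finite_set (cell_saws m r2 u n) /\ count_set (cell_saws m r2 u n) <= M * H n.
      apply: count_saws_cells => x xV [w uw]; apply: nsaw_H.
      by apply: (@vertex_at_B m r2 w) => //; rewrite -uw.
    apply: (count_split (v := u) (k := n) f3 k3
      (fun u' => finite_saws (E (r2 + m)) u' (N - a - n)) (fun u' => hC (r2 + m) u' _)).
    move=> q [nN _ sq]; split; last exact: drop_saw sq nN.
    exact: (short_saw cr vu (leqnn n) (take_saw sq nN)).
  apply: (count_split (v := v) (k := a) (finite_saws (E (r2 + m)) v a) (hC (r2 + m) v a)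
    (fun u => (cS2 u).1) (fun u => (cS2 u).2)) => p [sp aN va].
  have aN' : a <= N by apply: leq_trans aN; exact: leq_addr.
  split; first exact: take_saw sp aN'.
  by split=> //; [rewrite leq_subRL // | exact: drop_saw sp aN'].
have cF2 a : finite_set (F2 a) /\ count_set (F2 a) <= C a * (M * (M * X) * C (N - a - 2 * n)).
  pose S2 u := [set q | [/\ 2 * n <= N - a, cell2 u (take (2 * n) q) & saws (E (r2 + m)) u (N - a) q]].
  have cS2 u : finite_set (S2 u) /\ count_set (S2 u) <= M * (M * X) * C (N - a - 2 * n).
    apply: (count_split (v := u) (k := 2 * n) (c2 u).1 (c2 u).2
      (fun u' => finite_saws (E (r2 + m)) u' (N - a - 2 * n)) (fun u' => hC (r2 + m) u' _)).
    by move=> q [nN cq sq]; split=> //; exact: drop_saw sq nN.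
  apply: (count_split (v := v) (k := a) (finite_saws (E (r2 + m)) v a) (hC (r2 + m) v a)
    (fun u => (cS2 u).1) (fun u => (cS2 u).2)) => p [sp aN va].
  have aN' : a <= N by apply: leq_trans aN; exact: leq_addr.
  split; first exact: take_saw sp aN'.
  by split=> //; [rewrite leq_subRL // | exact: drop_saw sp aN'].
pose G (i : bool * nat) := if i.1 then F1 i.2 else F2 i.2.
pose k (i : bool * nat) := if i.1 then C i.2 * (M * H n * C (N - i.2 - n))
  else C i.2 * (M * (M * X) * C (N - i.2 - 2 * n)).
have [_] : finite_set (saws (E (r2 + m)) v N) /\ nsaw (E (r2 + m)) v N <=
    \sum_(i <- map (pair true) (iota 0 (N - n).+1) ++
      map (pair false) (iota 0 (N - 2 * n).+1)) k i.
  apply: (@count_set_cover _ _ _ _ G) => [[[] a] _|[[] a] _|p sp].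
  - by case: (cF1 a).
  - by case: (cF2 a).
  - by case: (cF1 a).
  - by case: (cF2 a).
  (* The condition [a + n <= N] leaves room for [n] steps after the vertex; by the choice of [N] it
     covers all of the first [2 * n * K.+1] steps. *)
  have [[a [aN av]]|none] := pselect (exists a, a + n <= N /\ vertex_at m r2 (last v (take a p))).
    exists (true, a) => //; rewrite mem_cat; apply/orP; left; apply: map_f.
    by rewrite mem_iota add0n ltnS /= leq_subRL; lia.
  have N'N : 2 * n * K.+1 <= N by rewrite NE leq_addl.
  have N'0 : 0 < 2 * n * K.+1 by rewrite !muln_gt0 n0.
  have [||w [x [p' [xV vx e sp']]]] := cell_saw (take_saw sp N'N) _ _.
  - by left.
  - move=> j /andP[_ jN]; rewrite take_takel ?(ltnW jN) // => vj.
    by apply: none; exists j; split=> //; rewrite NE addnC leq_add2l ltnW.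
  have [j [jK jf]] := block_free sp'.
  have jN : 2 * n * j + 2 * n <= 2 * n * K.+1 by rewrite -mulnSr leq_mul2l ltnS jK orbT.
  have jN' : 2 * n * j <= 2 * n * K.+1 by apply: leq_trans jN; exact: leq_addr.
  exists (false, 2 * n * j).
    rewrite mem_cat; apply/orP; right; apply: map_f.
    by rewrite mem_iota add0n ltnS /=; lia.
  split=> //; first exact: leq_trans N'N.
  have E1 : take (2 * n * j) p = map (cmap m w) (take (2 * n * j) p').
    by rewrite map_take -e take_takel.
  have E2 : take (2 * n) (drop (2 * n * j) p) =
      map (cmap m w) (take (2 * n) (drop (2 * n * j) p')).
    by rewrite map_take map_drop -e !take_drop take_takel // addnC.
  exists w, (last x (take (2 * n * j) p')), (take (2 * n) (drop (2 * n * j) p')).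
  split=> //.
  - by apply: path_V xV _; case: (take_saw sp' jN').
  - by rewrite E1 vx last_map.
  have sseg : saws (E (r1 + l)) (last x (take (2 * n * j) p')) (2 * n)
      (take (2 * n) (drop (2 * n * j) p')).
    by apply: take_saw (drop_saw sp' jN') _; rewrite leq_subRL.
  apply: cell_saw sseg _ _; first by left; rewrite muln_gt0.
  move=> i /andP[i0 iN]; rewrite take_takel ?(ltnW iN) // last_take_drop.
  by apply: jf; rewrite i0.
by rewrite big_cat !big_map.
Qed.

Section Distance.
Context (l D : nat).
Context (hD : forall u, u \in V l ->
  exists p, [/\ path (adj (E l)) O p, last O p = u & size p <= D]).

Let walk_to u k := `[< exists p, [/\ path (adj (E l)) O p, last O p = u & size p = k] >].

(** Distance from [O] in the graph of level [l]. The default 0 is for unreachable vertices; [hD]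
    makes every vertex of the level reachable. *)
Definition dist u : nat :=
  if pselect (exists k, walk_to u k) is left e then ex_minn e else 0.

Lemma dist_le p : path (adj (E l)) O p -> dist (last O p) <= size p.
Proof.
move=> pp; rewrite /dist; case: pselect => // e; case: ex_minnP => k _; apply.
by apply/asboolP; exists p.
Qed.

Lemma geodesic u : u \in V l -> dist u <= D /\
  exists g, [/\ path (adj (E l)) O g, last O g = u, size g = dist u & uniq (O :: g)].
Proof.
move=> uV; have [p [pp lp sp]] := hD uV; split.
  by rewrite -lp; apply: leq_trans sp; exact: dist_le.
rewrite /dist; case: pselect => [e|[]]; last by exists (size p); apply/asboolP; exists p.
case: ex_minnP => k /asboolP[g [pg lg sg]] kmin.
case/shortenP: pg lg => g' pg' ug' subg lg'; exists g'; split=> //.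
apply/eqP; rewrite eqn_leq; apply/andP; split.
  by rewrite -sg; apply: uniq_leq_size => //; case/andP: ug'.
by apply: kmin; apply/asboolP; exists g'.
Qed.

(** The vertices of the geodesic before [u] are strictly nearer to [O] than any vertex of [q], so
    the concatenation does not meet itself. *)
Lemma geodesic_cat u k g q : path (adj (E l)) O g -> last O g = u -> size g = dist u ->
  uniq (O :: g) -> saws (E l) u k q -> {in u :: q, forall z, dist u <= dist z} ->
  saws (E l) O (dist u + k) (g ++ q).
Proof.
move=> pg lg sg ug [sq pq uq] du; split.
- by rewrite size_cat sg sq.
- by rewrite cat_path pg lg.
have /andP[uq1 uq2] : (u \notin q) && uniq q by [].
rewrite -cat_cons cat_uniq ug uq2 andbT /=.
apply/hasPn => z zq; apply/negP => /= zg.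
have [i [ig zi]] : exists i, i <= size g /\ z = last O (take i g).
  have ig : index z (O :: g) <= size g by rewrite -ltnS; move: zg; rewrite -index_mem.
  by exists (index z (O :: g)); rewrite last_take // nth_index.
have pi : path (adj (E l)) O (take i g).
  by move: pg; rewrite -{1}(cat_take_drop i g) cat_path => /andP[].
have := dist_le pi; rewrite size_takel // -zi => di.
have := du z; rewrite inE zq orbT => /(_ isT) dz.
have ii : i = size g by apply/eqP; rewrite eqn_leq ig sg (leq_trans dz di).
by rewrite zi ii take_size lg in zq; rewrite zq in uq1.
Qed.

Let near n i v := [set p | [/\ v \in V l, saws (E l) v (2 * n) p & forall z, z \in v :: p ->
  dist (last v (take i p)) <= dist z]].

(** At step [i] the walk is at a vertex [u] nearest to [O]. A geodesic from [O] to [u] followed by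
    the next [n - dist u] steps is a self-avoiding walk of length [n], counted by [H n]; the
    remaining [n - i + dist u] steps are at most [n - i + D]. *)
Let count_near n i v : D <= n -> i <= n ->
  finite_set (near n i v) /\ count_set (near n i v) <= C i * (H n * C (n - i + D)).
Proof.
move=> Dn i_n.
pose S2 u := [set q | [/\ u \in V l, saws (E l) u (2 * n - i) q &
  {in u :: q, forall z, dist u <= dist z}]].
have cS2 u : finite_set (S2 u) /\ count_set (S2 u) <= H n * C (n - i + D).
  have [uV|nuV] := boolP (u \in V l); last first.
    rewrite (_ : S2 u = set0) ?count_set0 //.
    by apply/seteqP; split=> q //=; case => /(negP nuV).
  have [du [g [pg lg sg ug]]] := geodesic uV.
  pose k := n - dist u.
  pose S1 := [set q | saws (E l) u k q /\ {in u :: q, forall z, dist u <= dist z}].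
  have dk : dist u + k = n by rewrite subnKC // (leq_trans du).
  have [f1 c1] : finite_set S1 /\ count_set S1 <= H n.
    split; first by apply: sub_finite_set (finite_saws (E l) u k) => q [].
    apply: leq_trans (nsaw_H n (hO_B h l)).
    apply: (@count_set_inj _ _ _ _ (cat g)) => [|q1 q2 _ _ /eqP|q [sq dq]].
    - exact: finite_saws.
    - by rewrite eqseq_cat // eqxx => /eqP.
    - by rewrite -dk; apply: geodesic_cat.
  have cC u' : count_set (saws (E l) u' (2 * n - i - k)) <= C (n - i + D).
    apply: leq_trans (hC l u' _) _; apply: C_mono; lia.
  apply: (count_split (v := u) (k := k) f1 c1 (fun u' => finite_saws (E l) u' _) cC).
  move=> q [_ sq dq].
  have kn : k <= 2 * n - i by lia.
  split; last exact: drop_saw sq kn.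
  split; first exact: take_saw sq kn.
  move=> z; rewrite inE => zq; apply: dq; rewrite inE.
  by case/orP: zq => [->//|/mem_take ->]; rewrite orbT.
apply: (count_split (v := v) (k := i) (finite_saws (E l) v i) (hC l v i)
    (fun u => (cS2 u).1) (fun u => (cS2 u).2)) => p [vV sp dp].
have i2n : i <= 2 * n by lia.
split; first exact: take_saw sp i2n.
split; [by apply: path_V vV _; case: (take_saw sp i2n)|exact: drop_saw sp i2n|].
move=> z zq; apply: dp.
have -> : v :: p = belast v (take i p) ++ last v (take i p) :: drop i p.
  by rewrite -cat_rcons -lastI /= cat_take_drop.
by rewrite mem_cat zq orbT.
Qed.

(** If the point nearest to [O] comes in the second half, the walk is reversed; its new starting
    vertex is one of the vertices of the level, which explains the factor. *)
Lemma nsaw_near n v : D <= n -> v \in V l ->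
  nsaw (E l) v (2 * n) <=
    (#|` V l|.+1) * \sum_(i <- iota 0 n.+1) C i * (H n * C (n - i + D)).
Proof.
move=> Dn vV; set S := \sum_(i <- _) _.
pose N1 u := [set p | exists i, i <= n /\ near n i u p].
have cN1 u : finite_set (N1 u) /\ count_set (N1 u) <= S.
  apply: (@count_set_cover _ _ (iota 0 n.+1) _ (fun i => near n i u)) => [i|i|p [i [iN ip]]].
  - by rewrite mem_iota add0n ltnS => /= iN; case: (count_near u Dn iN).
  - by rewrite mem_iota add0n ltnS => /= iN; case: (count_near u Dn iN).
  - by exists i => //; rewrite mem_iota add0n ltnS.
pose N2 u := [set p | [/\ saws (E l) v (2 * n) p, last v p = u & N1 u (rpath v p)]].
have cN2 u : finite_set (N2 u) /\ count_set (N2 u) <= S.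
  have inj p q : N2 u p -> N2 u q -> rpath v p = rpath v q -> p = q.
    move=> [_ lp _] [_ lq _] e; have := rpathE v p; rewrite lp e -lq rpathE.
    by move=> /(congr1 rev); rewrite !revK => -[].
  have sub p : N2 u p -> N1 u (rpath v p) by case.
  split; first exact: finite_set_inj (cN1 u).1 inj sub.
  apply: leq_trans (cN1 u).2; exact: count_set_inj (cN1 u).1 inj sub.
pose G (i : option T) := if i is Some u then N2 u else N1 v.
have [_] : finite_set (saws (E l) v (2 * n)) /\ nsaw (E l) v (2 * n) <=
    \sum_(i <- None :: map Some (enum_fset (V l))) S.
  apply: (@count_set_cover _ _ _ _ G) => [[u|] _|[u|] _|p sp].
  - by case: (cN2 u).
  - by case: (cN1 v).
  - by case: (cN2 u).
  - by case: (cN1 v).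
  have [i [iN imin]] : exists i, i <= 2 * n /\ forall z, z \in v :: p ->
      dist (last v (take i p)) <= dist z.
    pose P k := has (fun z => dist z == k) (v :: p).
    have exP : exists k, P k by exists (dist v); rewrite /P /= eqxx.
    case: (ex_minnP exP) => k /hasP[z zp /eqP dz] kmin.
    have [sn _ _] := sp.
    exists (index z (v :: p)); split.
      by have := zp; rewrite -index_mem /= ltnS sn.
    move=> y yp; have -> : last v (take (index z (v :: p)) p) = z.
      by rewrite last_take ?nth_index // -ltnS; move: zp; rewrite -index_mem.
    by rewrite dz; apply: kmin; apply/hasP; exists y.
  have [i_n|n_i] := leqP i n.
    by exists None; [rewrite inE|exists i].
  have [sn pp up] := sp.
  have lV : last v p \in V l by apply: path_V pp.
  exists (Some (last v p)).
    by rewrite inE; apply/orP; right; apply: map_f.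
  split=> //; exists (2 * n - i); split; first by lia.
  have srp : size (rpath v p) = 2 * n by rewrite size_rev size_belast.
  split=> //.
    split=> //; last by rewrite rpathE rev_uniq.
    by rewrite -path_edges_sub path_edges_rev path_edges_sub.
  have E1 : last (last v p) (take (2 * n - i) (rpath v p)) = last v (take i p).
    rewrite !last_take ?srp ?sn ?leq_subr // rpathE nth_rev /= ?sn ?ltnS ?leq_subr //.
    have -> : (2 * n).+1 - (2 * n - i).+1 = i by lia.
    by apply: set_nth_default; rewrite /= sn ltnS.
  by move=> z; rewrite E1 rpathE mem_rev; exact: imin.
rewrite big_cons big_map big_const_seq count_predT iter_addn_0.
by rewrite (mulnC #|` V l|.+1 S) mulnS; apply: leq_trans.
Qed.

End Distance.

End Star.

End Cells.

(** * Scales and path weights *)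

Section Scales.
Local Open Scope nat_scope.
Context {T : choiceType} {M : nat} (h : hierarchy T M).
Local Notation V := (hV h). Local Notation E := (hE h). Local Notation B := (hB h).
Local Notation t := (ht h). Local Notation O := (hO h).
Implicit Types (m r n k : nat) (x y z u v : T) (p q : seq T).

Lemma adj_tE m i x y : adj (E m) x y -> adj (E m.+1) (t m i x) (t m i y).
Proof. by move=> a; rewrite /adj -tE2; apply: tE_E. Qed.

Definition reach m D := forall x u, x \in B m -> u \in V m ->
  exists p, [/\ path (adj (E m)) x p, last x p = u & size p <= D].

(** The target cell is reached through a chain of at most [M] different cells touching at boundary
    vertices; each but the last costs [L], the last one [D]. *)
Lemma reachS m L D : (forall x y, x \in B m -> y \in B m ->
    exists p, [/\ path (adj (E m)) x p, last x p = y & size p <= L]) ->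
  reach m D -> reach m.+1 (D + M * L).
Proof.
move=> cL rD x u xB uV.
have [r [cr rt]] := h_conn h.
have [j [u' [u'V ->]]] := (hV_S h m u).1 uV.
have [i [x' [x'B ->]]] := hB_cell xB.
have chain s : forall i0 x0, x0 \in B m -> path r i0 s -> last i0 s = j ->
    exists p, [/\ path (adj (E m.+1)) (t m i0 x0) p, last (t m i0 x0) p = t m j u' &
      size p <= D + size s * L].
  elim: s => [|i1 s IH] i0 x0 x0B /= => [_ ->|/andP[ri rs] ls].
    have [p [pp lp sp]] := rD x0 u' x0B u'V; exists (map (t m j) p); split.
    - by rewrite path_map; apply: sub_path pp => a b; apply: adj_tE.
    - by rewrite last_map lp.
    - by rewrite size_map mul0n addn0.
  have [a [b [aB bB ab]]] := rt m _ _ ri.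
  have [p [pp lp sp]] := cL _ _ x0B aB.
  have [q [pq lq sq]] := IH _ _ bB rs ls.
  exists (map (t m i0) p ++ q); rewrite cat_path last_cat last_map lp ab; split.
  - rewrite pq andbT path_map; apply: sub_path pp => c d; exact: adj_tE.
  - exact: lq.
  - by rewrite size_cat size_map mulSn; lia.
have /connectP[s0 ps0 ls0] := cr i j.
case/shortenP: ps0 ls0 => s ps us _ ls.
have [p [pp lp sp]] := chain s i x' x'B ps (esym ls).
exists p; split=> //; apply: leq_trans sp _; rewrite leq_add2l leq_mul2r; apply/orP; right.
have := uniq_leq_size us (_ : {subset i :: s <= enum 'I_M}).
by rewrite size_enum_ord /= => /(_ (fun (z : 'I_M) _ => mem_enum _ z)) /ltnW.
Qed.

Lemma reach0 : reach 0 #|` V 0|.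
Proof.
move=> x u xB uV; have [p pp lp] := h_conn0 (hB_V xB) uV.
case/shortenP: pp lp => p' pp' up' _ lp; exists p'; split=> //.
apply: uniq_leq_size; first by case/andP: up'.
move=> z zp; have := path_support pp' zp => /in_support[e eE ze].
exact: hE_V eE ze.
Qed.

Lemma reach_exists m : exists D, reach m D.
Proof.
elim: m => [|m [D rD]]; first by exists #|` V 0|; exact: reach0.
exists (D + M * D); apply: (@reachS m D D) => // x y xB yB; exact: rD xB (hB_V yB).
Qed.

Lemma crossing_exists m : exists k, `[< exists x y p, [/\ x \in B m, y \in B m & x != y] /\
  [/\ path (adj (E m)) x p, last x p = y & size p = k] >].
Proof.
have [x xB xO] := hB_two h m; have [D rD] := reach_exists m.
have [p [pp lp sp]] := rD x O xB (hB_V (hO_B h m)).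
by exists (size p); apply/asboolP; exists x, O, p; split; split=> //; exact: hO_B.
Qed.

Definition rho m := ex_minn (crossing_exists m).

Lemma crossing_rho m : crossing h m (rho m).
Proof.
move=> x y p xB yB xy pp lp; rewrite /rho; case: ex_minnP => k _; apply.
by apply/asboolP; exists x, y, p.
Qed.

Lemma rho_path m : exists x y p, [/\ x \in B m, y \in B m & x != y] /\
  [/\ path (adj (E m)) x p, last x p = y & size p = rho m].
Proof. by rewrite /rho; case: ex_minnP => k /asboolP. Qed.

Lemma crossing_leq_rho m n : crossing h m n -> n <= rho m.
Proof.
move=> cr; have [x [y [p [[xB yB xy] [pp lp <-]]]]] := rho_path m.
exact: cr xB yB xy pp lp.
Qed.

Lemma rhoS m : 2 * rho m <= rho m.+1.
Proof. by apply: crossing_leq_rho; apply: crossingS; exact: crossing_rho. Qed.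

Lemma rho_exp m s : 2 ^ s * rho m <= rho (s + m).
Proof.
elim: s => [|s IH]; first by rewrite mul1n.
by rewrite expnS -mulnA; apply: leq_trans (rhoS _); rewrite leq_mul2l.
Qed.

Lemma rho_ge m : 2 ^ m <= rho m.
Proof. by apply: crossing_leq_rho; exact: crossing_exp. Qed.

Lemma rho_gt0 m : 0 < rho m.
Proof. exact: leq_trans (expn_gt0 2 m) (rho_ge m). Qed.

(** With [A'] the constant chosen, [reachS] gives [(A' + M * A) * rho m <= 2 * A' * rho m], and
    [rho] at least doubles from level to level. *)
Lemma reach_rho : exists A, forall m, reach m (A * rho m).
Proof.
have [A hA] := h_fold h.
have conn m x y : x \in B m -> y \in B m ->
    exists p, [/\ path (adj (E m)) x p, last x p = y & size p <= A * rho m].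
  move=> xB yB; have [a [b [p [[aB bB ab] [pp lp <-]]]]] := rho_path m.
  exact: hA aB bB ab pp lp xB yB.
exists (#|` V 0| + M * A) => m; elim: m => [|m IH].
  move=> x u xB uV; have [p [pp lp sp]] := reach0 xB uV; exists p; split=> //.
  by apply: leq_trans sp _; have := rho_gt0 0; nia.
move=> x u xB uV; have [p [pp lp sp]] := reachS (conn m) IH xB uV; exists p; split=> //.
apply: leq_trans sp _; apply: leq_trans (leq_mul (leqnn _) (rhoS m)).
rewrite mulnA (mulnCA _ 2) !mulnDl; lia.
Qed.

(** Take the least [m] with [n <= rho m] and [l = m - s.+1]: level [m] cannot be crossed in fewer
    than [n] steps, while [2 ^ s * rho l <= rho m.-1 < n] makes the cells of level [l] small. The
    choice of [n0] ensures [s < m]. *)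
Lemma scale_exists : exists A, forall s, exists n0, forall n, n0 <= n -> exists l D,
  [/\ crossing h (s.+1 + l) n, reach l D, 2 ^ s * D <= A * n & 2 ^ l <= n].
Proof.
have [A hA] := reach_rho; exists A => s; exists (rho s).+1 => n sn.
have exm : exists m, n <= rho m.
  by exists n; apply: leq_trans (rho_ge n); exact: ltnW (ltn_expl _ _).
case: (ex_minnP exm) => m nm mmin.
have rho_mono a b : a <= b -> rho a <= rho b.
  move=> /subnK <-; apply: leq_trans (rho_exp _ _).
  by rewrite leq_pmull ?expn_gt0.
have sm : s < m.
  rewrite ltnNge; apply/negP => /rho_mono; have := leq_trans sn nm; lia.
pose l := m - s.+1; have me : m = s.+1 + l by rewrite /l; lia.
exists l, (A * rho l).
have rl : 2 ^ s * rho l < n.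
  have := mmin (s + l); rewrite [m]me; have := rho_exp l s; lia.
split=> //.
- by rewrite -me; refine (crossing_le nm (@crossing_rho m)).
- by rewrite mulnCA leq_mul2l ltnW ?orbT.
- have := rho_ge l; have : 0 < 2 ^ s by rewrite expn_gt0.
  nia.
Qed.

Lemma card_V m : #|` V m| <= M ^ m * #|` V 0|.
Proof.
have -> : M ^ m * #|` V 0| = size [seq cmap h 0 w x | w <- enum (@word M m), x <- V 0].
  by rewrite size_allpairs -cardE card_word.
apply: uniq_leq_size; first exact: fset_uniq.
move=> z; rewrite -{1}(addn0 m) => /V_cell[w [x [xV ->]]].
by apply/allpairsP; exists (w, x); rewrite mem_enum.
Qed.

Lemma card_E m : #|` E m| = M ^ m * #|` E 0|.
Proof.
elim: m => [|m IH]; first by rewrite mul1n.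
rewrite (card_restr (fsubset_refl (E m.+1))) expnS -mulnA -IH.
have -> : \sum_i #|` restr h m (E m.+1) i| = \sum_(i < M) #|` E m|.
  apply: eq_bigr => i _; congr (#|` _|); apply/fsetP => e; rewrite in_restr.
  by case: (boolP (e \in E m)) => //= /tE_E ->.
by rewrite sum_nat_const card_ord.
Qed.

End Scales.

(** * Boundary forests and the paths they consist of *)

Section Components.
Context {R : realType} {T : choiceType} {M : nat} (h : hierarchy T M).
Local Notation V := (hV h). Local Notation E := (hE h). Local Notation B := (hB h).
Local Notation O := (hO h).
Local Open Scope ring_scope.
Implicit Types (G : {fset {fset T}}) (m n k : nat) (x : R) (z v : T).

Definition bpaths m : {fset {fset {fset T}}} :=
  [fset G in fpowerset (E m) | `[< exists v p, [/\ G = path_edges v p, uniq (v :: p),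
     v \in B m, last v p \in B m & p != [::]] >]]%fset.

Lemma in_bpaths m G : G \in bpaths m -> exists v p, [/\ path (adj (E m)) v p,
  G = path_edges v p, uniq (v :: p), v \in B m & last v p \in B m /\ p != [::]].
Proof.
rewrite !inE fpowersetE => /andP[GE /asboolP[v [p [e u vB lB pn]]]].
by exists v, p; split=> //; rewrite -path_edges_sub -e.
Qed.

Definition leaves m G := [fset z in B m | degree G z == 1%N]%fset.

Definition bforests_le k m : {fset {fset {fset T}}} :=
  [fset G in forests_le h 0 m | (#|` leaves m G| <= k)%N]%fset.

Lemma in_bforests_le k m G :
  (G \in bforests_le k m) = (G \in forests_le h 0 m) && (#|` leaves m G| <= k)%N.
Proof. by rewrite /bforests_le !inE. Qed.

Lemma fset0_bforests k m : fset0 \in bforests_le k m.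
Proof.
rewrite in_bforests_le fset0_forests /=; apply: leq_trans (leq0n _).
rewrite leqn0 cardfs_eq0; apply/eqP/fsetP => z.
rewrite !inE degreeE (_ : edges_at fset0 z = fset0) ?cardfs0 ?andbF //.
by apply/fsetP => e; rewrite !inE.
Qed.

Lemma leaves_diff m G v p : linear_forest G -> simple G -> component_path G (v :: p) ->
  leaves m (G `\` path_edges v p)%fset = [fset z in leaves m G | z \notin v :: p]%fset.
Proof.
move=> lG sG cp; apply/fsetP => z; rewrite !inE /= (degree_diff_component z lG sG cp) inE.
by case: (_ || _); rewrite /= ?andbF ?andbT.
Qed.

Lemma forests0_leaf m G z : G \in forests_le h 0 m -> degree G z = 1%N -> z \in B m.
Proof.
move=> /in_forests_le[GE _]; rewrite leqn0 cardfs_eq0 => /eqP d0 dz.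
apply/negPn/negP => zB; have : z \in defects h m G; last by rewrite d0.
rewrite !inE zB dz eqxx !andbT.
have /fset0Pn[e] : edges_at G z != fset0 by rewrite -cardfs_gt0 -degreeE dz.
by rewrite in_edges_at => /andP[/(fsubsetP GE) /(@hE_V _ _ h) H' /H'].
Qed.

Lemma forests0_sub m G v p : G \in forests_le h 0 m -> component_path G (v :: p) ->
  (G `\` path_edges v p)%fset \in forests_le h 0 m.
Proof.
move=> GF cp; have /in_forests_le[GE lG _] := GF.
have sG : simple G by apply: simple_sub GE _; exact: hE_simple.
apply/in_forests_le; split.
- exact: fsubset_trans (fsubsetDl _ _) GE.
- exact: linear_forest_sub (fsubsetDl _ _) lG.
rewrite leqn0 cardfs_eq0; apply/eqP/fsetP => z; rewrite !inE.
apply/negP => /and3P[_ zB]; rewrite (degree_diff_component z lG sG cp).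
case: ifP => // _ /eqP dz.
by rewrite (forests0_leaf GF dz) in zB.
Qed.

Lemma component_choice G : simple G -> linear_forest G -> G != fset0 ->
  exists s, component_path G s.
Proof.
move=> sG lG n0; have [x [p [cp _ _ _]]] := component_two_leaves sG lG n0.
by exists (x :: p).
Qed.

Lemma wsum_bforests0 m x : wsum (bforests_le 0 m) x = 1.
Proof.
suff -> : bforests_le 0 m = [fset fset0]%fset by rewrite /wsum big_seq_fset1 cardfs0 expr0.
apply/fsetP => G; rewrite [in RHS]inE; apply/idP/eqP => [|->]; last exact: fset0_bforests.
rewrite in_bforests_le leqn0 cardfs_eq0 => /andP[GF /eqP l0].
have /in_forests_le[GE lG _] := GF.
have sG : simple G by apply: simple_sub GE _; exact: hE_simple.
apply/eqP/negPn/negP => n0; have [v [p [_ dv _ _]]] := component_two_leaves sG lG n0.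
have : v \in leaves m G by rewrite !inE dv eqxx andbT (forests0_leaf GF dv).
by rewrite l0.
Qed.

(** Peeling off one component splits a nonempty forest into a boundary path and a forest with fewer
    leaves; the pair determines the forest. *)
Lemma wsum_bforestsS k m x : 0 <= x ->
  wsum (bforests_le k.+1 m) x <= 1 + wsum (bpaths m) x * wsum (bforests_le k m) x.
Proof.
move=> x0.
have f0 : fset0 \in bforests_le k.+1 m.
  exact: fset0_bforests.
rewrite {1}/wsum (big_fsetD1 fset0 f0) cardfs0 expr0 lerD2l.
pose comp G := xget [::] [set s | component_path G s].
pose pe G := if comp G is v :: p then path_edges v p else fset0.
have compP G : G \in (bforests_le k.+1 m `\ fset0)%fset ->
    exists v p, [/\ G \in forests_le h 0 m, linear_forest G, simple G &
      component_path G (v :: p) /\ pe G = path_edges v p].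
  rewrite in_fsetD1 in_bforests_le => /andP[n0 /andP[GF _]].
  have /in_forests_le[GE lG _] := GF.
  have sG : simple G by apply: simple_sub GE _; exact: hE_simple.
  rewrite /pe /comp; case: xgetP => [s _ /= cs|none]; last first.
    by have [s /none] := component_choice sG lG n0.
  by case: s cs => [[]//|v p cp]; exists v, p.
pose S := [seq (P, Q) | P <- bpaths m, Q <- bforests_le k m].
apply: (le_trans (y := \sum_(t <- S) x ^+ #|` t.1| * x ^+ #|` t.2|)); last first.
  rewrite /S big_allpairs_dep /wsum mulr_suml ler_sum // => P _.
  by rewrite mulr_sumr ler_sum.
have -> : \sum_(G <- (bforests_le k.+1 m `\ fset0)%fset) x ^+ #|` G| =
    \sum_(G <- (bforests_le k.+1 m `\ fset0)%fset)
      x ^+ #|` pe G| * x ^+ #|` (G `\` pe G)%fset|.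
  apply: eq_big_seq => G /compP[v [p [_ _ _ [[_ _ pp _] peE]]]].
  rewrite -exprD; congr (_ ^+ _).
  have sub : (pe G `<=` G)%fset by rewrite peE path_edges_sub.
  by rewrite cardfsDS // subnKC // fsubset_leq_card.
apply: (@ler_sum_inj _ _ _ _ S (fun G => (pe G, (G `\` pe G)%fset))
   (fun t => x ^+ #|` t.1| * x ^+ #|` t.2|)).
- exact: fset_uniq.
- move=> G G' /compP[v [p [_ _ _ [[_ _ pp _] peE]]]] /compP[v' [p' [_ _ _ [[_ _ pp' _] peE']]]].
  move=> /= [e1 e2].
  have sub : (pe G `<=` G)%fset by rewrite peE path_edges_sub.
  have sub' : (pe G' `<=` G')%fset by rewrite peE' path_edges_sub.
  rewrite -(fsetID (pe G) G) -(fsetID (pe G') G') e2; congr (_ `|` _)%fset.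
  by rewrite (fsetIidPr sub) (fsetIidPr sub').
- move=> G GF; have [v [p [GF0 lG sG [cp peE]]]] := compP G GF.
  apply/allpairsP; exists (pe G, (G `\` pe G)%fset); split=> //=.
    have /in_forests_le[GE _ _] := GF0.
    have [s2 us ss _] := cp.
    rewrite peE !inE fpowersetE; apply/andP; split.
      by apply: fsubset_trans GE; rewrite path_edges_sub.
    apply/asboolP; exists v, p; split=> //.
    - by apply: (forests0_leaf GF0); apply: component_leaf cp.
    - by apply: (forests0_leaf GF0); apply: component_leaf_last cp.
    - by case: p s2 {us ss cp peE}.
  rewrite peE in_bforests_le forests0_sub //=.
  move: GF; rewrite in_fsetD1 in_bforests_le => /andP[_ /andP[_ lk]].
  rewrite -ltnS; apply: leq_trans lk.
  rewrite (leaves_diff _ lG sG cp); apply: fproper_ltn_card.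
  rewrite fproperE; apply/andP; split.
    by apply/fsubsetP => z; rewrite inE => /andP[].
  apply/fsubsetPn; exists v; first by rewrite !inE (forests0_leaf GF0) (component_leaf sG lG cp).
  by rewrite !inE eqxx !andbF.
- by move=> t; rewrite mulr_ge0 // exprn_ge0.
Qed.

(** A boundary forest has at most as many leaves as there are boundary vertices, so the peeling ends
    after that many rounds. *)
Lemma w_bpaths m x : 0 <= x -> w h 0 m x <= (1 + wsum (bpaths m) x) ^+ #|` B 0|.
Proof.
move=> x0; rewrite -(hB_card h m).
have -> : w h 0 m x = wsum (bforests_le #|` B m| m) x.
  rewrite /w; congr wsum; apply/fsetP => G; rewrite in_bforests_le andb_idr // => _.
  by apply: fsubset_leq_card; apply/fsubsetP => z; rewrite inE => /andP[].
have P0 : 0 <= wsum (bpaths m) x by exact: wsum_ge0.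
elim: #|` B m| => [|k IH]; first by rewrite wsum_bforests0.
apply: le_trans (wsum_bforestsS _ _ x0) _.
have h1 : 1 <= (1 + wsum (bpaths m) x) ^+ k by rewrite exprn_ege1 // lerDl.
by rewrite exprS mulrDl mul1r lerD // ler_wpM2l.
Qed.

(** A boundary path is a self-avoiding walk from a boundary vertex whose length is at least the
    crossing bound [2 ^ m] and at most the number of edges; [nsaw_H] bounds the number of such
    walks. *)
Lemma wsum_bpaths m x c : 0 <= x -> 0 <= c ->
  (forall n, (2 ^ m <= n)%N -> (n <= #|` E m|)%N -> (H h n)%:R * x ^+ n <= c) ->
  wsum (bpaths m) x <= (#|` B 0| * #|` E m|.+1)%:R * c.
Proof.
move=> x0 c0 hc.
pose I := [seq n <- iota 0 #|` E m|.+1 | (2 ^ m <= n)%N].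
pose P z := [seq p | n <- I, p <- fset_set (saws (E m) z n)].
pose S := [seq (z, p) | z <- B m, p <- P z].
have hP G : exists vp : T * seq T, G \in bpaths m ->
    [/\ path (adj (E m)) vp.1 vp.2, G = path_edges vp.1 vp.2, uniq (vp.1 :: vp.2), vp.1 \in B m &
      last vp.1 vp.2 \in B m /\ vp.2 != [::]].
  have [/in_bpaths[v [p Hvp]]|nG] := boolP (G \in bpaths m); first by exists (v, p).
  by exists (hO h, [::]).
have [f hf] := choice hP.
have -> : wsum (bpaths m) x = \sum_(G <- bpaths m) x ^+ size (f G).2.
  apply: eq_big_seq => G /hf[_ e u _ _]; congr (_ ^+ _).
  by rewrite {1}e card_path_edges.
apply: (le_trans (y := \sum_(t <- S) x ^+ size t.2)).
  apply: (@ler_sum_inj _ _ _ _ S f (fun t : T * seq T => x ^+ size t.2)).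
  - exact: fset_uniq.
  - by move=> G G' /hf[_ e _ _ _] /hf[_ e' _ _ _] E'; rewrite e e' E'.
  - move=> G GP; have [pp e u vB [lB pn]] := hf G GP.
    apply/allpairsPdep; exists (f G).1, (f G).2; split=> //; last by case: (f G).
    apply/allpairsPdep; exists (size (f G).2), (f G).2; split=> //.
      rewrite mem_filter mem_iota add0n ltnS /=; apply/andP; split.
        apply: (@crossing_exp _ _ h m (f G).1 (last (f G).1 (f G).2)) => //.
        case: (f G).2 u pn {lB pp e} => [//|y q] /andP[+ _] _.
        by apply: contraNneq => E2; rewrite E2; exact: (mem_last y q).
      rewrite -(card_path_edges u); apply: fsubset_leq_card.
      by rewrite path_edges_sub.
    by rewrite in_fset_set; [exact/mem_set|exact: finite_saws].
  - by move=> t; rewrite exprn_ge0.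
rewrite big_allpairs_dep /= natrM -mulrA -(hB_card h m).
have -> : #|` B m|%:R * (#|` E m|.+1%:R * c) = \sum_(z <- B m) (#|` E m|.+1%:R * c).
  by rewrite big_const_seq count_predT iter_addr_0 mulr_natl.
rewrite !big_seq; apply: ler_sum => z zB.
rewrite /P big_allpairs_dep /=.
apply: (le_trans (y := \sum_(n <- I) c)); last first.
  rewrite big_const_seq count_predT iter_addr_0 -[leLHS]mulr_natl ler_wpM2r // ler_nat.
  by rewrite size_filter (leq_trans (count_size _ _)) // size_iota.
rewrite !big_seq; apply: ler_sum => n; rewrite mem_filter mem_iota add0n ltnS => /and3P[mn _ nE].
apply: le_trans (hc n mn nE).
have -> : \sum_(p <- fset_set (saws (E m) z n)) x ^+ size p =
    \sum_(p <- fset_set (saws (E m) z n)) x ^+ n.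
  apply: eq_big_seq => p; rewrite in_fset_set; last exact: finite_saws.
  by move=> /set_mem[->].
rewrite big_const_seq count_predT iter_addr_0 -[leLHS]mulr_natl ler_wpM2r ?exprn_ge0 // ler_nat.
exact: nsaw_H.
Qed.

(* A self-avoiding walk, as an edge set, has at most two end points off the boundary. *)
Lemma nsaw_w m v n x : 0 <= x -> (nsaw (E m) v n)%:R * x ^+ n <= w h 2 m x.
Proof.
move=> x0.
have -> : (nsaw (E m) v n)%:R * x ^+ n =
    \sum_(p <- fset_set (saws (E m) v n)) x ^+ #|` path_edges v p|.
  rewrite (eq_big_seq (fun=> x ^+ n)); first by rewrite big_const_seq count_predT iter_addr_0 mulr_natl.
  move=> p; rewrite in_fset_set; last exact: finite_saws.
  by move=> /set_mem[<- _ u]; rewrite card_path_edges.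
apply: (@ler_sum_inj _ _ _ _ _ (path_edges v) (fun G : {fset {fset T}} => x ^+ #|` G|)).
- exact: fset_uniq.
- move=> p q; rewrite !in_fset_set; [|exact: finite_saws..].
  by move=> /set_mem[_ _ u] /set_mem[_ _ u']; exact: path_edges_inj.
- move=> p; rewrite in_fset_set; last exact: finite_saws.
  move=> /set_mem[_ pp u]; apply/in_forests_le; split.
  - by rewrite path_edges_sub.
  - exact: path_edges_linear_forest.
  apply: leq_trans (_ : #|` [fset v; last v p]%fset| <= 2)%N; last by rewrite cardfs2; case: (_ == _).
  apply: fsubset_leq_card; apply/fsubsetP => z; rewrite !inE => /and3P[_ _ /eqP/(path_edges_leaf u)].
  by case=> ->; rewrite eqxx ?orbT.
- by move=> t; rewrite exprn_ge0.
Qed.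

End Components.

(** * Exponential growth *)

Section Growth.
Context {R : realType} {T : choiceType} {M : nat} (h : hierarchy T M).
Local Notation V := (hV h). Local Notation E := (hE h). Local Notation B := (hB h).
Local Notation O := (hO h).
Local Open Scope ring_scope.
Implicit Types (G : {fset {fset T}}) (m n k : nat) (x beta gam : R).

Lemma poly_le_expR (A : R) (p : nat) (delta : R) : 0 < delta ->
  exists n0, forall n, (n0 <= n)%N -> A * n%:R ^+ p <= expR (delta * n%:R).
Proof.
(* Coefficient of [n^(p + 1)] in the exponential series of [delta n]; this single term dominates. *)
move=> d0; pose c := delta ^+ p.+1 / (p.+1)`!%:R.
have c0 : 0 < c by rewrite divr_gt0 ?exprn_gt0 // ltr0n fact_gt0.
exists (Num.truncn (`|A| / c)).+1 => n hn.
have nA : `|A| <= c * n%:R.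
  rewrite mulrC -ler_pdivrMr //; apply: le_trans (ltW (truncnS_gt _)) _.
  by rewrite ler_nat.
apply: (le_trans (y := `|A| * n%:R ^+ p)); first by rewrite ler_wpM2r ?exprn_ge0 // ler_norm.
have x0 : 0 <= delta * n%:R by rewrite mulr_ge0 // ltW.
apply: le_trans (expR_ge1Dxn p x0); apply: ler_wpDl => //.
rewrite exprMn mulrAC -/c [n%:R ^+ p.+1]exprS mulrA ler_wpM2r ?exprn_ge0 //.
Qed.

Lemma nat_le_exp2 (r : R) : exists k : nat, r <= 2 ^+ k.
Proof.
exists (Num.truncn r).+1; apply: le_trans (ltW (truncnS_gt _)) _.
by rewrite -natrX ler_nat ltnW // ltn_expl.
Qed.

Lemma exp2_scale n : (0 < n)%N -> exists j, (n <= 2 ^ j)%N /\ (2 ^ j <= 2 * n)%N.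
Proof.
move=> n0; have [n1|n1] := leqP n 1.
  by exists 0%N; have -> : n = 1%N by apply/eqP; rewrite eqn_leq n1.
exists (up_log 2 n); have /= /andP[h1 h2] := @up_log_bounds 2 n isT n1; split=> //.
case: (up_log 2 n) h1 {h2} => [|j] /= h1; first by rewrite expn0; lia.
by rewrite expnS leq_mul2l ltnW.
Qed.

Definition zbounded beta := exists Q, forall m, q h m (expR (- beta)) <= Q.

Lemma q_small x m : 0 <= x -> q h m x <= 2 ^- M -> forall k, q h (k + m) x <= 2 ^- M.
Proof.
move=> x0 qm; elim=> [//|k IH].
have q0 := q_ge0 h (k + m) x0.
have p0 : 0 < 2 ^+ M :> R by rewrite exprn_gt0.
have p1 : 2 ^- M <= 1 :> R by rewrite invf_le1 // exprn_ege1 // ler1n.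
apply: le_trans (q_S x0 (le_trans IH p1)) _.
rewrite expr2 mulrA; apply: (le_trans _ IH); rewrite ler_piMl // -ler_pdivlMl //.
by rewrite mulr1.
Qed.

Lemma small_zbounded beta m : q h m (expR (- beta)) <= 2 ^- M -> zbounded beta.
Proof.
set x := expR _ => qm; have x0 : 0 <= x by exact: expR_ge0.
exists (2 ^- M + \sum_(k < m) q h k x) => k.
have s0 : 0 <= \sum_(k < m) q h k x by apply: sumr_ge0 => i _; exact: q_ge0.
have [km|mk] := ltnP k m; last by rewrite -(subnK mk) ler_wpDr // q_small.
rewrite ler_wpDl ?invr_ge0 ?exprn_ge0 // (bigD1 (Ordinal km)) //= lerDl.
by apply: sumr_ge0 => i _; exact: q_ge0.
Qed.

Lemma zbounded_exists : exists2 beta, 0 <= beta & zbounded beta.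
Proof.
(* At [x = 1 / a] each of the nonempty forests of level 0, at most two to the number of edges of
   [F_0], weighs at most [1 / a], so [q] is at most [2 ^- M] there. *)
pose a : R := (2 ^+ #|` E 0| * 2 ^+ M); have a1 : 1 <= a.
  by rewrite mulr_ege1 // exprn_ege1 // ler1n.
have a0 : 0 < a by apply: lt_le_trans a1.
exists (ln a); first by rewrite ln_ge0.
apply: (@small_zbounded _ 0); rewrite expRN lnK ?posrE //.
have i0 : 0 <= a^-1 by rewrite invr_ge0 ltW.
have i1 : a^-1 <= 1 by rewrite invf_le1.
apply: (le_trans (y := \sum_(G <- bforests h 0) a^-1)).
  rewrite /q /wsum !big_seq; apply: ler_sum => G /in_bforests[_ _ n0 _].
  by rewrite ler_iXnr // cardfs_gt0.
rewrite big_const_seq count_predT iter_addr_0 -[leLHS]mulr_natl invfM mulrA.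
rewrite ler_piMl ?invr_ge0 ?exprn_ge0 // ler_pdivrMr ?exprn_gt0 // mul1r -natrX ler_nat.
rewrite -card_fpowerset; apply: fsubset_leq_card; apply/fsubsetP => G /in_bforests[GE _ _ _].
by rewrite fpowersetE.
Qed.

Lemma nsaw_poly x Q : 0 < x -> (forall m, q h m x <= Q) ->
  exists (A : R) (p : nat), 1 <= A /\ forall m v n, (0 < n)%N ->
    (nsaw (E m) v n)%:R * x ^+ n <= A * n%:R ^+ p.
Proof.
move=> x_gt0 hQ; have x0 := ltW x_gt0.
pose Q1 := 1 + `|Q|; have Q11 : 1 <= Q1 by rewrite lerDl.
have wQ n : w h 0 n x <= Q1 by rewrite w0E lerD2l; apply: le_trans (hQ n) (ler_norm _).
pose W := 1 + w h 2 0 x; have W1 : 1 <= W by rewrite lerDl w_ge0.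
have wW : w h 2 0 x <= W by rewrite lerDr.
have wB m := @w_bound R T M h 2 m x Q1 W x0 wQ Q11 W1 wW 2 (leqnn _).
set Lam := 3%:R * Q1 in wB.
(* [Lam <= 2 ^+ k] turns the factor [Lam ^+ (M * j)] of level [j] into a power of [2 ^ j], hence of
   [n]. *)
have [k Lk] := nat_le_exp2 Lam.
have Q10 : 0 <= Q1 by apply: le_trans Q11.
have L0 : 0 <= Lam by rewrite mulr_ge0.
have W0 : 0 <= W by apply: le_trans W1.
pose kM := (k * M)%N.
pose c1 := Q1 * W ^+ 2 * 2 ^+ (2 * kM).
have c11 : 1 <= c1.
  by rewrite /c1 !mulr_ege1 // exprn_ege1 // ler1n.
have c10 : 0 <= c1 by apply: le_trans c11.
have wn j n : (2 ^ j <= 2 * n)%N -> w h 2 j x <= c1 * n%:R ^+ (2 * kM).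
  move=> jn; apply: le_trans (wB j) _.
  have -> : Q1 * (Lam ^+ (M * j) * W) ^+ 2 = Q1 * W ^+ 2 * (Lam ^+ (M * j)) ^+ 2.
    by rewrite exprMn mulrA mulrAC.
  rewrite /c1 -[leRHS]mulrA ler_wpM2l ?mulr_ge0 ?exprn_ge0 //.
  rewrite -exprMn [(2 * kM)%N]mulnC [in leRHS]exprM.
  rewrite lerXn2r ?nnegrE ?exprn_ge0 ?mulr_ge0 //.
  apply: (le_trans (y := (2 ^+ k) ^+ (M * j))).
    by rewrite lerXn2r ?nnegrE ?exprn_ge0.
  have -> : (2 ^+ k) ^+ (M * j) = (2 ^+ j) ^+ kM :> R.
    by rewrite -!exprM /kM; congr (_ ^+ _); rewrite mulnA mulnC.
  by rewrite lerXn2r ?nnegrE ?exprn_ge0 ?mulr_ge0 // -natrX -natrM ler_nat.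
(* The two parts of the walk give twice the exponent [2 * kM], and the choice of the cutting step
   gives one more. *)
pose p := (2 * (2 * kM)).+1.
exists (M%:R ^+ 2 * 3%:R * c1 ^+ 2), p.
have M1 : 1 <= M%:R :> R by rewrite ler1n (M_gt0 h).
split; first by rewrite !mulr_ege1 // ?exprn_ege1 // ler1n.
move=> m v n n0; have [j [nj jn]] := exp2_scale n0.
have cr : crossing h j n by refine (crossing_le nj (@crossing_exp _ _ h j)).
clearbody c1; pose Wn := c1 * n%:R ^+ (2 * kM).
have n1 : 1 <= n%:R :> R by rewrite ler1n.
have Wn1 : 1 <= Wn by rewrite mulr_ege1 // exprn_ege1.
have Wn0 : 0 <= Wn by apply: le_trans Wn1.
pose X a := \max_(y <- V j) nsaw (E j) y a.
have hX y a : y \in V j -> (nsaw (E j) y a <= X a)%N.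
  by move=> yV; rewrite /X (big_fsetD1 y) //= leq_maxl.
have Xx a : (X a)%:R * x ^+ a <= Wn.
  rewrite /X; elim/big_ind: _ => [|a1 a2 h1 h2|y _]; first by rewrite mul0r.
    by rewrite /maxn; case: ifP.
  by apply: le_trans (nsaw_w _ _ _ _ x0) (wn _ _ jn).
have -> : M%:R ^+ 2 * 3%:R * c1 ^+ 2 * n%:R ^+ p = M%:R ^+ 2 * (3%:R * n%:R) * Wn ^+ 2.
  have -> : n%:R ^+ p = n%:R * (n%:R ^+ (2 * kM)) ^+ 2 :> R.
    by rewrite /p exprS -exprM [(2 * kM * 2)%N]mulnC.
  by rewrite /Wn; ring.
have h1 : (nsaw (E m) v n <= nsaw (E (m + j)) v n)%N by apply: nsaw_sub; rewrite addnC; exact: E_sub.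
have h2 := @nsaw_level _ _ h j m v n X cr n0 hX.
apply: (le_trans (y := (M * X n + \sum_(a <- iota 0 n.+1) (M * X a) * (M * X (n - a)))%N%:R * x ^+ n)).
  by rewrite ler_wpM2r ?exprn_ge0 // ler_nat (leq_trans h1).
rewrite natrD mulrDl natr_sum mulr_suml.
apply: (le_trans (y := M%:R ^+ 2 * Wn ^+ 2 + \sum_(a <- iota 0 n.+1) M%:R ^+ 2 * Wn ^+ 2)).
  apply: lerD.
    rewrite natrM -mulrA ler_pM ?mulr_ge0 ?exprn_ge0 //; first by rewrite ler_eXnr.
    by apply: le_trans (Xx n) _; rewrite ler_eXnr.
  rewrite !big_seq; apply: ler_sum => a; rewrite mem_iota add0n ltnS => /= an.
  have -> : (M * X a * (M * X (n - a)))%N%:R * x ^+ n =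
      M%:R ^+ 2 * (((X a)%:R * x ^+ a) * ((X (n - a)%N)%:R * x ^+ (n - a))).
    have -> : x ^+ n = x ^+ a * x ^+ (n - a) by rewrite -exprD subnKC.
    by rewrite !natrM; ring.
  rewrite ler_wpM2l ?exprn_ge0 // [leRHS]expr2 ler_pM ?mulr_ge0 ?exprn_ge0 //.
rewrite big_const_seq count_predT iter_addr_0 size_iota.
have -> : M%:R ^+ 2 * Wn ^+ 2 + M%:R ^+ 2 * Wn ^+ 2 *+ n.+1 = M%:R ^+ 2 * Wn ^+ 2 * n.+2%:R.
  by rewrite [RHS]mulr_natr [RHS]mulrS.
have -> : M%:R ^+ 2 * (3 * n%:R) * Wn ^+ 2 = M%:R ^+ 2 * Wn ^+ 2 * (3 * n%:R) by ring.
rewrite ler_wpM2l ?mulr_ge0 ?exprn_ge0 // -natrM ler_nat.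
by clear -n0; lia.
Qed.

Lemma bforest_exists m : exists G, G \in bforests h m.
Proof.
have [y [z [p [[yB zB yz] [pp lp _]]]]] := rho_path h m.
case/shortenP: pp lp => p' pp' up' _ lp; exists (path_edges y p'); apply/in_bforests; split.
- by rewrite path_edges_sub.
- exact: path_edges_linear_forest.
- rewrite -cardfs_gt0 card_path_edges // lt0n size_eq0.
  by apply: contraNneq yz => p0; rewrite p0 /= in lp; rewrite lp.
- by move=> u /(path_edges_leaf up')[->|->] //; rewrite lp.
Qed.

Lemma q1_ge1 m : 1 <= q h m 1 :> R.
Proof.
rewrite /q /wsum; under eq_bigr do rewrite expr1n.
have [G GF] := bforest_exists m.
by rewrite (big_fsetD1 G) //= lerDl; apply: sumr_ge0.
Qed.

Definition Ebound (a k m : nat) : nat := (a * (2 ^ m) ^ k)%N.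

Lemma E_poly : exists a k, (0 < a)%N /\ forall m, (#|` E m| < Ebound a k m)%N.
Proof.
exists (#|` E 0|).+1, M; split=> // m; rewrite card_E /Ebound.
have : (M ^ m <= (2 ^ m) ^ M)%N.
  rewrite -expnM mulnC expnM; case: m => // m.
  by rewrite leq_exp2r // ltnW // ltn_expl.
have := expn_gt0 (2 ^ m) M; rewrite expn_gt0 /= => h0 h1; nia.
Qed.

(** If the boundary paths had total weight [P] below [2^-(M + b)], with [b] boundary vertices, the
    forests made of them would weigh less than [1 + 2^-M]. So [P] is not small, and some length
    contributes more than half of the average that this guarantees; halving makes the inequality
    strict. *)
Lemma crossing_lower x m : 0 < x -> 2 ^- M <= q h m x ->
  exists n, [/\ (2 ^ m <= n)%N, (n <= #|` E m|)%N &
    2 ^- (M + #|` B 0|).+1 / (#|` B 0| * #|` E m|.+1)%:R < (H h n)%:R * x ^+ n].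
Proof.
move=> x_gt0 qm; have x0 := ltW x_gt0.
set P := wsum (bpaths h m) x; have P0 : 0 <= P by exact: wsum_ge0.
have PB : 1 + 2 ^- M <= (1 + P) ^+ #|` B 0|.
  by apply: le_trans (w_bpaths h m x0); rewrite w0E lerD2l.
have b0 : (0 < #|` B 0|)%N.
  by rewrite cardfs_gt0; apply/fset0Pn; exists O; exact: hO_B.
have Pl : 2 ^- (M + #|` B 0|) <= P.
  rewrite leNgt; apply/negP => PL.
  have P1 : P <= 1.
    by apply: le_trans (ltW PL) _; rewrite invf_le1 ?exprn_gt0 // exprn_ege1 // ler1n.
  (* Convexity: for [P] in [[0, 1]] the power lies below its chord. *)
  have bin k : (1 + P) ^+ k <= 1 + (2 ^+ k - 1) * P.
    elim: k => [|k IH]; first by rewrite !expr0 subrr mul0r addr0.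
    have k1 : 1 <= 2 ^+ k :> R by rewrite exprn_ege1 // ler1n.
    rewrite !exprS; apply: (le_trans (y := (1 + P) * (1 + (2 ^+ k - 1) * P))).
      by rewrite ler_wpM2l // addr_ge0.
    have : 0 <= (2 ^+ k - 1) * (P * (1 - P)) by rewrite !mulr_ge0 // subr_ge0.
    set K := 2 ^+ k in k1 *; lra.
  have := le_trans PB (bin #|` B 0|); rewrite lerD2l => hh.
  have : (2 ^+ #|` B 0| - 1) * P < 2 ^- M.
    have p0 : 0 < 2 ^+ #|` B 0| :> R by rewrite exprn_gt0.
    apply: (le_lt_trans (y := 2 ^+ #|` B 0| * P)); first by rewrite ler_wpM2r // gerBl.
    move: PL; by rewrite exprD invfM ltr_pdivlMr // mulrC.
  by rewrite ltNge hh.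
apply: contrapT => /forallNP none.
set c := _ / _ in none.
have c0 : 0 <= c by rewrite divr_ge0 ?invr_ge0 ?exprn_ge0.
have := @wsum_bpaths R T M h m x c x0 c0; rewrite -/P => hP.
have {}hP : P <= (#|` B 0| * #|` E m|.+1)%:R * c.
  apply: hP => n h1 h2; rewrite leNgt; apply/negP => h3; exact: (none n).
have bE : 0 < (#|` B 0| * #|` E m|.+1)%:R :> R by rewrite ltr0n muln_gt0 b0.
rewrite /c mulrC divfK ?gt_eqF // exprS invfM in hP.
have p0 : 0 < 2 ^- (M + #|` B 0|) :> R by rewrite invr_gt0 exprn_gt0.
by have := le_trans Pl hP; lra.
Qed.

Lemma crossing_critical (b : R) : 0 <= b ->
  (forall beta, 0 <= beta -> beta < b -> ~ zbounded beta) ->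
  exists (c : R) (a k : nat), 0 < c /\ forall m, exists n,
    [/\ (2 ^ m <= n)%N, (n <= Ebound a k m)%N &
        c * expR (b * n%:R) <= (H h n)%:R * (Ebound a k m)%:R].
Proof.
move=> b0 hb; have [a [k [a0 hE']]] := E_poly.
set b1 : R := #|` B 0|%:R.
have b1_gt0 : 0 < b1.
  by rewrite ltr0n cardfs_gt0; apply/fset0Pn; exists O; exact: hO_B.
exists (2 ^- (M + #|` B 0|).+1 / b1 * expR (-1)), a, k.
split; first by rewrite mulr_gt0 ?expR_gt0 // divr_gt0 // invr_gt0 exprn_gt0.
move=> m; set e := #|` E m|.
have p1 : 2 ^- M <= 1 :> R by rewrite invf_le1 ?exprn_gt0 // exprn_ege1 // ler1n.
have e0 : 0 < e.+1%:R :> R by [].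
(* [beta] lies slightly below [b], so that [q] is above the threshold. As [n] is at most the number
   [e] of edges, replacing [b] by [beta] changes the weights by a factor of at most [expR 1]. If [b]
   is too small for this, [beta = 0] serves. *)
have [beta [beta_b qb]] : exists beta, b - e.+1%:R^-1 <= beta /\ 2 ^- M <= q h m (expR (- beta)).
  have [h0|h0] := leP 0 (b - e.+1%:R^-1).
    exists (b - e.+1%:R^-1); split=> //; rewrite leNgt; apply/negP => /ltW/small_zbounded.
    by apply: hb => //; rewrite ltrBlDr ltrDl invr_gt0.
  exists 0; split; first exact: ltW.
  by rewrite oppr0 expR0; apply: le_trans p1 (q1_ge1 m).
have [n [h1 h2 h3]] := crossing_lower (expR_gt0 _) qb.
exists n; split=> //; first by apply: leq_trans h2 (ltnW (hE' m)).
have Eb : e.+1%:R <= (Ebound a k m)%:R :> R by rewrite ler_nat hE'.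
have H0 : 0 <= (H h n)%:R :> R by [].
apply: (le_trans (y := (H h n)%:R * e.+1%:R)); last by rewrite ler_wpM2l.
rewrite -/e natrM -/b1 invfM mulrA ltr_pdivrMr // in h3.
apply: (le_trans (y := (H h n)%:R * expR (- beta) ^+ n * e.+1%:R * expR (- 1) * expR (b * n%:R))).
  by rewrite ler_wpM2r ?expR_ge0 // ler_wpM2r ?expR_ge0 // ltW.
have -> : (H h n)%:R * expR (- beta) ^+ n * e.+1%:R * expR (- 1) * expR (b * n%:R) =
    (H h n)%:R * e.+1%:R * expR (- beta * n%:R + - 1 + b * n%:R).
  by rewrite !expRD (expRM_natr n (- beta)); ring.
rewrite ler_piMr ?mulr_ge0 // expR_le1.
have hbb : b - beta <= e.+1%:R^-1 by rewrite lerBlDr addrC -lerBlDr.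
have n0 : 0 <= n%:R :> R by [].
have : (b - beta) * n%:R <= 1; last by rewrite mulrBl => hn; lra.
apply: le_trans (ler_wpM2r n0 hbb) _.
by rewrite mulrC ler_pdivrMr // mul1r ler_nat leqW.
Qed.

(** Uniform in the level and in the starting vertex, as cutting a walk at arbitrary vertices
    requires. *)
Definition upper gam := exists A : R, 1 <= A /\
  forall m v k, (nsaw (E m) v k)%:R <= A * expR (gam * k%:R).

Lemma pow_le_expR (p : nat) (delta : R) : 0 < delta ->
  exists c : R, 1 <= c /\ forall n, n%:R ^+ p <= c * expR (delta * n%:R).
Proof.
move=> d0; case: p => [|p].
  exists 1; split=> // n; rewrite expr0 mul1r -expR0 ler_expR mulr_ge0 // ltW //.
pose c := (p.+1)`!%:R / delta ^+ p.+1.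
have f0 : 0 < (p.+1)`!%:R :> R by rewrite ltr0n fact_gt0.
have e0 : 0 < delta ^+ p.+1 by rewrite exprn_gt0.
have c0 : 0 <= c by rewrite divr_ge0 // ltW.
exists (1 + c); split=> [|n]; first by rewrite lerDl.
have x0 : 0 <= delta * n%:R by rewrite mulr_ge0 // ltW.
apply: (le_trans (y := c * expR (delta * n%:R))); last by rewrite ler_wpM2r ?expR_ge0 // lerDr.
rewrite /c mulrAC ler_pdivlMr // mulrC -ler_pdivrMl // mulrC -exprMn.
by apply: le_trans (expR_ge1Dxn p x0); apply: ler_wpDl => //; rewrite mulrC [n%:R * _]mulrC.
Qed.

Lemma upper_of_zbounded beta gam : zbounded beta -> beta < gam -> upper gam.
Proof.
move=> [Q hQ] bg; have [A [p [A1 hA]]] := nsaw_poly (expR_gt0 _) hQ.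
have d0 : 0 < gam - beta by rewrite subr_gt0.
have [c [c1 hc]] := pow_le_expR p d0.
have A0 : 0 <= A by apply: le_trans A1.
exists (A * c); split; first by rewrite mulr_ege1.
move=> m v [|k]; first by rewrite mulr0 expR0 mulr1 (le_trans (y := 1)) ?ler1n ?lern1 ?nsaw0 ?mulr_ege1.
have := hA m v k.+1 isT; rewrite -expRM_natr mulNr expRN => hk.
rewrite ler_pdivrMr ?expR_gt0 // in hk; apply: le_trans hk _.
rewrite -!mulrA ler_wpM2l //; apply: le_trans (ler_wpM2r (expR_ge0 _) (hc k.+1)) _.
by rewrite -mulrA -expRD -mulrDl subrK.
Qed.

Lemma nsaw_concat m v n k K1 K2 : (nsaw (E m) v n <= K1)%N ->
  (forall u, nsaw (E m) u k <= K2)%N -> (nsaw (E m) v (n + k) <= K1 * K2)%N.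
Proof.
move=> h1 h2; apply: (@count_split _ (saws (E m) v (n + k)) (saws (E m) v n)
  (fun u => saws (E m) u k) v n K1 K2 (finite_saws _ _ _) h1 (fun u => finite_saws _ _ _) h2 _).2.
move=> p sp; have nk : (n <= n + k)%N by exact: leq_addr.
by split; [exact: take_saw sp nk|have := drop_saw sp nk; rewrite addKn].
Qed.

(** * Growth at the critical parameter *)

Section Critical.
Context (b : R) (b0 : 0 <= b).
Context (hb : forall beta, 0 <= beta -> beta < b -> ~ zbounded beta).

(* Fekete's argument: [sup_v c_n(v)] is submultiplicative. *)
Lemma long_walks : (forall gam, b < gam -> upper gam) ->
  forall N, (0 < N)%N -> exists m v, expR (b * N%:R) <= (nsaw (E m) v N)%:R.
Proof.
move=> hU N N0; apply: contrapT => none.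
have lt m v : (nsaw (E m) v N)%:R < expR (b * N%:R).
  by rewrite ltNge; apply/negP => h1; apply: none; exists m, v.
(* The counts are integers below [expR (b * N%:R)], so the greatest such integer [s0] bounds them
   all and leaves a gap [delta] in the rate, uniform in level and vertex. *)
pose P s := s%:R < expR (b * N%:R).
have exP : exists s, P s by exists 0%N; rewrite /P expR_gt0.
have bP s : P s -> (s <= Num.truncn (expR (b * N%:R)))%N.
  by move=> hs; rewrite truncn_ge_nat ?expR_ge0 // ltW.
case: (ex_maxnP exP bP) => s0 Ps0 smax.
have hs m v : (nsaw (E m) v N <= s0)%N by apply: smax; exact: lt.
have Npos : 0 < N%:R :> R by rewrite ltr0n.
have [delta [d0 sd]] : exists delta, 0 < delta /\ s0%:R <= expR ((b - delta) * N%:R).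
  case: s0 Ps0 {smax hs} => [|s] Ps; first by exists 1; split=> //; exact: expR_ge0.
  exists (b - ln s.+1%:R / N%:R); split.
    rewrite subr_gt0 ltr_pdivrMr // -[ltRHS]expRK ltr_ln ?posrE ?expR_gt0 //.
  by rewrite opprB addrC subrK divfK ?gt_eqF // lnK ?posrE.
have b1 : b < b + 1 by rewrite ltrDl.
have [A [A1 hA]] := hU _ b1.
pose K := Num.truncn (A * expR ((b + 1) * N%:R)).
have hK m v r : (r < N)%N -> (nsaw (E m) v r <= K)%N.
  move=> rN; have A0 : 0 <= A by apply: le_trans A1.
  rewrite truncn_ge_nat ?mulr_ge0 ?expR_ge0 //; apply: le_trans (hA m v r) _.
  by rewrite ler_wpM2l // ler_expR ler_wpM2l ?addr_ge0 // ler_nat ltnW.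
have hq m r : (r < N)%N -> forall k v, (nsaw (E m) v (k * N + r) <= s0 ^ k * K)%N.
  move=> rN; elim=> [|k IH] v; first by rewrite mul0n add0n expn0 mul1n hK.
  by rewrite mulSn -addnA expnS -mulnA; apply: nsaw_concat (hs m v) IH.
(* Submultiplicativity gives the rate [b - delta] at all lengths, whereas the lengths [n] found here
   have rate [b] up to a polynomial factor. *)
have [c [a [k [c0 hc]]]] := crossing_critical b0 hb.
pose D := a%:R * K%:R * expR (`|b - delta| * N%:R) / c.
have d20 : 0 < delta / 2 by rewrite divr_gt0.
have [n0 hn0] := poly_le_expR D k d20.
have [n [mn _ hn]] := hc n0.
have nn0 : (n0 < n)%N by apply: leq_trans mn; exact: ltn_expl.
have n_gt0 : 0 < n%:R :> R by rewrite ltr0n; apply: leq_trans nn0.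
have Hn : (H h n)%:R <= expR ((b - delta) * n%:R) * expR (`|b - delta| * N%:R) * K%:R.
  apply: (le_trans (y := (s0 ^ (n %/ N) * K)%:R)).
    rewrite ler_nat /H {2}(divn_eq n N); apply: hq; exact: ltn_pmod.
  rewrite natrM natrX ler_wpM2r //.
  apply: (le_trans (y := expR ((b - delta) * N%:R) ^+ (n %/ N))).
    by rewrite lerXn2r ?nnegrE ?expR_ge0.
  rewrite -expRM_natr -expRD ler_expR {2}(divn_eq n N) natrD natrM.
  have rN : (n %% N)%:R <= N%:R :> R by rewrite ler_nat ltnW // ltn_pmod.
  have r0 : 0 <= (n %% N)%:R :> R by [].
  have := ler_norm (- (b - delta)); rewrite normrN => hnorm.
  have h1 : - (b - delta) * (n %% N)%:R <= `|b - delta| * (n %% N)%:R by rewrite ler_wpM2r.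
  have h2 : `|b - delta| * (n %% N)%:R <= `|b - delta| * N%:R by rewrite ler_wpM2l.
  have -> : (b - delta) * ((n %/ N)%:R * N%:R + (n %% N)%:R) =
    (b - delta) * N%:R * (n %/ N)%:R + (b - delta) * (n %% N)%:R by ring.
  rewrite mulNr in h1; lra.
have En : (Ebound a k n0)%:R <= a%:R * n%:R ^+ k :> R.
  rewrite /Ebound natrM natrX ler_wpM2l // lerXn2r ?nnegrE // ler_nat //.
have h1 : c * expR (b * n%:R) <= c * (D * n%:R ^+ k) * expR ((b - delta) * n%:R).
  apply: le_trans hn _.
  have -> : c * (D * n%:R ^+ k) * expR ((b - delta) * n%:R) =
    expR ((b - delta) * n%:R) * expR (`|b - delta| * N%:R) * K%:R * (a%:R * n%:R ^+ k).
    by rewrite /D; field; rewrite gt_eqF.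
  by apply: ler_pM.
have h2 : expR (b * n%:R) <= expR ((delta / 2) * n%:R) * expR ((b - delta) * n%:R).
  rewrite -(ler_pM2l c0); apply: le_trans h1 _; rewrite -mulrA; apply: ler_wpM2l; first exact: ltW.
  by rewrite ler_wpM2r ?expR_ge0 // hn0 // ltnW.
move: h2; rewrite -expRD ler_expR -mulrDl ler_pM2r //; lra.
Qed.

(** Cutting the walks of [long_walks] by [nsaw_long] and [nsaw_near] isolates one factor [H n]; the
    other steps, at most [N - n + D], are bounded at rate [b + delta]. The exponent loses [b D],
    [delta (N - n + D)] and a polynomial factor, each at most [eta n / 4]. *)
Lemma lower_limit eta : (forall gam, b < gam -> upper gam) -> 0 < eta ->
  exists n0, forall n, (n0 <= n)%N -> expR ((b - eta) * n%:R) <= (H h n)%:R.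
Proof.
move=> hU eta0.
have [A hA] := scale_exists h.
have e4 : 0 < eta / 4 by rewrite divr_gt0.
(* The summand 1 ensures [D <= n], the summand [4 * b / eta] ensures [b * D <= eta / 4 * n]. *)
have [s hs] := nat_le_exp2 (A%:R * (1 + 4 * b / eta)).
have [n1 hn1] := hA s.
set r1 := s.+1 in hn1.
pose K := (M ^ r1 * #|` B 0|).+1.
(* [Rt] is the ratio [N / n] of [nsaw_long], the same for all [n]; [delta] is chosen after it so
   that [delta * N = eta / 4 * n]. *)
pose Rt := (1 + 2 * K)%N.
pose delta := eta / 4 / Rt%:R.
have Rt0 : 0 < Rt%:R :> R by rewrite ltr0n.
have d0 : 0 < delta by rewrite divr_gt0.
have bd : b < b + delta by rewrite ltrDl.
have [A1 [A11 hA1]] := hU _ bd.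
set gam := b + delta in hA1; have gam0 : 0 <= gam by rewrite addr_ge0 // ltW.
have A10 : 0 <= A1 by apply: le_trans A11.
pose C k := Num.truncn (A1 * expR (gam * k%:R)).
have Cge k : (C k)%:R <= A1 * expR (gam * k%:R).
  by rewrite truncn_le mulr_ge0 ?expR_ge0.
have hC m v k : (nsaw (E m) v k <= C k)%N.
  by rewrite truncn_ge_nat ?mulr_ge0 ?expR_ge0.
have C_mono : {homo C : m n / (m <= n)%N >-> (m <= n)%N}.
  by move=> m n mn; apply: le_truncn; rewrite ler_wpM2l // ler_expR ler_wpM2l // ler_nat.
(* As [2 ^ l <= n], the number of vertices of level [l], which grows at most like [M ^ l], is
   polynomial in [n]. *)
have [k2 hk2] := nat_le_exp2 (M%:R : R).
pose c2 : R := 2 * (Rt%:R + 1) * A1 ^+ 4 * M%:R ^+ 2 * (#|` V 0|%:R + 1) * 2.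
have [n2 hn2] := poly_le_expR c2 (k2 + 2) e4.
exists (maxn n1 n2).+1 => n; rewrite gtn_max => /andP[n1n n2n].
have n_gt0 : (0 < n)%N by apply: leq_ltn_trans n1n.
have nR : 1 <= n%:R :> R by rewrite ler1n.
have nR0 : 0 <= n%:R :> R by [].
have [l [D [cr rD sD ln]]] := hn1 n (ltnW n1n).
have DR : D%:R * (1 + 4 * b / eta) <= n%:R.
  have p0 : 0 < 2 ^+ s :> R by rewrite exprn_gt0.
  rewrite -(ler_pM2l p0) mulrA -natrX -natrM.
  apply: (le_trans (y := (A * n)%:R * (1 + 4 * b / eta))).
    by rewrite ler_wpM2r ?ler_nat // addr_ge0 // divr_ge0 ?mulr_ge0 // ltW.
  by rewrite natrM mulrAC ler_wpM2r // natrX.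
have b4 : 0 <= 4 * b / eta by rewrite divr_ge0 ?mulr_ge0 // ltW.
have Dn : (D <= n)%N.
  rewrite -(ler_nat R); apply: le_trans DR; rewrite mulrDr mulr1 lerDl mulr_ge0 //.
have bD : b * D%:R <= eta / 4 * n%:R.
  have : D%:R * (4 * b / eta) <= n%:R.
    by apply: le_trans DR; rewrite ler_wpM2l // lerDr.
  have -> : D%:R * (4 * b / eta) = b * D%:R / (eta / 4) by field; rewrite gt_eqF.
  by rewrite ler_pdivrMr // [n%:R * _]mulrC.
pose N := (n + 2 * n * K)%N.
have NE : N%:R = Rt%:R * n%:R :> R by rewrite /N /Rt -natrM mulnDl mul1n mulnAC.
have NK : N = (n + 2 * n * (M ^ r1 * #|` B 0|).+1)%N by [].
have N2 : (2 * n <= N)%N.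
  by rewrite /N; apply: leq_trans (leq_addl _ _); rewrite leq_pmulr.
have nN : (n <= N)%N by rewrite /N leq_addr.
have N0 : (0 < N)%N by apply: leq_trans nN.
clearbody N.
have [m [v hmv]] := long_walks hU N0.
pose X := (#|` V l|.+1 * \sum_(i <- iota 0 n.+1) C i * (H h n * C (n - i + D)))%N.
have hX (x : T) : x \in V l -> (nsaw (E l) x (2 * n) <= X)%N.
  move=> xV; apply: (@nsaw_near _ _ h C hC C_mono l D _ n x Dn xV).
  by move=> u uV; exact: rD (hO_B h l) uV.
have long := @nsaw_long _ _ h C hC l r1 m v n N X n_gt0 cr hX NK.
have mono : (nsaw (E m) v N <= nsaw (E (m + (r1 + l))) v N)%N.
  by apply: nsaw_sub; rewrite addnC; exact: E_sub.
have CC a a' e : (a + a' <= e)%N -> (C a * C a')%:R <= A1 ^+ 2 * expR (gam * e%:R).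
  move=> ae; rewrite natrM; apply: le_trans (ler_pM _ _ (Cge a) (Cge a')) _ => //.
  have -> : A1 * expR (gam * a%:R) * (A1 * expR (gam * a'%:R)) =
    A1 ^+ 2 * (expR (gam * a%:R) * expR (gam * a'%:R)) by ring.
  rewrite -expRD -mulrDr -natrD ler_wpM2l ?exprn_ge0 // ler_expR ler_wpM2l // ler_nat //.
set Hn := (H h n)%:R : R; have Hn0 : 0 <= Hn by [].
have XR : X%:R <= (#|` V l|.+1%:R) * (n.+1%:R * (Hn * (A1 ^+ 2 * expR (gam * (n + D)%:R)))).
  rewrite natrM ler_wpM2l // natr_sum.
  apply: (le_trans (y := \sum_(i <- iota 0 n.+1) Hn * (A1 ^+ 2 * expR (gam * (n + D)%:R)))).
    rewrite !big_seq; apply: ler_sum => i; rewrite mem_iota add0n ltnS => /= i_n.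
    have -> : (C i * (H h n * C (n - i + D)))%N = (H h n * (C i * C (n - i + D)))%N.
      by rewrite mulnCA.
    rewrite natrM ler_wpM2l //; apply: CC; by rewrite addnA subnKC.
  by rewrite big_const_seq count_predT iter_addr_0 size_iota mulr_natl.
(* Bound for the steps outside [H n]: in the second case up to [n + D] of them come from
   [nsaw_near]. *)
set e1 := expR (gam * (N - n + D)%:R).
have e10 : 0 <= e1 by exact: expR_ge0.
pose W : R := #|` V l|.+1%:R * n.+1%:R.
have W1 : 1 <= W by rewrite mulr_ege1 // ler1n.
have M1 : 1 <= M%:R :> R by rewrite ler1n (M_gt0 h).
have S1 : (\sum_(a <- iota 0 (N - n).+1) C a * (M * H h n * C (N - a - n)))%N%:R <=
    N.+1%:R * (A1 ^+ 4 * M%:R ^+ 2 * W * Hn * e1).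
  rewrite natr_sum.
  apply: (le_trans (y := \sum_(a <- iota 0 (N - n).+1) (A1 ^+ 4 * M%:R ^+ 2 * W * Hn * e1))).
    rewrite !big_seq; apply: ler_sum => a; rewrite mem_iota add0n ltnS => /= aN.
    have -> : (C a * (M * H h n * C (N - a - n)))%N = (M * H h n * (C a * C (N - a - n)))%N.
      by rewrite mulnCA.
    rewrite natrM natrM; apply: (le_trans (y := M%:R * Hn * (A1 ^+ 2 * e1))).
      rewrite ler_wpM2l ?mulr_ge0 //; apply: CC; clear -aN; lia.
    have -> : A1 ^+ 4 * M%:R ^+ 2 * W * Hn * e1 = (M%:R * Hn * (A1 ^+ 2 * e1)) * (A1 ^+ 2 * M%:R * W).
      by ring.
    apply: ler_peMr; first by rewrite ?mulr_ge0 ?exprn_ge0.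
    apply: mulr_ege1 => //; apply: mulr_ege1 => //; exact: exprn_ege1.
  rewrite big_const_seq count_predT iter_addr_0 size_iota -[leLHS]mulr_natl.
  by rewrite ler_wpM2r ?mulr_ge0 ?exprn_ge0 ?ler_nat // ltnS leq_subr.
have S2 : (\sum_(a <- iota 0 (N - 2 * n).+1) C a * (M * (M * X) * C (N - a - 2 * n)))%N%:R <=
    N.+1%:R * (A1 ^+ 4 * M%:R ^+ 2 * W * Hn * e1).
  rewrite natr_sum.
  apply: (le_trans (y := \sum_(a <- iota 0 (N - 2 * n).+1) (A1 ^+ 4 * M%:R ^+ 2 * W * Hn * e1))).
    rewrite !big_seq; apply: ler_sum => a; rewrite mem_iota add0n ltnS => /= aN.
    have -> : (C a * (M * (M * X) * C (N - a - 2 * n)))%N = (M * M * X * (C a * C (N - a - 2 * n)))%N.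
      by rewrite mulnCA !mulnA.
    rewrite natrM natrM natrM.
    apply: (le_trans (y := M%:R * M%:R * X%:R * (A1 ^+ 2 * expR (gam * (N - 2 * n)%:R)))).
      rewrite ler_wpM2l ?mulr_ge0 //; apply: CC; clear -aN; lia.
    have -> : e1 = expR (gam * (n + D)%:R) * expR (gam * (N - 2 * n)%:R).
      rewrite -expRD -mulrDr -natrD /e1; congr (expR (_ * _%:R)); clear -N2; lia.
    have -> : A1 ^+ 4 * M%:R ^+ 2 * W * Hn * (expR (gam * (n + D)%:R) * expR (gam * (N - 2 * n)%:R)) =
      M%:R * M%:R * ((#|` V l|.+1%:R) * (n.+1%:R * (Hn * (A1 ^+ 2 * expR (gam * (n + D)%:R))))) *
        (A1 ^+ 2 * expR (gam * (N - 2 * n)%:R)).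
      by rewrite /W; ring.
    by rewrite ler_wpM2r ?mulr_ge0 ?exprn_ge0 ?expR_ge0 // ler_wpM2l // mulr_ge0.
  rewrite big_const_seq count_predT iter_addr_0 size_iota -[leLHS]mulr_natl.
  by rewrite ler_wpM2r ?mulr_ge0 ?exprn_ge0 ?ler_nat // ltnS leq_subr.
have tot : expR (b * N%:R) <= 2 * N.+1%:R * (A1 ^+ 4 * M%:R ^+ 2 * W) * (Hn * e1).
  apply: le_trans hmv _.
  have := leq_trans mono long; rewrite -(ler_nat R) natrD => /le_trans; apply.
  apply: le_trans (lerD S1 S2) _; rewrite le_eqVlt; apply/orP; left; apply/eqP; ring.
have Wn : 2 * N.+1%:R * (A1 ^+ 4 * M%:R ^+ 2 * W) <= c2 * n%:R ^+ (k2 + 2).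
  have h1 : N.+1%:R <= (Rt%:R + 1) * n%:R :> R by rewrite -natr1 NE; lra.
  have h2 : n.+1%:R <= 2 * n%:R :> R by rewrite -natr1; lra.
  have h3 : #|` V l|.+1%:R <= (#|` V 0|%:R + 1) * n%:R ^+ k2 :> R.
    have nk : 1 <= n%:R ^+ k2 :> R by rewrite exprn_ege1.
    rewrite -natr1 mulrDl mul1r lerD //.
    apply: (le_trans (y := (M ^ l * #|` V 0|)%:R)); first by rewrite ler_nat card_V.
    rewrite natrM mulrC ler_wpM2l // natrX.
    apply: (le_trans (y := (2 ^+ k2) ^+ l)); first by rewrite lerXn2r ?nnegrE ?exprn_ge0.
    by rewrite exprAC lerXn2r ?nnegrE ?exprn_ge0 // -natrX ler_nat.
  have -> : c2 * n%:R ^+ (k2 + 2) = 2 * ((Rt%:R + 1) * n%:R) * (A1 ^+ 4 * M%:R ^+ 2 *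
      (((#|` V 0|%:R + 1) * n%:R ^+ k2) * (2 * n%:R))).
    by rewrite /c2 exprD; ring.
  rewrite ler_pM ?mulr_ge0 ?exprn_ge0 //; first by rewrite ler_wpM2l.
  by rewrite ler_wpM2l ?mulr_ge0 ?exprn_ge0 // /W ler_pM.
have fin : expR (b * N%:R) <= expR (eta / 4 * n%:R) * (Hn * e1).
  apply: le_trans tot _; rewrite ler_wpM2r ?mulr_ge0 //.
  by apply: le_trans Wn _; apply: hn2; exact: ltnW.
have e1E : e1 = expR (gam * (N%:R - n%:R + D%:R)).
  by rewrite /e1 natrD natrB.
rewrite e1E mulrCA -expRD -ler_pdivrMr ?expR_gt0 // -expRN -expRD in fin.
apply: le_trans fin; rewrite ler_expR.
have DnR : D%:R <= n%:R :> R by rewrite ler_nat.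
have h1 : delta * (N%:R - n%:R + D%:R) <= eta / 4 * n%:R.
  apply: (le_trans (y := delta * N%:R)); first by rewrite ler_wpM2l ?(ltW d0) //; lra.
  by rewrite NE mulrA /delta divfK ?gt_eqF.
have h2 : 0 <= eta * n%:R by rewrite mulr_ge0 // ltW.
rewrite /gam mulrDl; lra.
Qed.

Lemma critical_bounds : zbounded b -> exists (A : R) (p : nat), 1 <= A /\
  forall n, (0 < n)%N -> (H h n)%:R <= A * expR (b * n%:R) * n%:R ^+ p /\
    expR (b * n%:R) <= A * (H h n)%:R * n%:R ^+ p.
Proof.
move=> [Q hQ]; have [A [p [A1 hA]]] := nsaw_poly (expR_gt0 _) hQ.
have A0 : 0 <= A by apply: le_trans A1.
have up m v n : (0 < n)%N -> (nsaw (E m) v n)%:R <= A * n%:R ^+ p * expR (b * n%:R).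
  by move=> n0; have := hA m v n n0; rewrite -expRM_natr mulNr expRN ler_pdivrMr ?expR_gt0.
have [c [a [k [c0 hc]]]] := crossing_critical b0 hb.
(* [a2] converts [Ebound] at the scale [2 ^ m <= 2 * n] into a power of [n]. The exponent [p.+1] in
   [A2] consists of [p] from the number of continuations and one from [crossing_critical]. *)
pose a2 : R := a%:R * 2 ^+ k.
have a20 : 0 <= a2 by rewrite mulr_ge0 ?exprn_ge0.
pose A2 := A / c * a2 ^+ p.+1.
have A20 : 0 <= A2 by rewrite mulr_ge0 ?exprn_ge0 // divr_ge0 // ltW.
exists (A + A2), (p + k * p.+1)%N; split; first by rewrite ler_wpDr.
move=> n n0; have nR : 1 <= n%:R :> R by rewrite ler1n.
have nR0 : 0 <= n%:R :> R by [].
split.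
  apply: le_trans (up n O n n0) _; rewrite [leRHS]mulrAC; apply: ler_wpM2r; first exact: expR_ge0.
  by rewrite ler_pM ?exprn_ge0 // ?lerDl // ler_weXn2l // leq_addr.
have [m [nm mn]] := exp2_scale n0.
have [n' [mn' n'E hn']] := hc m.
have nn' : (n <= n')%N by apply: leq_trans mn'.
set Eb := Ebound a k m in n'E hn'.
have Eb1 : 1 <= Eb%:R :> R by rewrite ler1n (leq_trans _ n'E) // (leq_trans n0).
have Eb2 : Eb%:R <= a2 * n%:R ^+ k.
  rewrite /Eb /Ebound natrM /a2 -mulrA ler_wpM2l // natrX -exprMn.
  by rewrite lerXn2r ?nnegrE ?mulr_ge0 // -natrM ler_nat.
pose K := Num.truncn (A * Eb%:R ^+ p * expR (b * (n' - n)%:R)).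
have KR : K%:R <= A * Eb%:R ^+ p * expR (b * (n' - n)%:R).
  by rewrite truncn_le !mulr_ge0 ?exprn_ge0 ?expR_ge0.
have hK u : (nsaw (E n') u (n' - n) <= K)%N.
  rewrite truncn_ge_nat ?mulr_ge0 ?exprn_ge0 ?expR_ge0 //.
  have [E0|d0] := posnP (n' - n)%N.
    rewrite E0 mulr0 expR0 mulr1; apply: (le_trans (y := 1)).
      by rewrite lern1 nsaw0.
    by rewrite mulr_ege1 // exprn_ege1.
  apply: le_trans (up n' u _ d0) _; rewrite ler_wpM2r ?expR_ge0 // ler_wpM2l //.
  rewrite lerXn2r ?nnegrE // ler_nat; apply: leq_trans (leq_subr _ _) n'E.
have Hn' : (H h n' <= H h n * K)%N.
  rewrite {1}/H -{2}(subnKC nn'); apply: nsaw_concat hK.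
  exact: nsaw_H (hO_B h n').
have Hn'R : (H h n')%:R <= (H h n)%:R * (A * Eb%:R ^+ p * expR (b * (n' - n)%:R)).
  by rewrite -(ler_nat R) natrM in Hn'; apply: le_trans Hn' _; rewrite ler_wpM2l.
have e1 : expR (b * n'%:R) = expR (b * n%:R) * expR (b * (n' - n)%:R).
  by rewrite -expRD -mulrDr -natrD subnKC.
have h1 : c * expR (b * n%:R) <= (H h n)%:R * A * Eb%:R ^+ p.+1.
  have x0 : 0 < expR (b * (n' - n)%:R) by exact: expR_gt0.
  rewrite -(ler_pM2r x0).
  have -> : c * expR (b * n%:R) * expR (b * (n' - n)%:R) = c * expR (b * n'%:R) by rewrite e1 mulrA.
  apply: le_trans hn' _.
  apply: le_trans (ler_wpM2r _ Hn'R) _ => //.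
  by rewrite exprS le_eqVlt; apply/orP; left; apply/eqP; ring.
have h2 : c * expR (b * n%:R) <= c * (A2 * (H h n)%:R * n%:R ^+ (k * p.+1)).
  apply: le_trans h1 _.
  have -> : c * (A2 * (H h n)%:R * n%:R ^+ (k * p.+1)) =
    (H h n)%:R * A * (a2 * n%:R ^+ k) ^+ p.+1.
    by rewrite exprMn exprM /A2; field; rewrite gt_eqF.
  by rewrite ler_wpM2l ?mulr_ge0 // lerXn2r ?nnegrE // mulr_ge0 ?exprn_ge0.
rewrite ler_pM2l // in h2; apply: le_trans h2 _.
rewrite ler_pM ?(mulr_ge0 A20) ?exprn_ge0 //; last by rewrite ler_weXn2l // leq_addl.
by rewrite ler_wpM2r // lerDr.
Qed.

End Critical.

End Growth.

(** * Geometry of nested fractals *)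

Section Euclidean.
Context {R : realType} {d : nat}.
Implicit Types x y z : 'cV[R]_d.

(** Squared Euclidean length; distances are compared through their squares, and [sqr_norm_le] and
    [sq_le_norm] relate it to the sup norm of the topology. *)
Definition sq x : R := dot x x.

Lemma dotC x y : dot x y = dot y x.
Proof. by apply: eq_bigr => i _; rewrite mulrC. Qed.

Lemma dotDl x y z : dot (x + y) z = dot x z + dot y z.
Proof. by rewrite -big_split; apply: eq_bigr => i _; rewrite mxE mulrDl. Qed.

Lemma dotZl (a : R) x y : dot (a *: x) y = a * dot x y.
Proof. by rewrite mulr_sumr; apply: eq_bigr => i _; rewrite mxE mulrA. Qed.

Lemma dotNl x y : dot (- x) y = - dot x y.
Proof. by rewrite -scaleN1r dotZl mulN1r. Qed.

Lemma dotDr x y z : dot z (x + y) = dot z x + dot z y.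
Proof. by rewrite !(dotC z) dotDl. Qed.

Lemma dotZr (a : R) x y : dot x (a *: y) = a * dot x y.
Proof. by rewrite !(dotC x) dotZl. Qed.

Lemma dotNr x y : dot x (- y) = - dot x y.
Proof. by rewrite !(dotC x) dotNl. Qed.

Definition dotE := (dotDl, dotDr, dotNl, dotNr, dotZl, dotZr).

Lemma sq_ge0 x : 0 <= sq x.
Proof. by apply: sumr_ge0 => i _; rewrite -expr2 sqr_ge0. Qed.

Lemma sq_eq0 x : (sq x == 0) = (x == 0).
Proof.
apply/idP/eqP => [|->]; last by rewrite /sq -(scale0r 0) dotZl mul0r.
rewrite /sq /dot psumr_eq0 => [/allP h|i _]; last by rewrite -expr2 sqr_ge0.
apply/matrixP => i j; rewrite ord1 mxE.
by have := h i; rewrite mem_index_enum => /(_ isT); rewrite -expr2 sqrf_eq0 => /eqP.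
Qed.

Lemma sq_gt0 x y : x != y -> 0 < sq (x - y).
Proof. by move=> xy; rewrite lt0r sq_ge0 sq_eq0 subr_eq0 xy. Qed.

Lemma sqZ a x : sq (a *: x) = a ^+ 2 * sq x.
Proof. by rewrite /sq dotZl dotZr mulrA expr2. Qed.

Lemma sqN x : sq (- x) = sq x.
Proof. by rewrite -scaleN1r sqZ sqrrN expr1n mul1r. Qed.

Lemma sqB x y : sq (x - y) = sq (y - x).
Proof. by rewrite -sqN opprB. Qed.

Lemma sqD_le x y : sq (x + y) <= 2 * (sq x + sq y).
Proof.
have := sq_ge0 (x - y); rewrite /sq !dotE (dotC y x) => h.
rewrite -subr_ge0; lra.
Qed.

Lemma enorm_sq x : enorm x ^+ 2 = sq x.
Proof. by rewrite sqr_sqrtr // sq_ge0. Qed.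

Lemma coord_le_norm x i : `|x i 0| <= `|x|.
Proof.
rewrite [leRHS]/Num.Def.normr /= mx_normrE.
by apply: (le_bigmax _ (fun ij : 'I_d * 'I_1 => `|x ij.1 ij.2|) (i, 0)).
Qed.

Lemma sqr_norm_le x : `|x| ^+ 2 <= sq x.
Proof.
have [->|x0] := eqVneq x 0; first by rewrite normr0 expr0n /= sq_ge0.
have : mx_norm x != 0 by move: x0; rewrite -normr_eq0.
move=> /mx_norm_neq0[[i j] /= E]; have -> : `|x| = `|x i 0| by rewrite -(ord1 j) -E.
rewrite -normrX ger0_norm ?sqr_ge0 // expr2 /sq /dot (bigD1 i) //= lerDl.
by apply: sumr_ge0 => k _; rewrite -expr2 sqr_ge0.
Qed.

Lemma sq_le_norm x : sq x <= d%:R * `|x| ^+ 2.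
Proof.
rewrite /sq /dot mulr_natl -[X in _ *+ X]card_ord -sumr_const; apply: ler_sum => i _.
by rewrite -expr2 -real_normK ?num_real // lerXn2r ?nnegrE // coord_le_norm.
Qed.

Lemma dot_le_norm x y : `|dot x y| <= `|x| * \sum_i `|y i 0|.
Proof.
apply: le_trans (ler_norm_sum _ _ _) _; rewrite mulr_sumr; apply: ler_sum => i _.
by rewrite normrM ler_wpM2r // coord_le_norm.
Qed.

Lemma lipschitz_continuous (W : normedModType R) (f : 'cV[R]_d -> W) (C : R) :
  (forall x y, `|f x - f y| <= C * `|x - y|) -> continuous f.
Proof.
move=> hf x; apply/(@cvgrPdist_lt _ _ _ _ (nbhs_filter x)) => e e0.
have C0 : 0 < `|C| + 1 by rewrite ltr_wpDl.
near=> y; apply: le_lt_trans (hf x y) _.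
apply: (le_lt_trans (y := (`|C| + 1) * `|x - y|)).
  by rewrite ler_wpM2r // (le_trans (ler_norm _)) // lerDl.
rewrite mulrC -ltr_pdivlMr //.
near: y; apply: cvgr_dist_lt => //; exact: divr_gt0.
Unshelve. all: by end_near. Qed.

Lemma closed_sq (A : set 'cV[R]_d) x : closed A ->
  (forall e, 0 < e -> exists2 y, A y & sq (x - y) < e) -> A x.
Proof.
move=> cA h; apply: cA => B /nbhs_ballP[e /= e0 eB].
have [y Ay xy] := h _ (exprn_gt0 2 e0); exists y; split => //; apply: eB.
rewrite -ball_normE /ball_ /=; rewrite -(ltr_pXn2r (n := 2)) ?nnegrE ?(ltW e0) //.
exact: le_lt_trans (sqr_norm_le _) xy.
Qed.

Lemma open_sq (A : set 'cV[R]_d) x : open A -> A x ->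
  exists2 e, 0 < e & forall y, sq (x - y) < e -> A y.
Proof.
move=> oA Ax; have /nbhs_ballP[e /= e0 eB] : nbhs x A by apply: open_nbhs_nbhs.
exists (e ^+ 2); first exact: exprn_gt0.
move=> y xy; apply: eB; rewrite -ball_normE /ball_ /=.
by rewrite -(ltr_pXn2r (n := 2)) ?nnegrE ?(ltW e0) // (le_lt_trans (sqr_norm_le _)).
Qed.

Lemma reflection_diff x y z t : reflection x y z - reflection x y t =
  (z - t) - (2 * dot (z - t) (x - y) / sq (x - y)) *: (x - y).
Proof.
rewrite /reflection -/(sq _); set c := 2^-1 *: (x + y); set v := x - y.
have E : 2 * dot (z - t) v / sq v = 2 * dot (z - c) v / sq v - 2 * dot (t - c) v / sq v.
  by rewrite -mulrBl -mulrBr -dotNl -dotDl opprB addrA subrK.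
rewrite E; apply/matrixP => i j; rewrite !mxE; ring.
Qed.

Lemma sq_reflection x y z t : sq (reflection x y z - reflection x y t) = sq (z - t).
Proof.
have [<-|xy] := eqVneq x y.
  by rewrite reflection_diff subrr scaler0 subr0.
rewrite reflection_diff; set a := z - t; set v := x - y.
have v0 : sq v != 0 by rewrite gt_eqF // sq_gt0.
clearbody a v.
have e (c : R) : sq (a - c *: v) = sq a - 2 * c * dot a v + c ^+ 2 * sq v.
  by rewrite /sq !dotE (dotC v a); ring.
by rewrite e; field.
Qed.

Lemma reflectionE x y z : reflection x y z = z - ((sq (z - y) - sq (z - x)) / sq (x - y)) *: (x - y).
Proof.
rewrite /reflection -/(sq _); congr (_ - (_ / _) *: _).
rewrite /sq !dotE (dotC y z) (dotC x z) (dotC y x).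
by field.
Qed.

Lemma reflection_l x y : reflection x y x = y.
Proof.
have [<-|xy] := eqVneq x y; first by rewrite reflectionE subrr mul0r scale0r subr0.
rewrite reflectionE [x - x]subrr.
have -> : sq (0 : 'cV[R]_d) = 0 by apply/eqP; rewrite sq_eq0.
by rewrite subr0 divff ?gt_eqF ?sq_gt0 // scale1r opprB addrC subrK.
Qed.

Lemma reflection_fix x y z : sq (z - x) = sq (z - y) -> reflection x y z = z.
Proof. by move=> e; rewrite reflectionE e subrr mul0r scale0r subr0. Qed.

Lemma reflection_inj x y : injective (reflection x y).
Proof.
move=> z t e; apply/eqP; rewrite -subr_eq0 -sq_eq0 -(sq_reflection x y).
by rewrite e subrr sq_eq0.
Qed.

(* [|x - R x| = | |x - y|^2 - |x - z|^2 | / |z - y|] for [R] the reflection exchanging [z] and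
   [y], so that [R x] is close to [x] if [z] is not closer to [y] than [x]. *)
Lemma reflection_closer x y z : x != y -> x != z -> sq (x - z) <= sq (x - y) ->
  sq (x - y) <= sq (z - y) -> sq (reflection z y x - x) < sq (x - y).
Proof.
move=> xy xz h1 h2; have D0 := sq_gt0 xy; have d0 := sq_gt0 xz.
rewrite reflectionE addrAC subrr add0r sqN sqZ.
have N0 : 0 < sq (z - y) by apply: lt_le_trans h2.
set D := sq (x - y) in h1 h2 D0 *; set e := sq (x - z) in h1 d0 *.
have -> : ((D - e) / sq (z - y)) ^+ 2 * sq (z - y) = (D - e) ^+ 2 / sq (z - y).
  by field; rewrite gt_eqF.
rewrite ltr_pdivrMr //.
apply: (lt_le_trans (y := D * D)); last by rewrite ler_pM2l.
nra.
Qed.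

End Euclidean.

Section Recurrence.
Context {R : realType}.

Lemma pigeonhole (U : finType) (f : nat -> U) : exists a b, (a < b)%N /\ f a = f b.
Proof.
have : ~~ injectiveb (fun i : 'I_#|U|.+1 => f i).
  apply/negP => /injectiveP /leq_card; rewrite card_ord; lia.
move=> /injectivePn[a [b ab e]]; case: (ltngtP a b) => h; [by exists a, b|by exists b, a|].
by rewrite (val_inj h) eqxx in ab.
Qed.

(** Pigeonhole principle for the coordinates rounded to a grid of mesh [e]. *)
Lemma bounded_close (n : nat) (X : nat -> 'cV[R]_n) (C e : R) : 0 < e ->
  (forall k i, `|X k i 0| <= C) ->
  exists a b, (a < b)%N /\ forall i, `|X a i 0 - X b i 0| < e.
Proof.
move=> e0 hX; pose f k (i : 'I_n) := Num.truncn ((X k i 0 + C) / e).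
pose N := Num.truncn (2 * C / e).
have fN k i : (f k i < N.+1)%N.
  rewrite ltnS; apply: le_truncn; rewrite ler_pM2r ?invr_gt0 //.
  have := hX k i; have := ler_norm (X k i 0); lra.
have [a [b [ab /ffunP E]]] := pigeonhole (fun k => [ffun i => Ordinal (fN k i)]).
exists a, b; split=> // i; have := E i; rewrite !ffunE => /(congr1 val) /= {}E.
have b0 k : 0 <= (X k i 0 + C) / e.
  rewrite divr_ge0 ?(ltW e0) //; have := hX k i; have := ler_norm (- X k i 0); rewrite normrN; lra.
have /andP[a1 a2] := truncn_itv (b0 a); have /andP[b1 b2] := truncn_itv (b0 b).
rewrite -/(f a i) -/(f b i) E in a1 a2 b1 b2.
rewrite -natr1 in a2 b2.
have -> : X a i 0 - X b i 0 = ((X a i 0 + C) / e - (X b i 0 + C) / e) * e by field; rewrite gt_eqF.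
rewrite normrM (gtr0_norm e0) gtr_pMl // ltr_norml; lra.
Qed.

End Recurrence.

Section Nested.
Context {R : realType} {d M : nat} (S : similitudes R d M) (K : set 'cV[R]_d).
Context (hK : nested_fractal S K) (hS : one_point_intersection S).
Local Notation L := (Defs.ratio S).
Local Notation P := (Psi S).
Local Notation Pw := (Psi_word S).
Local Notation W := (V0 S).
Implicit Types (x y z p q : 'cV[R]_d) (i j l : 'I_M) (u v w : seq 'I_M).

Lemma ratio_gt0 : 0 < L.
Proof. by apply: lt_trans (nf_scale hK). Qed.

Lemma ratio_neq0 : L != 0.
Proof. by rewrite gt_eqF // ratio_gt0. Qed.

Lemma rot_unit i : Defs.rot S i \in unitmx.
Proof. by have [] := mulmx1_unit (nf_orthogonal hK i). Qed.

Lemma sq_rot i x : sq (Defs.rot S i *m x) = sq x.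
Proof.
have E y : sq y = (y^T *m y) 0 0 by rewrite mxE; apply: eq_bigr => k _; rewrite mxE.
by rewrite !E trmx_mul mulmxA -(mulmxA x^T) (mulmx1C (nf_orthogonal hK i)) mulmx1.
Qed.

Lemma PsiK i : cancel (P i) (Psi_inv S i).
Proof.
move=> x; rewrite /Psi_inv /Psi addrK -scalemxAr scalerA divff ?ratio_neq0 // scale1r.
by rewrite mulmxA mulVmx ?rot_unit // mul1mx.
Qed.

Lemma Psi_invK i : cancel (Psi_inv S i) (P i).
Proof.
move=> x; rewrite /Psi_inv /Psi -scalemxAr mulmxA mulmxV ?rot_unit // mul1mx.
by rewrite scalerA mulVf ?ratio_neq0 // scale1r subrK.
Qed.

Lemma Psi_inj i : injective (P i).
Proof. exact: can_inj (PsiK i). Qed.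

Lemma Psi_diff i x y : P i x - P i y = L^-1 *: (Defs.rot S i *m (x - y)).
Proof. by rewrite /Psi mulmxBr scalerBr opprD addrACA subrr addr0. Qed.

Lemma sq_Psi i x y : sq (P i x - P i y) = L ^- 2 * sq (x - y).
Proof. by rewrite Psi_diff sqZ sq_rot exprVn. Qed.

Lemma sq_word w x y : sq (Pw w x - Pw w y) = (L ^- 2) ^+ size w * sq (x - y).
Proof. by elim: w => [|i w IH] /=; rewrite ?expr0 ?mul1r // sq_Psi IH mulrA -exprS. Qed.

Lemma word_inj w : injective (Pw w).
Proof. by elim: w => [//|i w IH] x y /= /Psi_inj /IH. Qed.

Lemma word_nseq k i x : Pw (nseq k i) x = iter k (P i) x.
Proof. by elim: k => //= k ->. Qed.

Lemma word_continuous w : continuous (Pw w).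
Proof.
pose c : R := (L ^- 2) ^+ size w * d%:R.
have c0 : 0 <= c by rewrite mulr_ge0 // exprn_ge0 // invr_ge0 exprn_ge0 // ltW // ratio_gt0.
apply: (@lipschitz_continuous _ _ _ _ (c + 1)) => x y.
rewrite -(ler_pXn2r (n := 2)) ?nnegrE ?mulr_ge0 ?addr_ge0 //.
apply: le_trans (sqr_norm_le _) _; rewrite sq_word exprMn.
apply: (le_trans (y := c * `|x - y| ^+ 2)).
  by rewrite -mulrA ler_wpM2l ?sq_le_norm // exprn_ge0 // invr_ge0 exprn_ge0 // ltW // ratio_gt0.
rewrite ler_wpM2r ?sqr_ge0 //; nra.
Qed.

Lemma K_Psi i x : K x -> K (P i x).
Proof. by move=> Kx; rewrite (attractor_eq (nf_attractor hK)); exists i => //; exists x. Qed.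

Lemma K_word w x : K x -> K (Pw w x).
Proof. by move=> Kx; elim: w => //= i w; apply: K_Psi. Qed.

Lemma K_split x : K x -> exists i y, K y /\ P i y = x.
Proof. by rewrite {1}(attractor_eq (nf_attractor hK)) => -[i _ [y Ky <-]]; exists i, y. Qed.

Lemma closed_cell w : closed (Pw w @` K).
Proof.
apply: compact_closed; first exact: norm_hausdorff.
apply: continuous_compact; last exact: attractor_compact (nf_attractor hK).
by apply: continuous_subspaceT => x; exact: word_continuous.
Qed.

Lemma finite_V0 : finite_set W.
Proof.
apply: contrapT => nf; have := nf_boundary hK.
by rewrite /fset_set; case: pselect => // ; rewrite cardfs0.
Qed.

Lemma in_V0 p : p \in fset_set W <-> W p.
Proof. by rewrite in_fset_set; [rewrite inE|exact: finite_V0]. Qed.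

Lemma V0_fix p : W p -> exists i, P i p = p.
Proof. by move=> [i [j [k [l [q []]]]]]; exists i. Qed.

Lemma fixed_uniq i p q : P i p = p -> P i q = q -> p = q.
Proof.
move=> ep eq; apply/eqP; rewrite -subr_eq0 -sq_eq0; apply/eqP.
have := sq_Psi i p q; rewrite ep eq => h.
have L1 : L ^- 2 < 1 by rewrite invf_lt1 ?exprn_gt0 ?ratio_gt0 // exprn_egt1 // (nf_scale hK).
have := sq_ge0 (p - q); nra.
Qed.

(** The fixed point is the limit of the [P i]-iterates of any point of the closed set [K]. *)
Lemma K_fixed i p : P i p = p -> K p.
Proof.
move=> ep; have [x Kx] := attractor_neq0 (nf_attractor hK).
have cK : closed K.
  by apply: compact_closed; [exact: norm_hausdorff|exact: attractor_compact (nf_attractor hK)].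
apply: (closed_sq cK) => e e0.
have [->|xp] := eqVneq p x; first by exists x => //; rewrite subrr /sq -(scale0r x) dotZl mul0r.
have s0 := sq_gt0 xp.
have L1 : 1 < L ^+ 2 by rewrite exprn_egt1 // (nf_scale hK).
have [k hk] : exists k, sq (p - x) / e < (L ^+ 2) ^+ k.
  pose a := L ^+ 2 - 1; have a0 : 0 < a by rewrite subr_gt0.
  exists (Num.truncn (sq (p - x) / e / a)).+1.
  apply: (lt_le_trans (y := a * (Num.truncn (sq (p - x) / e / a)).+1%:R)).
    by rewrite [ltRHS]mulrC -ltr_pdivrMr // truncnS_gt.
  have -> : L ^+ 2 = 1 + a by rewrite /a addrC subrK.
  elim: (_.+1) => [|n IH]; first by rewrite mulr0 expr0.
  rewrite exprS -natr1 mulrDr mulr1; have : 1 <= (1 + a) ^+ n by rewrite exprn_ege1 // lerDl ltW.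
  nra.
exists (Pw (nseq k i) x); first exact: K_word.
have {1}-> : p = Pw (nseq k i) p by rewrite word_nseq; elim: (k) => //= n <-.
rewrite sq_word size_nseq exprVn mulrC ltr_pdivrMr ?exprn_gt0 ?ratio_gt0 //.
by rewrite mulrC -ltr_pdivrMr.
Qed.

Lemma V0_K p : W p -> K p.
Proof. by move=> /V0_fix[i]; exact: K_fixed. Qed.

Local Notation A i := (mulmx (Defs.rot S i)).

Lemma iter_rotZ i k (c : R) z : iter k (A i) (c *: z) = c *: iter k (A i) z.
Proof. by elim: k => //= k ->; rewrite scalemxAr. Qed.

Lemma sq_iter_rot i k x y : sq (iter k (A i) x - iter k (A i) y) = sq (x - y).
Proof. by elim: k => //= k <-; rewrite -mulmxBr sq_rot. Qed.

Lemma iter_Psi_fixed i p k x : P i p = p ->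
  iter k (P i) x - p = L^-1 ^+ k *: iter k (A i) (x - p).
Proof.
move=> ep; elim: k => [|k IH] /=; first by rewrite expr0 scale1r.
by rewrite -[X in _ - X]ep Psi_diff IH -scalemxAr scalerA exprS.
Qed.

(** Both orbits are stacked into one bounded sequence, so that one pair [a < b] of times is close
    for both. Since the rotations are isometries, the first [a] iterations cancel. *)
Lemma iter_rot_recurrent i l z1 z2 e : 0 < e -> exists k,
  [/\ (0 < k)%N, sq (iter k (A i) z1 - z1) < e & sq (iter k (A l) z2 - z2) < e].
Proof.
move=> e0; pose C := 1 + sq z1 + sq z2.
pose X k := col_mx (iter k (A i) z1) (iter k (A l) z2).
have d0 : 0 < d%:R :> R by rewrite ltr0n (nf_dim hK).
pose e1 := Num.sqrt (e / d%:R).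
have e10 : 0 < e1 by rewrite sqrtr_gt0 divr_gt0.
have e1E : e1 ^+ 2 = e / d%:R by rewrite sqr_sqrtr // ltW // divr_gt0.
have sqi j k z : sq (iter k (A j) z) = sq z.
  by elim: k => //= k <-; rewrite sq_rot.
have hX k r : `|X k r 0| <= C.
  have b z c : `|z c 0| <= 1 + sq z.
    have h := coord_le_norm z c; have h2 := sqr_norm_le z.
    have : 0 <= (`|z| - 1) ^+ 2 by exact: sqr_ge0.
    have := normr_ge0 z; nra.
  rewrite /C; have := sq_ge0 z1; have := sq_ge0 z2 => g1 g2.
  case: (splitP r) => c rc.
    have -> : r = lshift d c by apply: val_inj.
    rewrite col_mxEu; have := b (iter k (A i) z1) c; rewrite sqi; lra.
  have -> : r = rshift d c by apply: val_inj.
  rewrite col_mxEd; have := b (iter k (A l) z2) c; rewrite sqi; lra.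
have [a [b [ab h]]] := bounded_close e10 hX.
have small z : (forall c, `|z c 0| < e1) -> sq z < e.
  move=> hz; have -> : e = \sum_(c < d) e1 ^+ 2.
    by rewrite sumr_const card_ord -mulr_natr e1E divfK ?gt_eqF.
  apply: ltr_sum; first by apply/hasP; exists (Ordinal (nf_dim hK)) => //; exact: mem_index_enum.
  move=> c _; rewrite -expr2 -real_normK ?num_real //.
  by rewrite ltrXn2r ?nnegrE // ltW.
have step j z : (forall c, `|(iter a (A j) z - iter b (A j) z) c 0| < e1) ->
    sq (iter (b - a) (A j) z - z) < e.
  move=> hz; rewrite sqB -(sq_iter_rot j a) -iterD subnKC ?(ltnW ab) //.
  exact: small.
exists (b - a)%N; split; first by rewrite subn_gt0.
  by apply: step => c; have := h (lshift d c); rewrite !col_mxEu !mxE.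
by apply: step => c; have := h (rshift d c); rewrite !col_mxEd !mxE.
Qed.

(* If [p = P j q] with [q] fixed by [P l], then up to a rotation close to the identity [P i^k P j]
   and [P j P l^k] agree for recurrent [k], whereas they map the open set of (NF1) into disjoint
   sets if [i != j]. *)
Lemma V0_index i j p y : W p -> P i p = p -> K y -> P j y = p -> j = i.
Proof.
move=> Wp ip Ky py; apply/eqP; apply/negPn/negP => ji.
have [_ [q Wq qp]] : (P i @` W `&` P j @` W) p.
  by rewrite -(nf4 hK) 1?eq_sym //; split; [exists p => //; exact: V0_K|exists y].
have [l lq] := V0_fix Wq.
have [U [[u Uu] _ oU dU UU]] := nf1 hK.
have PU a x : U x -> U (P a x) by move=> Ux; apply: UU; exists a => //; exists x.
have PUk a k x : U x -> U (iter k (P a) x) by move=> Ux; elim: k => //= k; exact: PU.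
have [e e0 eU] := open_sq oU Uu.
have [k [k0 h1 h2]] : exists k, [/\ (0 < k)%N,
  sq (iter k (A i) (A j (u - q)) - A j (u - q)) < e / 4 & sq (iter k (A l) (u - q) - (u - q)) < e / 4].
  by apply: iter_rot_recurrent; rewrite divr_gt0.
(* [X] lies in the image of [U] under [P j]. Its preimage [u'] under [iter k (P i) \o P j] is close
   to [u] by recurrence, hence in [U], and so [X] lies in the image of [U] under [P i] too. The two
   errors [e / 4] stay below [e] by [sqD_le]. *)
pose X := P j (iter k (P l) u).
pose u' := Psi_inv S j (iter k (Psi_inv S i) X).
have Xu' : iter k (P i) (P j u') = X.
  rewrite /u' Psi_invK; elim: k X {k0 h1 h2 u'} => // k IH X.
  by rewrite iterSr iterS Psi_invK IH.
have Uu' : U u'.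
  apply: eU; rewrite sqB.
  have E : sq (X - iter k (P i) (P j u)) = (L ^- 2) ^+ k.+1 * sq (u' - u).
    by rewrite -Xu' -!word_nseq sq_word size_nseq sq_Psi mulrA -exprSr.
  have E1 : X - p = L^-1 ^+ k.+1 *: (A j (iter k (A l) (u - q))).
    by rewrite /X -qp Psi_diff iter_Psi_fixed // -scalemxAr scalerA exprS.
  have E2 : iter k (P i) (P j u) - p = L^-1 ^+ k.+1 *: iter k (A i) (A j (u - q)).
    by rewrite iter_Psi_fixed // -{1}qp Psi_diff iter_rotZ scalerA exprSr.
  have L0 : 0 < (L ^- 2) ^+ k.+1 by rewrite exprn_gt0 // invr_gt0 exprn_gt0 // ratio_gt0.
  have : sq (X - iter k (P i) (P j u)) < (L ^- 2) ^+ k.+1 * e.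
    have -> : X - iter k (P i) (P j u) = (X - p) - (iter k (P i) (P j u) - p).
      by rewrite opprB addrA subrK.
    rewrite E1 E2 -scalerBr sqZ.
    have -> : (L^-1 ^+ k.+1) ^+ 2 = (L ^- 2) ^+ k.+1 by rewrite exprAC exprVn.
    rewrite ltr_pM2l //.
    set a := iter k (A l) _ in h2 *; set b := iter k (A i) _ in h1 *.
    have -> : A j a - b = A j (a - (u - q)) + (A j (u - q) - b).
      by rewrite mulmxBr addrA subrK.
    apply: le_lt_trans (sqD_le _ _) _; rewrite sq_rot (sqB _ b); lra.
  by rewrite E ltr_pM2l.
have : (P i @` U `&` P j @` U) X.
  split; last by exists (iter k (P l) u) => //; exact: PUk.
  rewrite -Xu' -(prednK k0) iterS; exists (iter k.-1 (P i) (P j u')) => //.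
  by apply: PUk; apply: PU.
by rewrite dU // eq_sym.
Qed.

(** By [V0_index] both points are fixed by [P i], and a contraction has one fixed point. *)
Lemma V0_cell i x p q : W p -> W q -> K x -> forall y, K y -> P i x = p -> P i y = q -> p = q.
Proof.
move=> Wp Wq Kx y Ky xp yq; have [j jp] := V0_fix Wp; have [l lq] := V0_fix Wq.
have ij := V0_index Wp jp Kx xp; have il := V0_index Wq lq Ky yq.
by apply: (@fixed_uniq i); rewrite ?ij // -ij il.
Qed.

(** All letters of [w] are the index of the map that fixes [p]. *)
Lemma V0_word p w y : W p -> K y -> Pw w y = p -> Pw w p = p.
Proof.
move=> Wp Ky; have [i ip] := V0_fix Wp.
elim: w => //= j w IH e; have ji := V0_index Wp ip (K_word w Ky) e.
rewrite IH; first by rewrite ji.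
by apply: (@Psi_inj j); rewrite e ji.
Qed.

(** After the common prefix, (NF4) applies to the first different letters and gives points of [V0];
    these are fixed by the remaining words, so they equal [x] and [y]. *)
Lemma word_cells_meet u v x y : size u = size v -> u != v -> K x -> K y -> Pw u x = Pw v y ->
  W x /\ W y.
Proof.
elim: u v => [|i u IH] [|j v] //= [suv]; rewrite eqseq_cons negb_and => uv Kx Ky e.
have [ij|ij] := eqVneq i j.
  by move: uv; rewrite ij eqxx /= => uv; apply: (IH v) => //; apply: (@Psi_inj i); rewrite e ij.
have := nf4 hK ij; move/seteqP => [sub _].
have [|[p Wp pe] [q Wq qe]] := sub (P i (Pw u x)).
  by split; [exists (Pw u x) => //; exact: K_word|rewrite e; exists (Pw v y) => //; exact: K_word].
have up : Pw u x = p by apply: (@Psi_inj i).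
have vq : Pw v y = q by apply: (@Psi_inj j); rewrite -e.
split.
  by have := V0_word Wp Kx up; rewrite -{2}up => /word_inj <-.
by have := V0_word Wq Ky vq; rewrite -{2}vq => /word_inj <-.
Qed.

(** * Reflections, nearest pairs and folding of paths *)

Local Notation refl := reflection.

Lemma refl_id x z : refl x x z = z.
Proof. by rewrite /reflection subrr scaler0 subr0. Qed.

Lemma refl_V0 x y z : W x -> W y -> W z -> W (refl x y z).
Proof.
move=> Wx Wy Wz; have [<-|xy] := eqVneq x y; first by rewrite refl_id.
by have [<- _] := nf3 hK Wx Wy xy; exists z.
Qed.

Lemma refl_cell x y w : W x -> W y -> (0 < size w)%N -> exists w',
  [/\ size w' = size w, refl x y @` (Pw w @` K) = Pw w' @` K &
      refl x y @` (Pw w @` W) = Pw w' @` W].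
Proof.
move=> Wx Wy w0; have [<-|xy] := eqVneq x y.
  exists w; split=> //; apply/seteqP; split=> z.
  - by move=> [t tw <-]; rewrite refl_id.
  - by move=> zw; exists z => //; rewrite refl_id.
  - by move=> [t tw <-]; rewrite refl_id.
  - by move=> zw; exists z => //; rewrite refl_id.
have [_ /(_ _ w0)/seteqP[sub _]] := nf3 hK Wx Wy xy.
have [|w' /= w'w [e1 e2]] := sub (refl x y @` (Pw w @` K), refl x y @` (Pw w @` W)).
  by exists (Pw w @` K, Pw w @` W) => //; exists w.
by exists w'; split.
Qed.

Definition nearest x y := [/\ W x, W y, x != y & enorm (x - y) = delta0 S].

Lemma delta0_le x y : W x -> W y -> x != y -> delta0 S <= enorm (x - y).
Proof.
move=> Wx Wy xy; apply: ge_inf; last by exists x, y.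
by exists 0 => r [a [b [_ _ _ ->]]]; exact: sqrtr_ge0.
Qed.

Lemma nearest_exists : exists x y, nearest x y.
Proof.
pose D := fset_set W.
have WD (x : D) : W (val x) by apply/in_V0; exact: (fsvalP x).
have D2 : (1 < #|{: D}|)%N by rewrite -cardfE; exact: nf_boundary hK.
have [a [b ab]] : exists a b : D, a != b.
  by have /card_gt1P[a [b [_ _ ab]]] := D2; exists a, b.
pose f (p : D * D) := enorm (val p.1 - val p.2).
case: (@arg_minP _ _ _ (a, b) (fun p : D * D => p.1 != p.2) f) => //= -[x y] /= xy h.
exists (val x), (val y); split=> //; apply/eqP; rewrite eq_le delta0_le // andbT.
apply: lb_le_inf; first by exists (enorm (val a - val b)), (val a), (val b); split.
move=> r [x' [y' [Wx' Wy' xy' ->]]].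
have x'D : x' \in D by apply/in_V0.
have y'D : y' \in D by apply/in_V0.
exact: (h ([` x'D]%fset, [` y'D]%fset)).
Qed.

Lemma nearest_sym x y : nearest x y -> nearest y x.
Proof.
by move=> [Wx Wy xy e]; split; rewrite 1?eq_sym // -e /enorm -!/(sq _) sqB.
Qed.

Lemma nearest_sq x y x' y' : nearest x y -> W x' -> W y' -> sq (x' - y') = sq (x - y) ->
  nearest x' y'.
Proof.
move=> [Wx Wy xy e] Wx' Wy' e'; split=> //; last by rewrite -e /enorm -!/(sq _) e'.
by rewrite -subr_eq0 -sq_eq0 e' sq_eq0 subr_eq0.
Qed.

Lemma nearest_le x y x' y' : nearest x y -> W x' -> W y' -> x' != y' ->
  sq (x - y) <= sq (x' - y').
Proof.
move=> [Wx Wy xy e] Wx' Wy' xy'; rewrite -!enorm_sq e.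
by rewrite lerXn2r ?nnegrE -?e ?sqrtr_ge0 // e delta0_le.
Qed.

Lemma nearest_eq x y x' y' : nearest x y -> nearest x' y' -> sq (x - y) = sq (x' - y').
Proof. by move=> [_ _ _ e] [_ _ _ e']; rewrite -!enorm_sq e e'. Qed.

Lemma refl_nearest a b x y : W a -> W b -> nearest x y -> nearest (refl a b x) (refl a b y).
Proof.
move=> Wa Wb n; have [Wx Wy _ _] := n.
by apply: (nearest_sq n); rewrite ?sq_reflection //; exact: refl_V0.
Qed.

Lemma nearest_from x : W x -> exists y, nearest x y.
Proof.
move=> Wx; have [a [b ab]] := nearest_exists; exists (refl a x b).
by have [Wa _ _ _] := ab; have := refl_nearest Wa Wx ab; rewrite reflection_l.
Qed.

(** Let [z] be a nearest partner of [x]. If it is no closer to [y] than [x], the reflection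
    exchanging [z] and [y] sends [x] to a nearest partner of [y], which by [reflection_closer] is
    closer to [x] than [y] is. *)
Lemma nearest_greedy x y : W x -> W y -> x != y ->
  (exists z, nearest x z /\ sq (z - y) < sq (x - y)) \/
  (exists z, nearest y z /\ sq (z - x) < sq (y - x)).
Proof.
move=> Wx Wy xy; have [z xz] := nearest_from Wx; have [_ Wz nxz _] := xz.
have [h|h] := ltP (sq (z - y)) (sq (x - y)); first by left; exists z.
right; exists (refl z y x); split.
  by apply: nearest_sym; have := refl_nearest Wz Wy xz; rewrite reflection_l.
by rewrite (sqB y) reflection_closer // (nearest_le xz).
Qed.

(** Adjacency in [F_m] before it is blown up by the inverse iterates of the map fixing the origin;
    at this scale the reflections of (NF3) act on the cells. *)
Definition step m x y : bool :=
  `[< exists w p q, [/\ size w = m, nearest p q, x = Pw w p & y = Pw w q] >].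

Lemma step_sym m x y : step m x y -> step m y x.
Proof.
move=> /asboolP[w [p [q [sw n -> ->]]]]; apply/asboolP; exists w, q, p; split=> //.
exact: nearest_sym.
Qed.

Lemma step_refl m a b x y : W a -> W b -> step m x y -> step m (refl a b x) (refl a b y).
Proof.
move=> Wa Wb /asboolP[w [p [q [sw n -> ->]]]]; apply/asboolP.
have [m0|m0] := posnP m.
  move: sw; rewrite m0 => /size0nil ->; exists [::], (refl a b p), (refl a b q); split=> //.
  exact: refl_nearest.
have [w' [sw' _ /seteqP[sub _]]] := refl_cell Wa Wb (etrans (congr1 _ sw) m0).
have [Wp Wq _ _] := n.
have [|p' Wp' ep] := sub (refl a b (Pw w p)); first by exists (Pw w p) => //; exists p.
have [|q' Wq' eq] := sub (refl a b (Pw w q)); first by exists (Pw w q) => //; exists q.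
exists w', p', q'; split; rewrite ?sw' //.
apply: (nearest_sq n) => //; have := sq_word w' p' q'.
rewrite ep eq sq_reflection sq_word sw' => /mulfI -> //.
by rewrite gt_eqF // exprn_gt0 // invr_gt0 exprn_gt0 // ratio_gt0.
Qed.

Definition joined m x y (n : nat) :=
  exists p : seq _, [/\ path (step m) x p, last x p = y & (size p <= n)%N].

Lemma joined_refl m x n : joined m x x n.
Proof. by exists [::]. Qed.

Lemma joined_trans m x y z n n' : joined m x y n -> joined m y z n' -> joined m x z (n + n').
Proof.
move=> [p [pp lp sp]] [p' [pp' lp' sp']]; exists (p ++ p').
by rewrite cat_path pp lp last_cat lp size_cat leq_add.
Qed.

Lemma joined_sym m x y n : joined m x y n -> joined m y x n.
Proof.
move=> [p [pp lp sp]]; exists (rev (belast x p)).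
rewrite size_rev size_belast -lp rev_path; split=> //.
  by apply: sub_path pp => u v; apply: step_sym.
by case: p {pp lp sp} => //= u p; rewrite rev_cons last_rcons.
Qed.

Lemma joined_mono m x y n n' : (n <= n')%N -> joined m x y n -> joined m x y n'.
Proof. by move=> nn [p [? ? sp]]; exists p; split=> //; apply: leq_trans nn. Qed.

Lemma joined_word m w x y n : size w = m -> joined 0 x y n -> joined m (Pw w x) (Pw w y) n.
Proof.
move=> sw [p [pp lp sp]]; exists (map (Pw w) p); rewrite last_map lp size_map; split=> //.
rewrite path_map; apply: sub_path pp => u v /asboolP[w0 [a [b [/size0nil -> ab -> ->]]]].
by apply/asboolP; exists w, a, b.
Qed.

Lemma joined_reflection m a b x y n : W a -> W b -> joined m x y n ->
  joined m (refl a b x) (refl a b y) n.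
Proof.
move=> Wa Wb [p [pp lp sp]]; exists (map (refl a b) p); rewrite last_map lp size_map; split=> //.
by rewrite path_map; apply: sub_path pp => u v; apply: step_refl.
Qed.

Lemma nearest_step x y : nearest x y -> step 0 x y.
Proof. by move=> n; apply/asboolP; exists [::], x, y. Qed.

Local Notation c := #|` fset_set W|.

(** Each move of [nearest_greedy] decreases the distance of the two end points, and only finitely
    many distances occur; the induction counts the pairs in [V0] that are closer. *)
Lemma F0_path x y : W x -> W y -> exists p : seq _, path (step 0) x p /\ last x p = y.
Proof.
pose D := fset_set W.
have WD z : W z -> z \in D by move/in_V0.
pose near r := [fset t in (D `*` D)%fset | sq (t.1 - t.2) < r]%fset.
have near_lt (a b a' b' : 'cV[R]_d) : W a -> W b -> sq (a - b) < sq (a' - b') ->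
    (#|` near (sq (a - b))| < #|` near (sq (a' - b'))|)%N.
  move=> Wa Wb lt; apply: fproper_ltn_card; rewrite fproperE; apply/andP; split.
    by apply/fsubsetP => t; rewrite !inE => /andP[-> h]; rewrite (lt_trans h).
  by apply/negP => /fsubsetP /(_ (a, b)); rewrite !inE /= !WD // lt ltxx => /(_ isT).
have [n] := ubnP #|` near (sq (x - y))|.
elim: n x y => // n IH x y xyn Wx Wy; rewrite ltnS in xyn.
have [->|xy] := eqVneq x y; first by exists [::].
have [[z [xz lt]]|[z [yz lt]]] := nearest_greedy Wx Wy xy.
  have [_ Wz _ _] := xz.
  have [p [pp lp]] := IH z y (leq_trans (near_lt _ _ _ _ Wz Wy lt) xyn) Wz Wy.
  by exists (z :: p); rewrite /= nearest_step.
have [_ Wz _ _] := yz; rewrite (sqB x) in xyn; have := leq_trans (near_lt _ _ _ _ Wz Wx lt) xyn.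
rewrite (sqB z) => zn; have [p [pp lp]] := IH x z zn Wx Wz.
exists (rcons p y); rewrite last_rcons rcons_path pp lp; split=> //.
by apply: nearest_step; apply: nearest_sym.
Qed.

Lemma F0_joined x y : W x -> W y -> joined 0 x y c.
Proof.
move=> Wx Wy; have [p [pp lp]] := F0_path Wx Wy.
case/shortenP: pp lp => p' pp' up' _ lp'; exists p'; split=> //.
apply: ltnW; apply: (@uniq_leq_size _ (x :: p')) => // z zp.
apply/in_V0; move: zp; rewrite inE => /orP[/eqP->//|zp].
have [p1 [p2 E]] : exists p1 p2 : seq _, p' = rcons p1 z ++ p2.
  by case/splitPr: zp => p1 p2; exists p1, p2; rewrite cat_rcons.
move: pp'; rewrite E cat_path rcons_path => /andP[/andP[_ h] _].
by move: h => /asboolP[w0 [a [b [/size0nil -> [_ Wb _ _] _ ->]]]].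
Qed.

Lemma cell_joined m w x y : size w = m -> W x -> W y -> joined m (Pw w x) (Pw w y) c.
Proof. by move=> sw Wx Wy; apply: joined_word => //; exact: F0_joined. Qed.

Lemma connected_cell w : connected (Pw w @` K).
Proof.
apply: connected_continuous_connected; first exact: nf2 hK.
by apply: continuous_subspaceT => x; exact: word_continuous.
Qed.

(** Intermediate value theorem on the connected cell for the difference of the squared distances to
    [a] and [z], which vanishes exactly on the bisector. *)
Lemma cell_bisector a z w (u v : 'cV[R]_d) : K u -> K v ->
  sq (Pw w u - a) <= sq (Pw w u - z) -> sq (Pw w v - z) < sq (Pw w v - a) ->
  exists t, K t /\ refl a z (Pw w t) = Pw w t.
Proof.
move=> Ku Kv hu hv; pose s (t : 'cV[R]_d) : R := sq (t - a) - sq (t - z).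
have sE t t' : s t - s t' = dot (t - t') (2 *: (z - a)).
  by rewrite /s /sq !dotE (dotC a t) (dotC a t') (dotC z t) (dotC z t'); ring.
have cs : continuous s.
  apply: (@lipschitz_continuous _ _ _ _ (\sum_i `|(2 *: (z - a)) i 0|)) => t t'.
  by rewrite sE mulrC dot_le_norm.
have : connected (s @` (Pw w @` K)).
  apply: connected_continuous_connected; first exact: connected_cell.
  by apply: continuous_subspaceT => x; exact: cs.
move=> /connected_intervalP itv.
have su : (s @` (Pw w @` K)) (s (Pw w u)) by exists (Pw w u) => //; exists u.
have sv : (s @` (Pw w @` K)) (s (Pw w v)) by exists (Pw w v) => //; exists v.
have [|_ [t Kt <-] st] := itv _ _ su sv 0; first by rewrite /s subr_le0 hu subr_ge0 ltW.
exists t; split=> //; apply: reflection_fix; apply/eqP.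
by rewrite -subr_eq0; apply/eqP.
Qed.

Lemma path_crossing (P' : pred 'cV[R]_d) (e : rel 'cV[R]_d) x (p : seq 'cV[R]_d) :
  ~~ P' x -> P' (last x p) -> path e x p -> exists (p1 : seq _) (v : 'cV[R]_d),
    [/\ ~~ P' (last x p1), P' v, e (last x p1) v, path e x p1 &
    (size p1 < size p)%N].
Proof.
elim: p x => [|y p IH] x /=; first by move=> /negP.
move=> nx Pl /andP[xy pp]; case Py: (P' y); first by exists [::], y.
have [|p1 [v [h1 h2 h3 h4 h5]]] := IH y _ Pl pp; first by rewrite Py.
by exists (y :: p1), v; rewrite /= xy.
Qed.

(* Reflect in the bisector of [a] and [z] the part of the path on the side of [a]: the cell in
   which the path crosses the bisector meets its own reflection, so that the crossing point and its
   reflection are at bounded distance. *)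
Lemma fold_near m a z b (p : seq 'cV[R]_d) : nearest a z -> W b -> sq (z - b) < sq (a - b) ->
  path (step m.+1) a p -> last a p = b -> joined m.+1 a z ((2 + 2 * c) * size p).
Proof.
move=> az Wb lt pp lp; have [Wa Wz naz _] := az.
(* [P'] is the open half-space of the points closer to [z]; the path starts outside it and ends
   inside. *)
pose P' t := sq (t - z) < sq (t - a).
have [||p1 [v [h1 h2 uv h4 h5]]] := @path_crossing P' (step m.+1) a p _ _ pp.
- rewrite /P' -leNgt subrr; have -> : sq (0 : 'cV[R]_d) = 0 by apply/eqP; rewrite sq_eq0.
  exact: sq_ge0.
- by rewrite lp /P' (sqB b z) (sqB b a).
set u := last a p1 in h1 uv; rewrite /P' -leNgt in h1.
have au : joined m.+1 a u (size p1) by exists p1.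
have zu : joined m.+1 z (refl a z u) (size p1).
  by have := joined_reflection Wa Wz au; rewrite reflection_l.
(* Join [u] to its mirror image through at most two cells, then follow the reflected path back to
   [z]. *)
suff uu : joined m.+1 u (refl a z u) (c + c).
  apply: (joined_mono _ (joined_trans (joined_trans au uu) (joined_sym zu))).
  clear -h5; nia.
move: uv => /asboolP[w [x [y [sw [Wx Wy _ _] ux vy]]]].
have [||t [Kt ft]] := @cell_bisector a z w x y (V0_K Wx) (V0_K Wy).
- by rewrite -ux.
- by rewrite -vy.
have [w' [sw' /seteqP[subK _] /seteqP[subW _]]] := refl_cell Wa Wz (etrans (congr1 _ sw) (ltn0Sn m)).
have [|x' Wx' ex] := subW (refl a z u); first by exists u => //; exists x.
have [|t' Kt' et] := subK (Pw w t); first by exists (Pw w t) => //; exists t.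
(* The fixed point [t] gives a point of both the cell and its mirror image; if these differ, it is a
   boundary point of both. *)
rewrite -ex ux; have [ww|ww] := eqVneq w w'.
  by rewrite -ww; apply: joined_mono (cell_joined sw Wx Wx'); rewrite leq_addr.
have [Wt Wt'] := word_cells_meet (esym sw') ww Kt Kt' (esym et).
apply: joined_trans (cell_joined sw Wx Wt) _; rewrite -et.
by apply: cell_joined => //; rewrite sw'.
Qed.

(** Reflections act transitively on nearest pairs: one takes [a] to [a'], and a second, exchanging
    two points equidistant from [a'], fixes [a'] and takes the image of [z] to [z']. *)
Lemma nearest_joined m a z a' z' n : nearest a z -> nearest a' z' ->
  joined m a z n -> joined m a' z' n.
Proof.
move=> az az' h; have [Wa Wz _ _] := az; have [Wa' Wz' _ _] := az'.
have h1 := joined_reflection Wa Wa' h; rewrite reflection_l in h1.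
have n1 := refl_nearest Wa Wa' az; rewrite reflection_l in n1.
set z1 := refl a a' z in h1 n1; have [_ Wz1 _ _] := n1.
have := joined_reflection Wz1 Wz' h1; rewrite reflection_l reflection_fix //.
exact: nearest_eq n1 az'.
Qed.

Lemma joined_chain m x (p : seq 'cV[R]_d) n : (forall a z, nearest a z -> joined m a z n) ->
  path (step 0) x p -> joined m x (last x p) (size p * n).
Proof.
move=> h; elim: p x => [|y p IH] x /=; first by move=> _; exact: joined_refl.
move=> /andP[/asboolP[w0 [a [b [/size0nil -> ab -> ->]]]] /IH].
by rewrite mulSn; apply: joined_trans; exact: h.
Qed.

(** [nearest_greedy] provides at one end of the path a nearest pair, which [fold_near] connects;
    symmetry connects all nearest pairs, and at most [c] of them lead from [x] to [y]. Level 0 is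
    separate since (NF3) permutes cells of positive level only. *)
Lemma fold_joined m a b (p : seq 'cV[R]_d) x y : W a -> W b -> a != b ->
  path (step m) a p -> last a p = b ->
  W x -> W y -> joined m x y (c * (2 + 2 * c) * size p).
Proof.
move=> Wa Wb ab pp lp Wx Wy.
have p0 : (0 < size p)%N by case: p lp {pp} => //= E; rewrite E eqxx in ab.
case: m pp => [|m] pp.
  apply: joined_mono (F0_joined Wx Wy); clear -p0; nia.
have [a' [z' [az' d']]] : exists a' z', nearest a' z' /\ joined m.+1 a' z' ((2 + 2 * c) * size p).
  have [[z [az lt]]|[z [bz lt]]] := nearest_greedy Wa Wb ab.
    by exists a, z; split=> //; apply: fold_near lp.
  exists b, z; split=> //.
  have -> : size p = size (rev (belast a p)) by rewrite size_rev size_belast.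
  apply: (fold_near bz Wa lt).
    by rewrite -lp rev_path; apply: sub_path pp => u v; apply: step_sym.
  by case: (p) p0 => //= u p' _; rewrite rev_cons last_rcons.
have [q [pq lq sq']] := F0_joined Wx Wy.
rewrite -lq; apply: joined_mono (joined_chain (n := (2 + 2 * c) * size p) _ pq).
  by rewrite -mulnA leq_mul2r sq' orbT.
by move=> a2 z2 n2; apply: nearest_joined n2 d'.
Qed.

Definition touch i j : bool := `[< exists p q, [/\ W p, W q & P i p = P j q] >].

(** Otherwise the cells linked to [i] and the remaining ones would form two disjoint nonempty closed
    sets covering the connected set [K]. *)
Lemma touch_connect i j : connect touch i j.
Proof.
have cP l : closed (P l @` K).
  by have -> : P l @` K = Pw [:: l] @` K; [|exact: closed_cell].
apply/negPn/negP => nij.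
pose A := \bigcup_(l in [set l | connect touch i l]) P l @` K.
pose B := \bigcup_(l in [set l | ~~ connect touch i l]) P l @` K.
have [x0 Kx0] := attractor_neq0 (nf_attractor hK).
have AB : forall x, A x -> ~ B x.
  move=> x [l /= il [y Ky yx]] [l' /= nil [y' Ky' yx']].
  have ll : l != l' by apply/eqP => E; rewrite -E il in nil.
  have [[p Wp pe] [q Wq qe]] : (P l @` W `&` P l' @` W) x.
    by rewrite -(nf4 hK ll); split; [exists y|exists y'].
  move: nil; rewrite (connect_trans il) //; apply: connect1; apply/asboolP.
  by exists p, q; split=> //; rewrite pe qe.
have AUB : forall x, K x -> A x \/ B x.
  move=> x /K_split[l [y [Ky <-]]]; case il: (connect touch i l).
    by left; exists l => //; exists y.
  by right; exists l; [rewrite /= il|exists y].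
have AK : A `<=` K by move=> x [l _ [y Ky <-]]; exact: K_Psi.
have fin (X : set 'I_M) : finite_set X by exact: finite_finset.
have cA : closed A by have := closed_bigcup (fin _) (fun l _ => cP l); exact.
have cB : closed B by have := closed_bigcup (fin _) (fun l _ => cP l); exact.
have AE : A = K.
  apply: (nf2 hK).
  - by exists (P i x0); exists i => //=; exists x0.
  - exists (~` B); first exact: closed_openC.
    apply/seteqP; split=> x; first by move=> Ax; split; [exact: AK|exact: AB].
    by move=> [/AUB[]].
  - exists A => //; apply/seteqP; split=> x; first by move=> Ax; split=> //; exact: AK.
    by case.
have : A (P j x0) by rewrite AE; exact: K_Psi.
by move=> /AB; apply; exists j => //; exists x0.
Qed.

(** * The levels [F_m] of a nested fractal as a hierarchy *)

Context (o : 'cV[R]_d) (Wo : W o) (i0 : 'I_M) (o_fix : P i0 o = o).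
Local Notation up m := (iter m (Psi_inv S i0)).
Local Notation down m := (iter m (P i0)).

Lemma upK m : cancel (up m) (down m).
Proof. by elim: m => // m IH x; rewrite iterSr iterS Psi_invK IH. Qed.

Lemma downK m : cancel (down m) (up m).
Proof. by elim: m => // m IH x; rewrite iterSr iterS PsiK IH. Qed.

Lemma in_vertices m z : vertices (Fm S i0 m) z <->
  exists w p, [/\ size w = m, W p & z = up m (Pw w p)].
Proof.
split=> [[w sw [p Wp <-]]|[w [p [sw Wp ->]]]]; first by exists w, p.
by exists w => //; exists p.
Qed.

Lemma in_edges m e : edges (Fm S i0 m) e <->
  exists w p q, [/\ size w = m, nearest p q & e = [fset up m (Pw w p); up m (Pw w q)]%fset].
Proof.
split=> [[w sw [_ [p [q [Wp Wq pq h ->]]] <-]]|[w [p [q [sw [Wp Wq pq h] ->]]]]].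
  by exists w, p, q; split=> //; exact: imfset_fset2.
exists w => //; exists [fset p; q]%fset; first by exists p, q.
exact: imfset_fset2.
Qed.

Lemma finite_words m : finite_set [set w : seq 'I_M | size w = m].
Proof.
apply: (@sub_finite_set _ _ [set val t | t in [set: m.-tuple 'I_M]]).
  by move=> w /= /eqP sw; exists (Tuple sw).
by apply: finite_image; exact: finite_finset.
Qed.

Lemma finite_vertices m : finite_set (vertices (Fm S i0 m)).
Proof.
apply: (@sub_finite_set _ _ ((fun t => up m (Pw t.1 t.2)) @` ([set w : seq 'I_M | size w = m] `*` W))).
  by move=> z /in_vertices[w [p [sw Wp ->]]]; exists (w, p).
by apply: finite_image; apply: finite_setX; [exact: finite_words|exact: finite_V0].
Qed.

Lemma finite_edges m : finite_set (edges (Fm S i0 m)).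
Proof.
apply: (@sub_finite_set _ _ ((fun t => [fset up m (Pw t.1 t.2.1); up m (Pw t.1 t.2.2)]%fset) @`
    ([set w : seq 'I_M | size w = m] `*` (W `*` W)))).
  by move=> e /in_edges[w [p [q [sw [Wp Wq _ _] ->]]]]; exists (w, (p, q)).
apply: finite_image; apply: finite_setX; first exact: finite_words.
by apply: finite_setX; exact: finite_V0.
Qed.

Lemma finite_boundary m : finite_set (boundary S i0 m).
Proof. by apply: finite_image; exact: finite_V0. Qed.

Definition levelV m := fset_set (vertices (Fm S i0 m)).
Definition levelE m := fset_set (edges (Fm S i0 m)).
Definition levelB m := fset_set (boundary S i0 m).
(** Shrinks [F_m] into [K], moves it into the cell of [i] and blows up by one level more; for [i0]
    this is the identity. *)
Definition cell_map m i x := up m.+1 (P i (down m x)).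

Lemma levelVP m z : z \in levelV m <-> exists w p, [/\ size w = m, W p & z = up m (Pw w p)].
Proof. by rewrite -in_vertices in_fset_set; [rewrite inE|exact: finite_vertices]. Qed.

Lemma levelEP m e : e \in levelE m <->
  exists w p q, [/\ size w = m, nearest p q & e = [fset up m (Pw w p); up m (Pw w q)]%fset].
Proof. by rewrite -in_edges in_fset_set; [rewrite inE|exact: finite_edges]. Qed.

Lemma levelBP m z : z \in levelB m <-> exists2 p, W p & z = up m p.
Proof.
rewrite in_fset_set; last exact: finite_boundary.
by rewrite inE; split=> [[p Wp <-]|[p Wp ->]]; exists p.
Qed.

Lemma levelV_K m z : z \in levelV m -> K (down m z).
Proof. by move=> /levelVP[w [p [_ Wp ->]]]; rewrite upK; apply: K_word; exact: V0_K. Qed.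

Lemma cell_map_up m i x : cell_map m i (up m x) = up m.+1 (P i x).
Proof. by rewrite /cell_map upK. Qed.

Lemma cell_map_eq m i j x y : cell_map m i x = cell_map m j y -> P i (down m x) = P j (down m y).
Proof. exact: (can_inj (upK m.+1)). Qed.

Lemma cell_map_inj m i : injective (cell_map m i).
Proof. by move=> x y /cell_map_eq /Psi_inj /(can_inj (downK m)). Qed.

Lemma cell_map_i0 m x : cell_map m i0 x = x.
Proof. by rewrite /cell_map -iterS downK. Qed.

Lemma levelV_S m z : z \in levelV m.+1 <-> exists i x, x \in levelV m /\ z = cell_map m i x.
Proof.
rewrite levelVP; split.
  move=> [[|i w] [p [//= [sw] Wp ->]]]; exists i, (up m (Pw w p)).
  by rewrite cell_map_up levelVP; split=> //; exists w, p.
move=> [i [x [/levelVP[w [p [sw Wp ->]]] ->]]]; exists (i :: w), p.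
by rewrite /= sw cell_map_up.
Qed.

Lemma levelE_S m e : e \in levelE m.+1 <->
  exists i e0, e0 \in levelE m /\ e = [fset cell_map m i x | x in (e0 : {fset _})]%fset.
Proof.
rewrite levelEP; split.
  move=> [[|i w] [p [q [//= [sw] n ->]]]]; exists i, [fset up m (Pw w p); up m (Pw w q)]%fset.
  by rewrite imfset_fset2 !cell_map_up levelEP; split=> //; exists w, p, q.
move=> [i [e0 [/levelEP[w [p [q [sw n ->]]]] ->]]]; exists (i :: w), p, q.
by rewrite /= sw imfset_fset2 !cell_map_up.
Qed.

Lemma levelE_simple m : simple (levelE m).
Proof.
move=> e /levelEP[w [p [q [sw [_ _ pq _] ->]]]].
exists (up m (Pw w p)), (up m (Pw w q)); split=> //.
by rewrite (inj_eq (can_inj (upK m))) (inj_eq (@word_inj w)).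
Qed.

Lemma levelE_V m e x : e \in levelE m -> x \in e -> x \in levelV m.
Proof.
move=> /levelEP[w [p [q [sw [Wp Wq _ _] ->]]]]; rewrite in_fset2 => /orP[]/eqP->; apply/levelVP.
  by exists w, p.
by exists w, q.
Qed.

Lemma level_meet m i j x y : i != j -> x \in levelV m -> y \in levelV m ->
  cell_map m i x = cell_map m j y ->
  [/\ W (down m x), W (down m y) & P i (down m x) = P j (down m y)].
Proof.
move=> ij /levelV_K Kx /levelV_K Ky /cell_map_eq e.
have ij' : [:: i] != [:: j] by rewrite eqseq_cons (negPf ij).
by have [Wx Wy] := @word_cells_meet [:: i] [:: j] _ _ erefl ij' Kx Ky e.
Qed.

Lemma level_meetB m i j x y : i != j -> x \in levelV m -> y \in levelV m ->
  cell_map m i x = cell_map m j y -> x \in levelB m /\ y \in levelB m.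
Proof.
move=> ij xV yV /(level_meet ij xV yV)[Wx Wy _]; rewrite !levelBP.
by split; [exists (down m x)|exists (down m y)]; rewrite // downK.
Qed.

Lemma level_meet1 m i j x y x' y' : i != j -> x \in levelV m -> y \in levelV m ->
  x' \in levelV m -> y' \in levelV m -> cell_map m i x = cell_map m j y ->
  cell_map m i x' = cell_map m j y' -> x = x'.
Proof.
move=> ij xV yV x'V y'V /(level_meet ij xV yV)[Wx Wy e] /(level_meet ij x'V y'V)[Wx' Wy' e'].
have ij' : [:: i] != [:: j] by rewrite eqseq_cons (negPf ij).
apply: (can_inj (downK m)); apply: (@Psi_inj i).
apply: (hS ij') => //.
  by split; [exists (down m x)|exists (down m y)].
by split; [exists (down m x')|exists (down m y')].
Qed.

Lemma levelB_V m x : x \in levelB m -> x \in levelV m.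
Proof.
move=> /levelBP[p Wp ->]; have [i ip] := V0_fix Wp; apply/levelVP.
exists (nseq m i), p; rewrite size_nseq word_nseq; split=> //.
by congr (up m _); elim: m => //= m <-.
Qed.

Lemma levelB_cell m z : z \in levelB m.+1 -> exists i x, x \in levelB m /\ z = cell_map m i x.
Proof.
move=> /levelBP[p Wp ->]; have [i ip] := V0_fix Wp; exists i, (up m p).
by rewrite levelBP cell_map_up ip; split=> //; exists p.
Qed.

Lemma levelB_one m z i j x y : z \in levelB m.+1 -> x \in levelV m -> y \in levelV m ->
  z = cell_map m i x -> z = cell_map m j y -> i = j.
Proof.
move=> /levelBP[p Wp ->] /levelV_K Kx /levelV_K Ky /(can_inj (upK _)) px /(can_inj (upK _)) py.
have [l lp] := V0_fix Wp.
by rewrite (V0_index Wp lp Kx (esym px)) (V0_index Wp lp Ky (esym py)).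
Qed.

Lemma levelB_uniq m z z' i x x' : z \in levelB m.+1 -> z' \in levelB m.+1 ->
  x \in levelV m -> x' \in levelV m -> z = cell_map m i x -> z' = cell_map m i x' -> z = z'.
Proof.
move=> /levelBP[p Wp ->] /levelBP[q Wq ->] /levelV_K Kx /levelV_K Ky.
move=> /(can_inj (upK _)) px /(can_inj (upK _)) py; congr (up m.+1 _).
exact: (V0_cell Wp Wq Kx Ky (esym px) (esym py)).
Qed.

Lemma levelV0 : levelV 0 = levelB 0.
Proof.
apply/fsetP => z; apply/idP/idP => [/levelVP[w [p [/size0nil -> Wp ->]]]|].
  by apply/levelBP; exists p.
exact: levelB_V.
Qed.

Lemma up_o m : up m o = o.
Proof. by elim: m => //= m ->; rewrite -{1}o_fix PsiK. Qed.

Lemma o_levelB m : o \in levelB m.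
Proof. by apply/levelBP; exists o; rewrite ?up_o. Qed.

Lemma card_levelB m : #|` levelB m| = #|` fset_set W|.
Proof.
have -> : levelB m = [fset up m x | x in fset_set W]%fset.
  apply/fsetP => z; apply/idP/imfsetP => [/levelBP[p Wp ->]|[p /in_V0 Wp ->]].
    by exists p => //; apply/in_V0.
  by apply/levelBP; exists p.
by apply: card_imfset; exact: can_inj (upK m).
Qed.

Lemma levelB_two m : exists2 x, x \in levelB m & x != o.
Proof.
have c2 : (1 < #|` levelB m|)%N by rewrite card_levelB; exact: nf_boundary hK.
have : (0 < #|` (levelB m `\ o)%fset|)%N.
  by move: c2; rewrite (cardfsD1 o) o_levelB.
by rewrite cardfs_gt0 => /fset0Pn[x]; rewrite !inE => /andP[xo xB]; exists x.
Qed.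

Lemma adj_level m (u v : 'cV[R]_d) : adj (levelE m) u v = step m (down m u) (down m v).
Proof.
apply/idP/idP => [/levelEP[w [p [q [sw n e]]]]|/asboolP[w [p [q [sw n eu ev]]]]].
  have s1 : step m (Pw w p) (Pw w q) by apply/asboolP; exists w, p, q.
  have [[-> ->]|[-> ->]] := fset2_eq e; rewrite !upK //; exact: step_sym.
by apply/levelEP; exists w, p, q; rewrite -eu -ev !downK.
Qed.

Lemma path_level m x (p : seq 'cV[R]_d) :
  path (adj (levelE m)) x p = path (step m) (down m x) (map (down m) p).
Proof. by rewrite path_map; apply: eq_path => u v; rewrite /relpre /= adj_level. Qed.

Lemma joined_level m x y n : joined m (down m x) (down m y) n ->
  exists p : seq _, [/\ path (adj (levelE m)) x p, last x p = y & (size p <= n)%N].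
Proof.
move=> [p [pp lp sp]]; exists (map (up m) p); rewrite size_map; split=> //.
  by rewrite path_level mapK //; exact: upK.
by rewrite -{1}(downK m x) last_map lp downK.
Qed.

Lemma level_auto m x y : x \in levelB m -> y \in levelB m -> exists phi : _ -> _,
  [/\ injective phi, phi x = y, {in levelB m, forall z, phi z \in levelB m} &
    forall u v : 'cV[R]_d, [fset u; v]%fset \in levelE m -> [fset phi u; phi v]%fset \in levelE m].
Proof.
move=> /levelBP[a Wa ->] /levelBP[b Wb ->].
exists (fun z => up m (refl a b (down m z))); split.
- by move=> u v /(can_inj (upK m)) /reflection_inj /(can_inj (downK m)).
- by rewrite upK reflection_l.
- move=> z /levelBP[p Wp ->]; apply/levelBP; exists (refl a b p); first exact: refl_V0.
  by rewrite upK.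
- move=> u v; rewrite -!/(adj _ _ _) !adj_level !upK; exact: step_refl.
Qed.

Lemma level_conn0 x y : x \in levelV 0 -> y \in levelV 0 ->
  exists2 p : seq _, path (adj (levelE 0)) x p & last x p = y.
Proof.
rewrite levelV0 => /levelBP[a Wa ->] /levelBP[b Wb ->].
by have [p [pp lp _]] := @joined_level 0 a b _ (F0_joined Wa Wb); exists p.
Qed.

Lemma level_conn : exists r : rel 'I_M, (forall i j, connect r i j) /\
  forall m i j, r i j -> exists x y,
    [/\ x \in levelB m, y \in levelB m & cell_map m i x = cell_map m j y].
Proof.
exists touch; split; first exact: touch_connect.
move=> m i j /asboolP[p [q [Wp Wq e]]]; exists (up m p), (up m q).
by rewrite !cell_map_up e; split=> //; apply/levelBP; [exists p|exists q].
Qed.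

Lemma level_fold : exists A : nat, forall m x y (p : seq _) x' y',
  x \in levelB m -> y \in levelB m -> x != y -> path (adj (levelE m)) x p -> last x p = y ->
  x' \in levelB m -> y' \in levelB m ->
  exists p' : seq _, [/\ path (adj (levelE m)) x' p', last x' p' = y' & (size p' <= A * size p)%N].
Proof.
exists (c * (2 + 2 * c))%N => m x y p x' y' /levelBP[a Wa ->] /levelBP[b Wb ->] ab pp lp.
move=> /levelBP[a' Wa' ->] /levelBP[b' Wb' ->]; apply: joined_level; rewrite !upK.
rewrite path_level upK in pp; rewrite -(size_map (down m) p).
apply: (fold_joined Wa Wb _ pp _ Wa' Wb').
  by apply: contra ab => /eqP->.
by rewrite -{1}(upK m a) last_map lp upK.
Qed.

Lemma card_levelB0 m : #|` levelB m| = #|` levelB 0|.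
Proof. by rewrite !card_levelB. Qed.

Definition nested_hierarchy : hierarchy 'cV[R]_d M :=
  Hierarchy cell_map_inj cell_map_i0 levelV_S levelE_S levelE_simple levelE_V
    level_meetB level_meet1 levelB_V levelB_cell levelB_one levelB_uniq levelV0 o_levelB
    card_levelB0 levelB_two level_auto level_conn0 level_conn level_fold.

End Nested.

(** * The canonical graph as a hierarchy *)

Section Model.
Context {R : realType} {d M : nat} (S : similitudes R d M) (K : set 'cV[R]_d).
Context (hK : nested_fractal S K) (hS : one_point_intersection S).
Context (O : 'cV[R]_d) (hO : V0 S O) (i0 : 'I_M) (hfix : Psi S i0 O = O).
Local Notation h := (nested_hierarchy hK hS hO hfix).

Lemma mem_hE m e : (e \in hE h m) <-> edges (Fm S i0 m) e.
Proof. by rewrite in_fset_set; [rewrite inE|exact: finite_edges hK i0 m]. Qed.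

Lemma mem_hB m z : (z \in hB h m) <-> boundary S i0 m z.
Proof. by rewrite in_fset_set; [rewrite inE|exact: finite_boundary hK i0 m]. Qed.

Lemma mem_hV m z : (z \in hV h m) <-> vertices (Fm S i0 m) z.
Proof. by rewrite in_fset_set; [rewrite inE|exact: finite_vertices hK i0 m]. Qed.

(** One inclusion is clear, and [nsaw_O] gives the reverse inequality of cardinalities. *)
Lemma saws_stable n r : saws (hE h (r + n)) O n = saws (hE h n) O n.
Proof.
have sub : saws (hE h n) O n `<=` saws (hE h (r + n)) O n.
  move=> p [sp pp up]; split=> //; apply: sub_path pp => x y; apply: adj_sub.
  exact: E_sub.
apply/seteqP; split=> //.
have f1 := finite_saws (hE h (r + n)) O n; have f2 := finite_saws (hE h n) O n.
have le2 : (n <= 2 ^ n)%N by rewrite ltnW // ltn_expl.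
have cr : crossing h n n := crossing_le le2 (@crossing_exp _ _ h n).
have le : (nsaw (hE h (r + n)) O n <= nsaw (hE h n) O n)%N := nsaw_O r cr.
have : fset_set (saws (hE h n) O n) = fset_set (saws (hE h (r + n)) O n).
  by apply/eqP; rewrite eqEfcard le andbT; apply/fsubsetP => p; rewrite !in_fset_set // !inE; exact: sub.
by move=> /(congr1 (fun A => [set` A])); rewrite !fset_setK // => ->.
Qed.

Lemma path_level_finf x (p : seq 'cV[R]_d) :
  path (fun u v => `[< edges (Finf S i0) [fset u; v]%fset >]) x p ->
  exists m, path (adj (hE h m)) x p.
Proof.
elim: p x => [|y p IH] x /=; first by exists 0%N.
move=> /andP[/asboolP[m _ e] /IH[m' pp]]; exists (maxn m m').
apply/andP; split.
  rewrite -(subnK (leq_maxl m m')); apply: (adj_sub (E_sub h _ m)).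
  exact/mem_hE.
rewrite -(subnK (leq_maxr m m')); apply: sub_path pp => u v; apply: adj_sub.
exact: E_sub.
Qed.

Lemma saw_Finf n (s : n.+1.-tuple 'cV[R]_d) : saw (Finf S i0) O n s ->
  saws (hE h n) O n (behead s) /\ tval s = O :: behead s.
Proof.
case: s => -[//|x p] sp [xO sV us ss].
have {}xO : x = O by rewrite -xO /thead (tnth_nth x).
have sp' : size p = n by case/eqP: (sp).
rewrite /= in us ss sV *; rewrite xO in us ss *; split=> //.
have [m pp] := path_level_finf ss.
rewrite -(saws_stable n m); split=> //.
rewrite addnC; apply: sub_path pp => u v; apply: adj_sub; exact: E_sub.
Qed.

Lemma saws_Finf n p : saws (hE h n) O n p ->
  exists s : n.+1.-tuple _, saw (Finf S i0) O n s /\ tval s = O :: p.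
Proof.
move=> [sp pp up]; have sOp : size (O :: p) == n.+1 by rewrite /= sp.
exists (Tuple sOp); split=> //; split=> //.
- move=> x; rewrite /= inE => /orP[/eqP->|xp].
    by exists n => //; apply/mem_hV/hB_V/hO_B.
  case/splitPr: xp pp {sp up sOp} => p1 p2; rewrite cat_path /= => /and3P[_ e _].
  by exists n => //; apply/mem_hV; apply: (hE_V (h := h) e); rewrite fset22.
- rewrite /=; apply: sub_path pp => u v e; apply/asboolP; exists n => //.
  exact/mem_hE.
Qed.

Lemma saw_countE n : saw_count S i0 O n = H h n.
Proof.
have f1 := finite_saws (hE h n) O n.
have behead_inj (s t : n.+1.-tuple 'cV[R]_d) : saw (Finf S i0) O n s -> saw (Finf S i0) O n t ->
    behead s = behead t -> s = t.
  by move=> /saw_Finf[_ es] /saw_Finf[_ et] e; apply: val_inj; rewrite /= es et e.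
have f2 : finite_set (saw (Finf S i0) O n).
  by apply: (finite_set_inj f1 behead_inj) => s /saw_Finf[].
apply/eqP; rewrite eqn_leq; apply/andP; split.
  by apply: (count_set_inj f1 behead_inj) => s /saw_Finf[].
pose f p : n.+1.-tuple 'cV[R]_d := xget (nseq_tuple n.+1 O) [set s | tval s = O :: p].
have fE p : saws (hE h n) O n p -> saw (Finf S i0) O n (f p) /\ tval (f p) = O :: p.
  move=> /saws_Finf[s [hs es]]; rewrite /f; case: xgetP => [t _ /= et|/(_ s)]; last by case.
  by have -> : t = s by apply: val_inj; rewrite /= et es.
apply: (@count_set_inj _ _ _ _ f f2) => [p q /fE[_ ep] /fE[_ eq] e|p /fE[]//].
by move: ep; rewrite e eq => -[].
Qed.

Lemma in_bforests_boundary m G : G \in bforests h m <-> boundary_forest S i0 m G.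
Proof.
split=> [/in_bforests[sG lG G0 dG]|[G0 sG lG dG]].
  split=> // [e /(fsubsetP sG) /mem_hE//|x /dG /mem_hB//].
apply/in_bforests; split=> //; first by apply/fsubsetP => e /sG /mem_hE.
by move=> z /dG /mem_hB.
Qed.

Lemma finite_states : finite_set (states S).
Proof.
apply: (@sub_finite_set _ _ [set` fpowerset (fpowerset (fset_set (V0 S)))]); last exact: finite_fset.
move=> sigma [_ hs _] /=; rewrite fpowersetE; apply/fsubsetP => e /hs[_ eV].
by rewrite fpowersetE; apply/fsubsetP => x xe; apply/(in_V0 hK); exact: eV.
Qed.

Lemma embed_inj m : injective (embed S i0 m).
Proof. exact: can_inj (upK hK i0 m). Qed.

(** The trace is nonempty because a component has two different ends, both on the boundary. Hence
    the states exhaust the boundary forests, and [q] is at most the sum of the [Zm]. *)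
Lemma trace_state m G : G \in bforests h m -> exists2 sigma, states S sigma & forests S i0 m sigma G.
Proof.
move=> Gb; have /in_bforests[sG lG G0 dG] := Gb.
have siG : simple G by move=> e /(fsubsetP sG); exact: hE_simple.
have fT : finite_set (Defs.trace S i0 m G).
  apply: (@sub_finite_set _ _ [set` fpowerset (fset_set (V0 S))]); last exact: finite_fset.
  move=> e [s [x [y [_ Vx Vy _ ->]]]] /=; rewrite fpowersetE; apply/fsubsetP => z.
  by rewrite in_fset2 => /orP[]/eqP->; apply/(in_V0 hK).
pose sigma := fset_set (Defs.trace S i0 m G).
have sE e : e \in sigma -> Defs.trace S i0 m G e by rewrite in_fset_set // inE.
have tE e : e \in sigma -> exists s (x y : 'cV[R]_d), [/\ component_path G s,
    infix [:: embed S i0 m x; embed S i0 m y] (seq.filter (fun z => `[< boundary S i0 m z >]) s) &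
    e = [fset x; y]%fset].
  by move=> /sE[s [x [y [cs _ _ i E]]]]; exists s, x, y.
exists sigma; last first.
  by split; [exact/in_bforests_boundary|rewrite fset_setK].
split.
- have [x [p [cs dx dl xl]]] := component_two_leaves siG lG G0.
  have /mem_hB[u Vu ux] := dG _ dx; have /mem_hB[v Vv vl] := dG _ dl.
  pose D z : bool := `[< boundary S i0 m z >].
  have Dx : D x by apply/asboolP; exists u.
  have lF : last x p \in seq.filter D p.
    rewrite mem_filter; apply/andP; split; first by apply/asboolP; exists v.
    by have := mem_last x p; rewrite inE eq_sym (negbTE xl).
  case E : (seq.filter D p) => [|z r]; first by rewrite E in lF.
  have zD : z \in seq.filter D p by rewrite E inE eqxx.
  move: zD; rewrite mem_filter => /andP[/asboolP[t Vt tz] _].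
  apply/fset0Pn; exists [fset u; t]%fset; rewrite in_fset_set // inE.
  exists (x :: p), u, t; split=> //.
  rewrite /= -/(D x) Dx -/D E ux tz; apply/infixP; by exists [::], r.
- move=> e es; have := trace_simple siG lG tE es => -[x [y [xy Ee]]].
  split; first by rewrite Ee cardfs2 xy.
  have [s [x' [y' [_ Vx Vy _ ->]]]] := sE _ es.
  by move=> z; rewrite /= in_fset2 => /orP[]/eqP->.
- exact: (trace_linear_forest (@embed_inj m) siG lG tE).
Qed.

Lemma forests_sub m sigma : forests S i0 m sigma `<=` [set` bforests h m].
Proof. by move=> G [/in_bforests_boundary]. Qed.

Lemma finite_forests m sigma : finite_set (forests S i0 m sigma).
Proof. by apply: sub_finite_set (@forests_sub m sigma) _; exact: finite_fset. Qed.

Lemma ZmE m sigma beta :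
  Zm S i0 m sigma beta = wsum (fset_set (forests S i0 m sigma)) (expR (- beta)).
Proof.
rewrite /Zm fsbig_finite; last exact: finite_forests.
by apply: eq_bigr => G _; rewrite expRM_natr.
Qed.

Lemma Zm_ge0 m sigma beta : 0 <= Zm S i0 m sigma beta.
Proof. by rewrite ZmE wsum_ge0 // expR_ge0. Qed.

Lemma Zm_le m sigma beta : Zm S i0 m sigma beta <= q h m (expR (- beta)).
Proof.
rewrite ZmE; apply: wsum_sub; first exact: expR_ge0.
apply/fsubsetP => G; rewrite in_fset_set; last exact: finite_forests.
by rewrite inE => /forests_sub.
Qed.

Lemma q_le m beta : q h m (expR (- beta)) <= \sum_(sigma <- fset_set (states S)) Zm S i0 m sigma beta.
Proof.
rewrite /q /wsum; under [leRHS]eq_bigr do rewrite ZmE /wsum.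
set x := expR _; have x0 : 0 <= x by exact: expR_ge0.
pose B sigma := fset_set (forests S i0 m sigma).
apply: (le_trans (y := \sum_(G <- bforests h m) \sum_(sigma <- fset_set (states S))
    (if G \in B sigma then x ^+ #|` G| else 0))).
  rewrite !big_seq; apply: ler_sum => G /trace_state[sigma st fG].
  have sS : sigma \in fset_set (states S) by rewrite in_fset_set ?inE //; exact: finite_states.
  rewrite (big_fsetD1 sigma) //= /B in_fset_set; last exact: finite_forests.
  rewrite mem_set // lerDl; apply: sumr_ge0 => t _; case: ifP => // _; exact: exprn_ge0.
rewrite exchange_big /=; apply: ler_sum => sigma _.
rewrite -big_mkcond /= -big_filter.
apply: (ler_sum_inj (h := id) (F := fun G : {fset {fset 'cV[R]_d}} => x ^+ #|` G|)) => //.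
- by rewrite filter_uniq ?fset_uniq.
- by move=> G; rewrite mem_filter => /andP[].
- by move=> G; exact: exprn_ge0.
Qed.

(** There are finitely many states, each [Zm] is at most [q], and [q] is at most their sum; so the
    maximum over the states and the total weight are bounded together. *)
Lemma bounded_betasE beta : bounded_betas S i0 beta <-> 0 <= beta /\ zbounded h beta.
Proof.
split=> -[b0 hb]; split=> //.
  have [C hC] : exists C : R, forall m sigma, states S sigma -> Zm S i0 m sigma beta <= C.
    have le m sigma : states S sigma ->
        ((Zm S i0 m sigma beta)%:E <= ereal_sup [set Z_norm S i0 m beta | m in [set: nat]])%E.
      move=> st; apply: (@le_trans _ _ (Z_norm S i0 m beta)).
        apply: ereal_sup_ubound; exists sigma => //.
        by rewrite ger0_norm // Zm_ge0.
      by apply: ereal_sup_ubound; exists m.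
    move: hb le; case: (ereal_sup _) => [r|//|] _ le.
      by exists r => m sigma st; have := le m sigma st; rewrite lee_fin.
    (* The supremum is [-oo] only if there is no state; then any bound will do. *)
    by exists 0 => m sigma st; have := le m sigma st; rewrite leeNy_eq.
  exists (#|` fset_set (states S)|%:R * C) => m; apply: le_trans (q_le m beta) _.
  rewrite mulr_natl -[leRHS]iter_addr_0 -count_predT -big_const_seq !big_seq.
  apply: ler_sum => sigma; rewrite in_fset_set; last exact: finite_states.
  by rewrite inE; exact: hC.
have [Q hQ] := hb; apply: (@le_lt_trans _ _ Q%:E); last exact: ltry.
apply: ge_ereal_sup => _ [m _ <-]; apply: ge_ereal_sup => _ [sigma _ <-].
by rewrite lee_fin ger0_norm ?Zm_ge0 //; apply: le_trans (Zm_le _ _ _) (hQ m).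
Qed.

(** Real form of [beta_c]; the set is nonempty and bounded below by 0, so both infima agree. *)
Definition bc : R := inf (bounded_betas S i0).

Lemma bounded_betas_neq0 : bounded_betas S i0 !=set0.
Proof. by have [beta b0 zb] := @zbounded_exists R _ _ h; exists beta; apply/bounded_betasE. Qed.

Lemma bounded_betas_lb : lbound (bounded_betas S i0) 0.
Proof. by move=> beta []. Qed.

Lemma bc_ge0 : 0 <= bc.
Proof. exact: lb_le_inf bounded_betas_neq0 bounded_betas_lb. Qed.

Lemma beta_cE : beta_c S i0 = bc%:E.
Proof.
rewrite /beta_c ereal_inf_EFin //; last exact: bounded_betas_neq0.
by exists 0; exact: bounded_betas_lb.
Qed.

Lemma bc_critical beta : 0 <= beta -> beta < bc -> ~ zbounded h beta.
Proof.
move=> b0; rewrite ltNge => /negP bb zb; apply: bb; apply: ge_inf.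
  by exists 0; exact: bounded_betas_lb.
exact/bounded_betasE.
Qed.

Lemma upper_bc gam : bc < gam -> upper h gam.
Proof.
move=> lt; have hi : has_inf (bounded_betas S i0).
  by split; [exact: bounded_betas_neq0|exists 0; exact: bounded_betas_lb].
have d0 : 0 < gam - bc by rewrite subr_gt0.
have [beta hb] := inf_adherent d0 hi; rewrite -/bc addrC subrK => bg.
by have [_ zb] := (bounded_betasE beta).1 hb; exact: upper_of_zbounded zb bg.
Qed.

Lemma saw_root_cvg : saw_root S i0 O @ \oo --> expR bc.
Proof.
have lo eta : 0 < eta -> exists n0, forall n, (n0 <= n)%N -> expR ((bc - eta) * n%:R) <= (H h n)%:R.
  exact: (lower_limit bc_ge0 bc_critical upper_bc).
have [n1 hn1] := lo 1 ltr01.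
have Hpos n : (n1 <= n)%N -> 0 < (H h n)%:R :> R.
  by move=> /hn1; apply: lt_le_trans; exact: expR_gt0.
pose s n : R := n%:R^-1 * ln (H h n)%:R.
have : s @ \oo --> bc.
  apply/cvgrPdist_le => e e0; have e2 : 0 < e / 2 by rewrite divr_gt0.
  have [n2 hn2] := lo e e0.
  (* For large [n] the constant [A] is absorbed by the remaining [e / 2]. *)
  have [A [A1 hA]] : upper h (bc + e / 2) by apply: upper_bc; rewrite ltrDl.
  have [n3 hn3] := poly_le_expR A 0 e2.
  exists (maxn (maxn n1 n2) n3).+1 => // n /=; rewrite gtn_max gtn_max => /andP[/andP[h1 h2] h3].
  have n0 : 0 < n%:R :> R by rewrite ltr0n; apply: leq_ltn_trans h1.
  have Hn := Hpos n (ltnW h1).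
  have l1 := hn2 n (ltnW h2); rewrite -ler_ln ?posrE ?expR_gt0 // expRK in l1.
  have l2 : (H h n)%:R <= expR ((bc + e) * n%:R).
    apply: le_trans (hA n O n) _; have := hn3 n (ltnW h3); rewrite expr0 mulr1 => hAe.
    apply: le_trans (ler_wpM2r (expR_ge0 _) hAe) _.
    rewrite -expRD ler_expR -mulrDl ler_wpM2r // ; lra.
  rewrite -ler_ln ?posrE ?expR_gt0 // expRK in l2.
  have sE : ln (H h n)%:R = s n * n%:R by rewrite /s mulrAC mulVf ?gt_eqF // mul1r.
  rewrite sE ler_pM2r // in l1; rewrite sE ler_pM2r // in l2.
  rewrite ler_norml; lra.
move=> /(continuous_cvg _ (@continuous_expR R bc)); apply: cvg_trans.
apply: near_eq_cvg; exists n1 => // n /= hn.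
rewrite /saw_root saw_countE /powR gt_eqF ?Hpos //.
Qed.

End Model.

Theorem theorem2 (R : realType) (d M : nat) (S : similitudes R d M)
    (K : set 'cV[R]_d) (hK : nested_fractal S K)
    (hS : one_point_intersection S)
    (O : 'cV[R]_d) (hO : V0 S O)
    (i0 : 'I_M) (hi0 : i0 = 0%N :> nat) (hfix : Psi S i0 O = O) :
  [/\ beta_c S i0 \is a fin_num,
      cvgn (saw_root S i0 O) &
      connective_constant S i0 O = expR (fine (beta_c S i0))] /\
  ((exists beta : R, bounded_betas S i0 beta /\ beta_c S i0 = beta%:E) ->
   exists A p : R, [/\ 1 <= A, 0 <= p &
     forall n : nat, (1 <= n)%N ->
       A^-1 * connective_constant S i0 O ^+ n * n%:R `^ (- p)
         <= (saw_count S i0 O n)%:R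
         <= A * connective_constant S i0 O ^+ n * n%:R `^ p]).
Proof.
have fr := saw_root_cvg hK hS hO hfix; have bE := beta_cE hK hS hO hfix.
have cE : connective_constant S i0 O = expR (bc S i0) by exact: cvg_lim fr.
split; first by split; [rewrite bE|apply/cvg_ex; exists (expR (bc S i0))|rewrite bE].
move=> [beta [hb]]; rewrite bE => -[be]; rewrite -be in hb.
have [_ zb] := (bounded_betasE hK hS hO hfix _).1 hb.
have [A [p [A1 hA]]] := critical_bounds (bc_ge0 hK hS hO hfix)
  (bc_critical (hK := hK) (hS := hS) (hO := hO) (hfix := hfix)) zb.
exists A, p%:R; split=> // n n1; have [up lo] := hA n n1.
rewrite cE (saw_countE hK hS hO hfix) powRN powR_mulrn // -expRM_natr; apply/andP; split=> //.
have A0 : 0 < A by apply: lt_le_trans A1.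
have np : 0 < n%:R ^+ p :> R by rewrite exprn_gt0 // ltr0n.
by rewrite ler_pdivrMr // ler_pdivrMl // mulrA.
Qed.
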